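(* Let $k$ be a field, let $X=\operatorname{Proj} R\subseteq\mathbb{P}^n$ be an irreducible projective scheme over $k$ of dimension at least $1$, and let $I=(F_0,\dots,F_m)\subseteq R$ be a homogeneous ideal generated by forms $F_0,\dots,F_m$ of the same degree $d$. Let $\phi:\widetilde{X}\to\bar{X}$ be the projection from the blowup of $X$ along the subscheme defined by $I$, and let $\operatorname{reg}(\phi)=\max\{\operatorname{reg}(\widetilde{X}_\wp)\mid\wp\in\bar{X}\}$, the maximum being over closed points $\wp$ of $\bar{X}$. Assume that each fiber $\widetilde{X}_\wp$ is an arithmetically Cohen-Macaulay scheme. Then for all $q\gg 0$, $$\operatorname{reg}(I^q)=qd+\operatorname{reg}(\phi).$$
   Context: $R$ is the standard graded homogeneous coordinate ring of $X\subseteq\mathbb{P}^n$. Rees algebra and blowup. $\mathcal{R}=R[It]=\bigoplus_{q\ge 0} I^q t^q$ is the Rees algebra of $I$, bigraded by $\mathcal{R}_{(p,q)}=(I^q)_{p+qd}\,t^q$ (so each $F_it$ has bidegree $(0,1)$, and elements of $R_1$ have bidegree $(1,0)$). $\widetilde{X}$ is the blowup of $X$ along the subscheme defined by $I$, identified with the bi-projective scheme $\operatorname{Proj}\mathcal{R}\subseteq\mathbb{P}^n\times\mathbb{P}^m$; $\phi$ is the restriction to $\widetilde{X}$ of the second projection $\mathbb{P}^n\times\mathbb{P}^m\to\mathbb{P}^m$, and $\bar{X}=\operatorname{image}(\phi)\subseteq\mathbb{P}^m$. The homogeneous coordinate ring of $\bar{X}$ is $S=k[F_0t,\dots,F_mt]=\bigoplus_q\mathcal{R}_{(0,q)}$.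 Fibers. For a closed point $\wp\in\bar{X}$, viewed as a homogeneous prime of $S$, the homogeneous localization $\mathcal{R}_{(\wp)}$ is the ring of elements of degree $0$ in $t$ of the localization of $\mathcal{R}$ at the homogeneous elements of $S\setminus\wp$. It is $\mathbb{N}$-graded by the first degree $p$. The fiber is $\widetilde{X}_\wp=\widetilde{X}\times_{\bar{X}}\operatorname{Spec}\mathcal{O}_{\bar{X},\wp}=\operatorname{Proj}\mathcal{R}_{(\wp)}$. The fiber $\widetilde{X}_\wp$ is called arithmetically Cohen-Macaulay if its homogeneous coordinate ring $\mathcal{R}_{(\wp)}$ is a Cohen-Macaulay ring. Invariants. For an $\mathbb{N}$-graded algebra $T$ with irrelevant ideal $T_+$ (generated by the elements of positive degree), $a^i(T)=\max\{l\mid [H^i_{T_+}(T)]_l\neq 0\}$, with $a^i(T)=-\infty$ if $H^i_{T_+}(T)=0$, and $\operatorname{reg}(T)=\max_{i\ge 0}\{a^i(T)+i\}$. For a finitely generated graded $R$-module $M$, such as $I^q$, $a^i(M)$ and $\operatorname{reg}(M)$ are defined in the same way using $H^i_{R_+}(M)$. Set $\operatorname{reg}(\widetilde{X}_\wp)=\operatorname{reg}(\mathcal{R}_{(\wp)})$. *)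

(* Defs.v *)
From HB Require Import structures.
From mathcomp Require Import all_boot all_order all_algebra.
From mathcomp Require Import all_classical constructive_ereal ring.

Set Implicit Arguments.
Unset Strict Implicit.
Unset Printing Implicit Defensive.

Import Order.TTheory GRing.Theory Num.Theory.
Local Open Scope classical_set_scope.
Local Open Scope ring_scope.
Local Open Scope quotient_scope.

(* Maxima of sets of integers. They are suprema in [int] with two infinities:
   the value is [-oo] on the empty set, and a finite value is attained. *)
Definition maxz (E : set (\bar int)) : \bar int := supremum -oo%E E.

Definition chain_dim (T : Type) (C : set (set T)) : \bar int :=
  maxz [set (r%:Z)%:E | r in [set r : nat | exists Z : nat -> set T,
    (forall i, (i <= r)%N -> C (Z i)) /\
    (forall i, (i < r)%N -> Z i `<` Z i.+1)]].

Section Ideals.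
Variable A : comPzRingType.
Implicit Types (J K : set A) (s : seq A).

Definition is_ideal J : Prop :=
  [/\ J 0, forall a b, J a -> J b -> J (a + b) & forall a b, J b -> J (a * b)].

Definition ideal_gen (E : set A) : set A := smallest is_ideal E.

Definition idealM J K : set A :=
  ideal_gen [set a * b | a in J & b in K].

Definition idealX J (q : nat) : set A := iter q (idealM J) [set: A].

Definition is_prime J : Prop :=
  [/\ is_ideal J, ~ J 1 & forall a b, J (a * b) -> J a \/ J b].

Definition is_maximal J : Prop :=
  [/\ is_ideal J, ~ J 1 &
      forall K, is_ideal K -> J `<=` K -> K = J \/ K = [set: A]].

Definition noetherian : Prop :=
  forall J, is_ideal J -> exists s, J = ideal_gen [set` s].

Definition krull_dim : \bar int := chain_dim is_prime.

Definition regular_seq s : Prop :=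
  (forall i, (i < size s)%N -> forall b,
     ideal_gen [set` take i s] (s`_i * b) -> ideal_gen [set` take i s] b) /\
  ~ ideal_gen [set` s] 1.

(* Depth of a local ring: a regular sequence generates a proper ideal, hence
   its members lie in the maximal ideal. *)
Definition depth : \bar int :=
  maxz [set ((size s)%:Z)%:E | s in regular_seq].

Record Spec := SpecPoint { spec_pt :> set A; specP : is_prime spec_pt }.

End Ideals.

Lemma ideal_gen_ideal (A : comPzRingType) (E : set A) :
  is_ideal (ideal_gen E).
Proof.
split=> [J [[]]//|a b Ja Jb J JE|a b Jb J JE]; have [[J0 JD JM] _] := JE.
  by apply: JD; [exact: (Ja J JE)|exact: (Jb J JE)].
by apply: JM; exact: (Jb J JE).
Qed.

Lemma idealX_ideal (A : comPzRingType) (J : set A) q : is_ideal (idealX J q).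
Proof. by case: q => [|q]; [split|exact: ideal_gen_ideal]. Qed.

Lemma is_idealB (A : comPzRingType) (J : set A) a b :
  is_ideal J -> J a -> J b -> J (a - b).
Proof.
by move=> [_ JD JM] Ja Jb; apply: JD => //; rewrite -mulN1r; apply: JM.
Qed.

Lemma is_ideal_sum (A : comPzRingType) (J : set A) (I : Type) (r : seq I)
    (P : pred I) (f : I -> A) : is_ideal J ->
  (forall i, P i -> J (f i)) -> J (\sum_(i <- r | P i) f i).
Proof. by move=> [J0 JD _] Jf; apply: (big_ind J). Qed.

Lemma idealXD (A : comPzRingType) (J : set A) p q a b :
  idealX J p a -> idealX J q b -> idealX J (p + q) (a * b).
Proof.
elim: p a => [|p IHp] a; first by case: (idealX_ideal J q) => _ _ H _ /H.
rewrite addSn => Ja Jb.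
apply: (Ja [set c | idealX J (p + q).+1 (c * b)]); split.
  have [J0 JD JM] := idealX_ideal J (p + q).+1; split=> /=.
  - by rewrite mul0r.
  - by move=> c e Jc Je; rewrite mulrDl; apply: JD.
  - by move=> c e Je; rewrite -mulrA; apply: JM.
move=> _ [c Jc [e Je <-]] /= K [_ JK]; apply: JK => /=.
by exists c => //; exists (e * b); [exact: IHp|rewrite mulrA].
Qed.

(* W^-1 M, for M a module over A and W a multiplicative subset of A: the
   quotient of M * W that identifies m / s and m' / s' when
   w (s' m - s m') = 0 for some w in W. *)
Section Localization.
Variables (A : comPzRingType) (W : mulrClosed A) (M : lmodType A).

Record mulset := MulSet { mulset_val : A; _ : mulset_val \in W }.
HB.instance Definition _ := [isSub for mulset_val].
HB.instance Definition _ := [Choice of mulset by <:].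

Definition frac_eq (x y : M * mulset) : bool :=
  `[< exists2 w : A, w \in W & w *: (val y.2 *: x.1 - val x.2 *: y.1) = 0 >].

Lemma frac_eq_refl : reflexive frac_eq.
Proof.
by move=> x; apply/asboolP; exists 1; rewrite ?rpred1// subrr scaler0.
Qed.

Lemma frac_eq_sym : symmetric frac_eq.
Proof.
suff H x y : frac_eq x y -> frac_eq y x by move=> x y; apply/idP/idP; apply: H.
move=> /asboolP[w Ww H]; apply/asboolP; exists w => //.
by rewrite -opprB scalerN H oppr0.
Qed.

Lemma frac_eq_trans : transitive frac_eq.
Proof.
move=> [y [s Ws]] [x [r Wr]] [z [t Wt]] /asboolP[/= v Wv xy] /asboolP[/= w Ww yz].
apply/asboolP => /=; exists (v * w * s); first by rewrite !rpredM.
have : (w * t) *: (v *: (s *: x - r *: y)) +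
       (v * r) *: (w *: (t *: y - s *: z)) = 0 by rewrite xy yz !scaler0 addr0.
rewrite !scalerBr !scalerA => <-.
rewrite addrA; have -> : w * t * v * r = v * r * w * t by ring.
by rewrite subrK; congr (_ *: x - _ *: z); ring.
Qed.

Canonical frac_equiv := EquivRel frac_eq frac_eq_refl frac_eq_sym frac_eq_trans.

Definition locm : Type := {eq_quot frac_eq}.
HB.instance Definition _ : EqQuotient _ frac_eq locm := EqQuotient.on locm.
HB.instance Definition _ := Choice.on locm.

Definition frac (m : M) (s : mulset) : locm := \pi_locm (m, s).

Lemma fracP m s m' s' : reflect
  (exists2 w : A, w \in W & w *: (val s' *: m - val s *: m') = 0)
  (frac m s == frac m' s').
Proof. by apply: (iffP idP) => [/eqP/eqmodP/asboolP|?]; last exact/eqP/eqmodP/asboolP. Qed.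

Lemma locmW (P : locm -> Prop) : (forall m s, P (frac m s)) -> forall x, P x.
Proof. by move=> Pfrac x; rewrite -[x]reprK; case: (repr x) => m s; apply: Pfrac. Qed.

Definition mulset1 : mulset := MulSet (rpred1 W).
Definition mulsetM (s s' : mulset) : mulset := MulSet (rpredM (valP s) (valP s')).

Definition locm_add (x y : locm) : locm :=
  let: (m, s) := repr x in let: (m', s') := repr y in
  frac (val s' *: m + val s *: m') (mulsetM s s').
Definition locm_opp (x : locm) : locm :=
  let: (m, s) := repr x in frac (- m) s.

Lemma repr_frac m s : exists2 w : A, w \in W &
  w *: (val s *: (repr (frac m s)).1 - val (repr (frac m s)).2 *: m) = 0.
Proof. by apply/fracP; rewrite /frac -surjective_pairing reprK. Qed.

Lemma locm_addE m s m' s' : locm_add (frac m s) (frac m' s') =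
  frac (val s' *: m + val s *: m') (mulsetM s s').
Proof.
have [w Ww] := repr_frac m s; have [w' Ww'] := repr_frac m' s'.
rewrite /locm_add; case: (repr _) => n' r' /=; case: (repr _) => n r /= E' E.
apply/eqP/fracP; exists (w * w'); rewrite ?rpredM //=.
have <- : (w' * val s' * val r') *: (w *: (val s *: n - val r *: m)) +
   (w * val s * val r) *: (w' *: (val s' *: n' - val r' *: m')) = 0.
  by rewrite E E' !scaler0 addr0.
rewrite !(scalerDr, scalerN, scalerA, opprD) -!addrA; rewrite /=; congr (_ *: n + _).
  by ring.
rewrite [RHS]addrCA; congr (_ *: n' + (- (_ *: m) - _ *: m')); ring.
Qed.

Lemma locm_oppE m s : locm_opp (frac m s) = frac (- m) s.
Proof.
have [w Ww] := repr_frac m s; rewrite /locm_opp; case: (repr _) => n r /= E.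
apply/eqP/fracP; exists w => //=.
by rewrite !scalerN opprK addrC -opprB scalerN E oppr0.
Qed.

Lemma locm_addA : associative locm_add.
Proof.
elim/locmW => m s; elim/locmW => m' s'; elim/locmW => m'' s''.
rewrite !locm_addE; apply/eqP/fracP; exists 1; rewrite ?rpred1 //= scale1r.
apply/eqP; rewrite subr_eq0; apply/eqP; rewrite !(scalerDr, scalerA) -!addrA.
by congr (_ *: m + (_ *: m' + _ *: m'')); ring.
Qed.

Lemma locm_addC : commutative locm_add.
Proof.
elim/locmW => m s; elim/locmW => m' s'.
by rewrite !locm_addE addrC; congr frac; apply: val_inj; rewrite /= mulrC.
Qed.

Lemma locm_add0 : left_id (frac 0 mulset1) locm_add.
Proof.
elim/locmW => m s; rewrite locm_addE scaler0 add0r scale1r.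
by congr frac; apply: val_inj; rewrite /= mul1r.
Qed.

Lemma locm_addN : left_inverse (frac 0 mulset1) locm_opp locm_add.
Proof.
elim/locmW => m s; rewrite locm_oppE locm_addE -scalerDr addNr.
apply/eqP/fracP; exists 1; first exact: rpred1.
by rewrite !scaler0 subrr scaler0.
Qed.

HB.instance Definition _ :=
  GRing.isZmodule.Build locm locm_addA locm_addC locm_add0 locm_addN.

Lemma frac0 s : frac 0 s = 0.
Proof.
by apply/eqP/fracP; exists 1; rewrite ?rpred1// !scaler0 subrr scaler0.
Qed.

Lemma fracN m s : frac (- m) s = - frac m s.
Proof. by rewrite -locm_oppE. Qed.

Lemma fracD m s m' s' :
  frac m s + frac m' s' = frac (val s' *: m + val s *: m') (mulsetM s s').
Proof. exact: locm_addE. Qed.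

End Localization.

Arguments locm {A} W M.

Section Widen.
Variables (A : comPzRingType) (W W' : mulrClosed A) (M : lmodType A).
Hypothesis sWW' : {subset W <= W'}.

Definition locm_widen (x : locm W M) : locm W' M :=
  frac (repr x).1 (MulSet (sWW' (valP (repr x).2))).

Lemma locm_widenE m (s : mulset W) :
  locm_widen (frac m s) = frac m (MulSet (sWW' (valP s))).
Proof.
have [w Ww E] := repr_frac m s.
by apply/eqP/fracP; exists w => //; apply: sWW'.
Qed.

End Widen.

Section LocalizedRing.
Variables (A : comPzRingType) (W : mulrClosed A).

Definition locr : Type := locm W A^o.
HB.instance Definition _ := GRing.Zmodule.on locr.

Definition fracr (a : A) (s : mulset W) : locr := @frac A W A^o a s.

Definition locr_one : locr := fracr 1 (mulset1 W).
Definition locr_mul (x y : locr) : locr :=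
  fracr ((repr x).1 * (repr y).1) (mulsetM (repr x).2 (repr y).2).

Lemma fracrP a (s : mulset W) a' (s' : mulset W) : reflect
  (exists2 w : A, w \in W & w * (val s' * a - val s * a') = 0)
  (fracr a s == fracr a' s').
Proof. exact: (@fracP A W A^o a s a' s'). Qed.

Lemma locrW (P : locr -> Prop) : (forall a s, P (fracr a s)) -> forall x, P x.
Proof. exact: (@locmW A W A^o P). Qed.

Lemma fracrM a (s : mulset W) a' (s' : mulset W) :
  locr_mul (fracr a s) (fracr a' s') = fracr (a * a') (mulsetM s s').
Proof.
have [w Ww] := @repr_frac A W A^o a s; have [w' Ww'] := @repr_frac A W A^o a' s'.
rewrite -!/(fracr _ _) /locr_mul.
case: (repr _) => n' r' /=; case: (repr _) => n r /= E' E.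
apply/eqP/fracrP; exists (w * w'); rewrite ?rpredM //=.
have H (x x' y y' b b' c c' : A) :
    w * (x * b - y * c) = 0 -> w' * (x' * b' - y' * c') = 0 ->
    w * w' * (x * x' * (b * b') - y * y' * (c * c')) = 0.
  move=> Ew Ew'; transitivity ((w' * (x' * b')) * (w * (x * b - y * c)) +
    (w * (y * c)) * (w' * (x' * b' - y' * c'))); first by ring.
  by rewrite Ew Ew' !mulr0 addr0.
exact: H E E'.
Qed.

Lemma locr_mulA : associative locr_mul.
Proof.
elim/locrW => m s; elim/locrW => m' s'; elim/locrW => m'' s''.
rewrite !fracrM mulrA; congr fracr; apply: val_inj => /=; exact: mulrA.
Qed.

Lemma locr_mulC : commutative locr_mul.
Proof.
elim/locrW => m s; elim/locrW => m' s'.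
by rewrite !fracrM mulrC; congr fracr; apply: val_inj; rewrite /= mulrC.
Qed.

Lemma locr_mul1 : left_id locr_one locr_mul.
Proof.
elim/locrW => m s; rewrite fracrM mul1r.
by congr fracr; apply: val_inj; rewrite /= mul1r.
Qed.

Lemma locr_mulD : left_distributive locr_mul +%R.
Proof.
elim/locrW => m s; elim/locrW => m' s'; elim/locrW => m'' s''.
rewrite /fracr fracD -!/(fracr _ _) !fracrM /fracr fracD -!/(fracr _ _).
apply/eqP/fracrP; exists 1; rewrite ?rpred1 //= mul1r /GRing.scale /=.
have H (a a' a'' x x' x'' : A) : x * x'' * (x' * x'') * ((x' * a + x * a') * a'')
    - x * x' * x'' * (x' * x'' * (a * a'') + x * x'' * (a' * a'')) = 0 by ring.
exact: H.
Qed.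

HB.instance Definition _ := GRing.Zmodule_isComPzRing.Build locr
  locr_mulA locr_mulC locr_mul1 locr_mulD.

End LocalizedRing.

Section Primes.
Variables (A : comPzRingType).

Definition compl (P : Spec A) : {pred A} := [pred a | `[< ~ spec_pt P a >]].

Lemma complP (P : Spec A) a : reflect (~ spec_pt P a) (a \in compl P).
Proof. exact: asboolP. Qed.

Fact compl_mulr_closed (P : Spec A) : mulr_closed (compl P).
Proof.
have [[_ _ _] P1 PM] := specP P; split=> [|a b]; first exact/complP.
by move=> /complP nPa /complP nPb; apply/complP => /PM[].
Qed.
HB.instance Definition _ P :=
  GRing.isMulClosed.Build A (compl P) (compl_mulr_closed P).

Definition cohen_macaulay : Prop :=
  noetherian A /\
  forall P : Spec A, is_maximal P ->
    depth (locr (compl P)) = krull_dim (locr (compl P)).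

End Primes.

Section Graded.
Variables (A : comPzRingType) (G : nat -> set A).

Definition graded_ring : Prop :=
  [/\ forall p, G p 0 /\ (forall a b, G p a -> G p b -> G p (a - b)),
      G 0%N 1,
      forall p q a b, G p a -> G q b -> G (p + q)%N (a * b),
      forall a, exists N (c : nat -> A),
        (forall p, G p (c p)) /\ a = \sum_(p < N) c p &
      forall N (c : nat -> A), (forall p, G p (c p)) ->
        \sum_(p < N) c p = 0 -> forall p, (p < N)%N -> c p = 0].

Definition homogeneous (J : set A) : Prop :=
  forall N (c : nat -> A), (forall p, G p (c p)) ->
    J (\sum_(p < N) c p) -> forall p, (p < N)%N -> J (c p).

Definition irrelevant : set A := \bigcup_(p in [set p | (0 < p)%N]) G p.

Record Proj := ProjPoint {
  proj_pt :> Spec A;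
  proj_homogeneous : homogeneous proj_pt;
  proj_relevant : ~ (irrelevant `<=` proj_pt)
}.

Definition zariski_closed (Z : set Proj) : Prop :=
  exists J : set A, Z = [set P : Proj | J `<=` P].

Definition irreducible (Z : set Proj) : Prop :=
  Z !=set0 /\
  forall Z1 Z2, zariski_closed Z1 -> zariski_closed Z2 ->
    Z `<=` Z1 `|` Z2 -> Z `<=` Z1 \/ Z `<=` Z2.

Definition proj_dim : \bar int :=
  chain_dim [set Z | zariski_closed Z /\ irreducible Z].

Definition closed_point (P : Proj) : Prop := zariski_closed [set P].

End Graded.

Definition is_subring (A : pzRingType) (E : set A) : Prop :=
  [/\ E 1, forall a b, E a -> E b -> E (a - b)
         & forall a b, E a -> E b -> E (a * b)].

Definition subring_gen (A : pzRingType) (E : set A) : set A :=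
  smallest (@is_subring A) E.

(* The x i are the images in R of the homogeneous coordinates of the ambient
   projective space. *)
Definition standard_graded (k : fieldType) (R : comAlgType k)
    (G : nat -> set R) (r : nat) (x : 'I_r -> R) : Prop :=
  [/\ graded_ring G,
      G 0%N = range (fun c : k => c%:A),
      forall i, G 1%N (x i) &
      subring_gen (range (fun c : k => c%:A) `|` range x) = [set: R]].

(* Local cohomology of the graded module M = (+)_l GM l over the graded ring A,
   with support in the ideal generated by the homogeneous elements x i, is the
   cohomology of the Cech complex
     C^i = (+)_(#|s| = i) M_(x_s),   x_s = \prod_(j in s) x j.
   M_(x_s) is obtained by inverting the monomials in the x j, j in s. Cochains
   are total functions of s, supported on the s with i elements. *)
Section LocalCohomology.
Variables (A : comPzRingType) (GA : nat -> set A) (r : nat) (x : 'I_r -> A).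
Variables (M : lmodType A) (GM : nat -> set M).

Definition monomials (s : {set 'I_r}) : {pred A} :=
  [pred a | `[< exists e : 'I_r -> nat, a = \prod_(j in s) x j ^+ e j >]].

Lemma monomialsP (s : {set 'I_r}) a : reflect
  (exists e : 'I_r -> nat, a = \prod_(j in s) x j ^+ e j) (a \in monomials s).
Proof. exact: asboolP. Qed.

Fact monomials_mulr_closed s : mulr_closed (monomials s).
Proof.
split=> [|a b].
  by apply/monomialsP; exists (fun=> 0%N); rewrite big1 // => j _; rewrite expr0.
move=> /monomialsP[e ->] /monomialsP[f ->]; apply/monomialsP.
exists (fun j => (e j + f j)%N).
by rewrite -big_split /=; apply: eq_bigr => j _; rewrite exprD.
Qed.
HB.instance Definition _ s :=
  GRing.isMulClosed.Build A (monomials s) (monomials_mulr_closed s).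

Lemma monomialsS (s t : {set 'I_r}) :
  s \subset t -> {subset monomials s <= monomials t}.
Proof.
move=> /fintype.subsetP st a /monomialsP[e ->]; apply/monomialsP.
exists (fun j => if j \in s then e j else 0%N).
rewrite [RHS](bigID (mem s)) /= [X in _ * X]big1 ?mulr1; last first.
  by move=> j /andP[_ /negPf ->]; rewrite expr0.
rewrite [RHS](eq_bigl (mem s)) => [|j].
  by apply: eq_bigr => j /= ->.
by case sj: (j \in s); rewrite /= ?sj ?andbF // (st _ sj).
Qed.

Definition cochain : Type :=
  forall s : {set 'I_r}, locm (monomials s) M.

Definition cochain_in (i : nat) (c : cochain) : Prop :=
  forall s : {set 'I_r}, #|s| != i -> c s = 0.

Definition cochain_deg (l : int) (c : cochain) : Prop :=
  forall s : {set 'I_r}, c s = 0 \/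
    exists p e m (w : mulset (monomials s)),
      [/\ GM p m, GA e (val w), c s = frac m w & l = p%:Z - e%:Z].

Definition cech_d (c : cochain) : cochain := fun t =>
  \sum_(j in t) locm_widen (monomialsS (subD1set t j)) (c (t :\ j))
                  *~ ((-1) ^+ #|[set h in t | (h < j)%N]|).

(* The degree l part of H^i is nonzero. For i = 0 the only cochain b allowed
   below is 0. *)
Definition local_cohomology_neq0 (i : nat) (l : int) : Prop :=
  exists c : cochain,
    [/\ cochain_in i c, cochain_deg l c, forall t, cech_d c t = 0 &
        ~ exists b : cochain,
          [/\ forall s : {set 'I_r}, #|s|.+1 != i -> b s = 0, cochain_deg l b
            & forall t, cech_d b t = c t]].

Definition a_invariant (i : nat) : \bar int :=
  maxz [set l%:E | l in local_cohomology_neq0 i].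

Definition regularity : \bar int :=
  maxz [set (a_invariant i + (i%:Z)%:E)%E | i in [set: nat]].

End LocalCohomology.

Section Rees.
Variables (R : comNzRingType) (I : set R).

Definition powmod_pred (q : nat) : {pred R^o} :=
  [pred a : R^o | `[< idealX I q a >]].

Lemma powmodP q (a : R^o) : reflect (idealX I q a) (a \in powmod_pred q).
Proof. exact: asboolP. Qed.

Fact powmod_submod_closed q : submod_closed (powmod_pred q).
Proof.
have [J0 JD JM] := idealX_ideal I q; split=> [|c a b].
  exact/powmodP.
by move=> /powmodP Ja /powmodP Jb; apply/powmodP/JD => //; apply: JM.
Qed.
HB.instance Definition _ q :=
  GRing.isSubmodClosed.Build R R^o (powmod_pred q) (powmod_submod_closed q).

Record powmod (q : nat) :=
  PowMod { powmod_val : R^o; _ : powmod_val \in powmod_pred q }.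
HB.instance Definition _ q := [isSub for @powmod_val q].
HB.instance Definition _ q := [Choice of powmod q by <:].
HB.instance Definition _ q := [SubChoice_isSubLmodule of powmod q by <:].

Definition rees_pred : {pred {poly R}} :=
  [pred u : {poly R} | `[< forall q, idealX I q u`_q >]].

Lemma reesP (u : {poly R}) : reflect (forall q, idealX I q u`_q) (u \in rees_pred).
Proof. exact: asboolP. Qed.

Fact rees_subring_closed : subring_closed rees_pred.
Proof.
split=> [|u v|u v].
- apply/reesP => q; rewrite coef1; case: q => [|q] //=.
  by case: (idealX_ideal I q.+1).
- move=> /reesP Iu /reesP Iv; apply/reesP => q; rewrite coefB.
  by apply: is_idealB => //; apply: idealX_ideal.
move=> /reesP Iu /reesP Iv; apply/reesP => q; rewrite coefM.
apply: is_ideal_sum => [|i _]; first exact: idealX_ideal.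
by have := idealXD (Iu i) (Iv (q - i)%N); rewrite subnKC ?leq_ord.
Qed.
HB.instance Definition _ :=
  GRing.isSubringClosed.Build {poly R} rees_pred rees_subring_closed.

Record rees := Rees { rees_val : {poly R}; _ : rees_val \in rees_pred }.
HB.instance Definition _ := [isSub for rees_val].
HB.instance Definition _ := [Choice of rees by <:].
HB.instance Definition _ := [SubChoice_isSubComNzRing of rees by <:].

Definition rees_t (q : nat) : set rees :=
  [set u | exists a : R, val u = a *: 'X^q].

Definition rees_gr (G : nat -> set R) (d p q : nat) : set rees :=
  [set u | exists2 a : R, G (p + q * d)%N a & val u = a *: 'X^q].

Fact rees_cst_subproof (a : R) : a%:P \in rees_pred.
Proof.
apply/reesP => q; rewrite coefC; case: q => [|q] //=.
by case: (idealX_ideal I q.+1).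
Qed.
Definition rees_cst (a : R) : rees := Rees (rees_cst_subproof a).

Lemma rees_tM q q' u u' : rees_t q u -> rees_t q' u' -> rees_t (q + q') (u * u').
Proof.
move=> [a ua] [a' ua']; exists (a * a').
by rewrite rmorphM /= ua ua' -scalerAl -scalerAr scalerA exprD.
Qed.

Lemma rees_tB q u u' : rees_t q u -> rees_t q u' -> rees_t q (u - u').
Proof.
by move=> [a ua] [a' ua']; exists (a - a'); rewrite rmorphB /= ua ua' scalerBl.
Qed.

Lemma rees_t1 : rees_t 0 1.
Proof. by exists 1; rewrite rmorph1 scale1r expr0. Qed.

End Rees.

Section Fibers.
Variables (k : fieldType) (R : comAlgType k) (m : nat) (F : 'I_m -> R).

Definition base_ideal : set R := ideal_gen (range F).
Local Notation I := base_ideal.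

Definition image_gens : set (rees I) :=
  [set u | (exists c : k, val u = (c%:A)%:P) \/
           (exists i, val u = F i *: 'X)].

Definition image_pred : {pred rees I} :=
  [pred u | `[< subring_gen image_gens u >]].

Lemma imageP u : reflect (subring_gen image_gens u) (u \in image_pred).
Proof. exact: asboolP. Qed.

Fact image_subring_closed : subring_closed image_pred.
Proof.
split=> [|u v|u v].
- by apply/imageP => E [[]].
- move=> /imageP Su /imageP Sv; apply/imageP => E E_; have [[_ EB _] _] := E_.
  by apply: EB; [exact: (Su E E_)|exact: (Sv E E_)].
move=> /imageP Su /imageP Sv; apply/imageP => E E_; have [[_ _ EM] _] := E_.
by apply: EM; [exact: (Su E E_)|exact: (Sv E E_)].
Qed.
HB.instance Definition _ :=
  GRing.isSubringClosed.Build (rees I) image_pred image_subring_closed.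

(* S = k[F_0 t, ..., F_m t], as a subring of R[It]. *)
Record image_ring := ImageRing { image_val : rees I; _ : image_val \in image_pred }.
HB.instance Definition _ := [isSub for image_val].
HB.instance Definition _ := [Choice of image_ring by <:].
HB.instance Definition _ := [SubChoice_isSubComNzRing of image_ring by <:].

Definition image_gr (q : nat) : set image_ring :=
  [set s | rees_t q (val s)].

Section Fiber.
Variable P : Proj image_gr.

Definition denoms : {pred rees I} :=
  [pred u | `[< exists s : image_ring,
     [/\ val s = u, ~ spec_pt P s & exists q, image_gr q s] >]].

Lemma denomsP u : reflect (exists s : image_ring,
  [/\ val s = u, ~ spec_pt P s & exists q, image_gr q s]) (u \in denoms).
Proof. exact: asboolP. Qed.

Fact denoms_mulr_closed : mulr_closed denoms.
Proof.
have [[_ _ _] P1 PM] := specP P; split=> [|a b].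
  apply/denomsP; exists 1; split=> //.
  by exists 0%N; apply: (rees_t1 I).
move=> /denomsP[s [<- Ps [q sq]]] /denomsP[s' [<- Ps' [q' sq']]]; apply/denomsP.
exists (s * s'); split=> //.
  by case/PM.
by exists (q + q')%N; apply: (rees_tM sq sq').
Qed.
HB.instance Definition _ :=
  GRing.isMulClosed.Build (rees I) denoms denoms_mulr_closed.

Definition fiber_pred : {pred locr denoms} :=
  [pred y | `[< exists q u (w : mulset denoms),
     [/\ rees_t q u, rees_t q (val w) & y = fracr u w] >]].

Lemma fiberP y : reflect (exists q u (w : mulset denoms),
  [/\ rees_t q u, rees_t q (val w) & y = fracr u w]) (y \in fiber_pred).
Proof. exact: asboolP. Qed.

Fact fiber_subring_closed : subring_closed fiber_pred.
Proof.
split=> [|y y'|y y'].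
- by apply/fiberP; exists 0%N, 1, (mulset1 denoms); split=> //; apply: rees_t1.
- move=> /fiberP[q [u [w [uq wq ->]]]] /fiberP[q' [u' [w' [uq' wq' ->]]]].
  apply/fiberP; exists (q + q')%N, (val w' * u - val w * u'), (mulsetM w w').
  split; last by rewrite /fracr -fracN fracD scalerN.
    by apply: rees_tB; [rewrite addnC|]; apply: rees_tM.
  exact: rees_tM.
move=> /fiberP[q [u [w [uq wq ->]]]] /fiberP[q' [u' [w' [uq' wq' ->]]]].
apply/fiberP; exists (q + q')%N, (u * u'), (mulsetM w w').
by split; [exact: rees_tM..|rewrite -fracrM].
Qed.
HB.instance Definition _ :=
  GRing.isSubringClosed.Build (locr denoms) fiber_pred fiber_subring_closed.

(* The homogeneous coordinate ring of the fiber over P: the fractions of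
   degree 0 in t. *)
Record fiber := Fiber { fiber_val : locr denoms; _ : fiber_val \in fiber_pred }.
HB.instance Definition _ := [isSub for fiber_val].
HB.instance Definition _ := [Choice of fiber by <:].
HB.instance Definition _ := GRing.SubChoice_isSubComPzRing.Build
  (locr denoms) fiber_pred fiber (GRing.subringClosedP _).

Fact fiber_cst_subproof (a : R) :
  fracr (rees_cst I a) (mulset1 denoms) \in fiber_pred.
Proof.
apply/fiberP; exists 0%N, (rees_cst I a), (mulset1 denoms).
split=> //; last exact: rees_t1.
by exists a; rewrite expr0 alg_polyC.
Qed.
Definition fiber_cst (a : R) : fiber := Fiber (fiber_cst_subproof a).

Definition fiber_gr (G : nat -> set R) (d p : nat) : set fiber :=
  [set y | exists q u (w : mulset denoms),
     [/\ rees_gr G d p q u, rees_t q (val w) & val y = fracr u w]].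

End Fiber.

Variables (G : nat -> set R) (r : nat) (x : 'I_r -> R) (d : nat).

(* When R is generated by the x i, in degree 1, so is the algebra of the fiber
   over its degree 0 part: the images of the x i generate the irrelevant
   ideal. *)
Definition reg_fiber (P : Proj image_gr) : \bar int :=
  @regularity (fiber P) (fiber_gr G d) r (fiber_cst P \o x) (fiber P)^o
    (fiber_gr G d).

Definition reg_phi : \bar int :=
  maxz [set reg_fiber P | P in @closed_point _ image_gr].

Definition reg_pow (q : nat) : \bar int :=
  @regularity R G r x (powmod I q) (fun l => [set a | G l (val a)]).

End Fibers.

(* Main.v *)
Require Import Defs.
From HB Require Import structures.
From mathcomp Require Import all_boot all_order all_algebra.
From mathcomp Require Import all_classical constructive_ereal.
From mathcomp Require Import zify ring.

Set Implicit Arguments.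
Unset Strict Implicit.
Unset Printing Implicit Defensive.

Import Order.TTheory GRing.Theory Num.Theory.
Local Open Scope classical_set_scope.
Local Open Scope ring_scope.

(** Let [S] be the coordinate ring of the image. For fixed [i] and [p], the local
    cohomology modules [H^i(I^q)] in degree [p + q d] are the graded pieces, of
    degree [q], of one graded [S]-module [H i p]: the part of first degree [p] of the
    local cohomology of the Rees algebra with support in the ideal of the [x j].
    The localization of [H i p] at a closed point of the image is [H^i] of the fiber
    in degree [p]. So the regularity of [I^q], shifted by [q d], and the
    regularities of the fibers are read off the same modules, once two facts are
    known ([cohomology_finite]): [H i p] vanishes for all large [p], and each [H i p]
    is a noetherian [S]-module.

    If [H i p] has a nonzero localization, some class is killed by no power of a
    suitable [F i t], so that [H i p] is nonzero in all large degrees [q]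
    ([fiber_support_coh]). If all its localizations at closed points vanish, each
    class is killed by the elements of [S] of large degree, because a homogeneous
    ideal that contains no [S_N] lies in the ideal of a closed point
    ([closed_point_above]); as [H i p] is noetherian, it is then zero in all large
    degrees ([coh_fiber_support]). Now let [y] be the maximum of [p + i] over the pairs
    with a nonzero localization, which is the regularity of the morphism. The
    pairs with [p + i > y] and with [H i p] nonzero are finitely many, and for [q]
    large none of them contributes to the regularity of [I^q], while a pair that
    realizes the maximum does. If there is no pair with a nonzero
    localization, then there is no closed point at all, since the local cohomology of
    the coordinate ring of a fiber cannot vanish entirely
    ([cohomology_nonvanishing]), and [I^q] is zero for large [q].

    The finiteness is proved for all quotients [Z / B] of homogeneous ideals
    of the Rees algebra, by induction on the number of the [x j] that do not kill
    [Z / B]. If all of them do, the cohomology is [Z / B] itself, and the Rees algebra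
    is noetherian. Otherwise the kernel and the cokernel of the multiplication by some
    [x j] are controlled by induction. Hence the multiplication by [x j] on the
    cohomology is injective in large degrees, where the cohomology vanishes because it
    is torsion with respect to [x j]; and in each degree its kernel is noetherian, which
    allows a descending induction on the degree.

    Cohomology classes are represented by sequences of numerators of Čech cochains
    ([cochains]), which lie inside the ring [R] in the case of the Rees algebra;
    [local_cohomologyP] compares this with the Čech complex of localizations. *)

(** * Graded ideals and the basis theorem *)

Section GradedIdeals.
Variables (D : zmodType) (R : comPzRingType).
Implicit Types (A B N Z : D -> set R) (y : R) (g h : D).

(** A ring graded by [D] is given by its homogeneous pieces, which are subgroups
    of one ambient ring: the bigraded Rees algebra has the pieces
    [(I^q)_(p + q d)], all of them inside [R]. *)
Definition graded_pieces A : Prop :=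
  [/\ A 0 1, forall g a b, A g a -> A g b -> A g (a - b) &
      forall g h a b, A g a -> A h b -> A (g + h) (a * b)].

Definition gideal A N : Prop :=
  [/\ forall g, N g `<=` A g, forall g, N g 0,
      forall g a b, N g a -> N g b -> N g (a + b) &
      forall g h a b, A g a -> N h b -> N (g + h) (a * b)].

Definition gacc A B : Prop := forall N : nat -> D -> set R,
  (forall n, gideal A (N n)) -> (forall n g, B g `<=` N n g) ->
  (forall n g, N n g `<=` N n.+1 g) ->
  exists J, forall n g, N n g `<=` N J g.

Lemma chain_le (T : Type) (U : nat -> T -> Prop) (S : forall n t, U n t -> U n.+1 t)
  n m t : (n <= m)%N -> U n t -> U m t.
Proof.
by move=> /subnKC <-; elim: (m - n)%N => [|j IH] Ut; rewrite ?addn0 // addnS; apply/S/IH.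
Qed.

Section Ring.
Variable A : D -> set R.
Hypothesis hA : graded_pieces A.

Lemma piecesN g a : A g a -> A g (- a).
Proof. by have [_ AB _] := hA => Aa; rewrite -sub0r; apply: (AB) => //; rewrite -(subrr a); apply: AB. Qed.

Lemma piecesD g a b : A g a -> A g b -> A g (a + b).
Proof. by have [_ AB _] := hA => Aa Ab; rewrite -[b]opprK; apply: (AB) => //; apply: piecesN. Qed.

Lemma piecesN1 : A 0 (-1).
Proof. by have [A1 _ _] := hA; apply: piecesN. Qed.

Lemma pieces_sum g (I : Type) (r : seq I) (P : pred I) (f : I -> R) :
  A g 0 -> (forall i, P i -> A g (f i)) -> A g (\sum_(i <- r | P i) f i).
Proof.
move=> A0 Af; apply: (big_ind (A g)) => // a b; exact: piecesD.
Qed.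

Lemma piecesX g y n : A g y -> A (g *+ n) (y ^+ n).
Proof.
have [A1 _ AM] := hA => Ay; elim: n => [|n IH]; first by rewrite mulr0n expr0.
by rewrite mulrS exprS; apply: AM.
Qed.

Lemma gidealN N g a : gideal A N -> N g a -> N g (- a).
Proof.
by move=> [_ _ _ NM] Na; rewrite -mulN1r -[g]add0r; apply: NM => //; apply: piecesN1.
Qed.

Lemma gidealB N g a b : gideal A N -> N g a -> N g b -> N g (a - b).
Proof. by move=> hN Na Nb; have [_ _ ND _] := hN; apply: ND => //; apply: gidealN. Qed.

Lemma gideal_sum N g (I : Type) (r : seq I) (P : pred I) (f : I -> R) : gideal A N ->
  (forall i, P i -> N g (f i)) -> N g (\sum_(i <- r | P i) f i).
Proof. by move=> [_ N0 ND _] Nf; apply: (big_ind (N g)) => //; apply: ND. Qed.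

(** The ideals [N + y M] and [(N : y)], the latter inside [Z], for [y] homogeneous
    of degree [g]. *)
Definition addgen N M g y h : set R :=
  [set v | exists b a, [/\ N h b, M (h - g) a & v = b + y * a]].

Definition colon N Z g y h : set R := [set v | Z h v /\ N (g + h) (y * v)].

Lemma addgen_gideal N M Z g y : (forall h a, M (h - g) a -> Z h (y * a)) ->
  (forall h, N h `<=` Z h) ->
  gideal A N -> gideal A M -> gideal A Z -> gideal A (addgen N M g y).
Proof.
move=> yZ NZ [NA N0 ND NM] [MA M0 MD MM] [ZA Z0 ZD ZM]; split.
- by move=> h _ [b [a [Nb Aa ->]]]; apply/ZA/ZD; [exact: NZ|exact: yZ].
- by move=> h; exists 0, 0; split=> //; rewrite mulr0 addr0.
- move=> h _ _ [b [a [Nb Aa ->]]] [b' [a' [Nb' Aa' ->]]].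
  exists (b + b'), (a + a'); split; [exact: ND| |by rewrite mulrDr addrACA].
  exact: MD.
- move=> h h' c _ Ac [b [a [Nb Aa ->]]]; exists (c * b), (c * a).
  split; [exact: NM| |by rewrite mulrDr mulrCA].
  by rewrite -addrA; apply: MM.
Qed.

Lemma colon_gideal N Z g y : A g y -> gideal A N -> gideal A Z ->
  gideal A (colon N Z g y).
Proof.
move=> Ay [NA N0 ND NM] [ZA Z0 ZD ZM]; split.
- by move=> h v [/ZA].
- by move=> h; split; rewrite ?mulr0.
- by move=> h a b [Za Na] [Zb Nb]; split; [exact: ZD|rewrite mulrDr; apply: ND].
move=> h h' a b Aa [Zb Nb]; split; first exact: ZM.
by rewrite mulrCA addrCA; apply: NM.
Qed.

Variables (wt : D -> int).
Hypothesis wtB : forall g h, wt (g - h) = wt g - wt h.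
Hypothesis A_wt : forall g a, wt g < 0 -> A g a -> a = 0.
Hypothesis A0 : forall g, A g 0.

Lemma A_gideal : gideal A A.
Proof.
have [_ _ AM] := hA; split=> [g v //||g a b|//]; [exact: A0|exact: piecesD].
Qed.

(** If the quotient by the homogeneous element [y] satisfies the ascending chain
    condition, so does the ring. For a chain [N_n] the ideals
    [(N_n : y^i) + y A] increase in both [n] and [i], and are all reached by some
    [n = J]. An element [v] of [(N_n : y^i)] is then [m + y a] with
    [m] in [(N_J : y^i)] and [a] in [(N_n : y^(i+1))]; as [a] has smaller degree,
    [v] lies in [(N_J : y^i)] by induction on the degree. *)
Lemma gacc_addgen B g y : 0 < wt g -> A g y -> gideal A B ->
  gacc A (addgen B A g y) -> gacc A B.
Proof.
move=> g0 Ay hB acc N hN BN incN; have [_ AB AM] := hA.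
have yA h a : A (h - g) a -> A h (y * a).
  by move=> Aa; rewrite -[h](subrK g) addrC; apply: AM.
pose C n i := colon (N n) A (g *+ i) (y ^+ i).
have hC n i : gideal A (C n i).
  by apply: colon_gideal; [exact: piecesX|exact: hN|exact: A_gideal].
pose Q n i := addgen (C n i) A g y.
have hQ n i : gideal A (Q n i).
  by apply: (@addgen_gideal _ _ A) => //; [have [] := hC n i|exact: A_gideal..].
have Nle n m h : (n <= m)%N -> N n h `<=` N m h.
  move=> nm v; exact: (chain_le (U := fun n v => N n h v) (fun n => @incN n h) nm).
have Cle n m i h : (n <= m)%N -> C n i h `<=` C m i h.
  by move=> nm v [Av Nv]; split=> //; apply: Nle Nv.
have CS n i h : C n i h `<=` C n i.+1 h.
  move=> v [Av Nv]; split=> //; rewrite mulrS exprS -addrA -mulrA.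
  by have [_ _ _ NM] := hN n; apply: NM.
have Qle n m i h : (n <= m)%N -> Q n i h `<=` Q m i h.
  by move=> nm _ [b [a [Cb Aa ->]]]; exists b, a; split=> //; apply: Cle Cb.
have Qlei n i j h : (i <= j)%N -> Q n i h `<=` Q n j h.
  move=> ij _ [b [a [Cb Aa ->]]]; exists b, a; split=> //.
  exact: (chain_le (U := fun i v => C n i h v) (fun i => @CS n i h) ij).
have BQ n i h : addgen B A g y h `<=` Q n i h.
  move=> _ [b [a [Bb Aa ->]]]; exists b, a; split=> //; split.
    by have [BA _ _ _] := hB; apply: BA.
  by apply: BN; have [_ _ _ BM] := hB; apply: BM => //; apply: piecesX.
have [J0 stab0] : exists J, forall n h, Q n n h `<=` Q J J h.
  apply: (acc (fun n => Q n n)) => // n h v Qv.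
  by apply: (@Qle n) => //; apply: Qlei Qv.
have stab i : exists J, forall n h, Q n i h `<=` Q J i h.
  by apply: (acc (fun n => Q n i)) => // n h; apply: Qle.
have [J1 stab1] := choice stab.
pose J := maxn J0 (\max_(i < J0) J1 i).
have stabJ n i h : Q n i h `<=` Q J i h.
  move=> v Qv; case: (ltnP i J0) => [iJ|Ji].
    apply: (@Qle (J1 i)); last exact: stab1 Qv.
    by rewrite leq_max; apply/orP; right; apply: (leq_bigmax (Ordinal iJ)).
  apply: (@Qle J0); first by rewrite leq_maxl.
  apply: (@Qlei J0 J0) => //; apply: (stab0 (maxn n i)).
  by apply: (@Qle n); rewrite ?leq_maxl //; apply: Qlei Qv; rewrite leq_maxr.
exists J => n; have [nJ|/ltnW Jn] := leqP n J; first by move=> h; apply: Nle.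
suff main : forall e i h v, wt h < e%:Z -> C n i h v -> C J i h v.
  move=> h v Nv; have [NA _ _ _] := hN n.
  have [||_] := main `|wt h|.+1 0%N h v; last by rewrite mulr0n add0r expr0 mul1r.
    lia.
  by split; [exact: NA|rewrite mulr0n add0r expr0 mul1r].
elim=> [|e IH] i h v he Cv.
  have -> : v = 0 by apply: A_wt he _; have [] := Cv.
  by have [_ C0 _ _] := hC J i.
have /stabJ : Q n i h v by exists v, 0; split=> //; rewrite mulr0 addr0.
move=> [m [a [Cm Aa vE]]].
have Ca : C n i.+1 (h - g) a.
  split=> //; rewrite mulrSr exprSr -mulrA -addrA (addrC g) subrK.
  have -> : y * a = v - m by rewrite vE addrC addKr.
  have : C n i h (v - m) by apply: gidealB => //; apply: Cle Cm.
  by case.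
have [_ Na] : C J i.+1 (h - g) a by apply: IH Ca; rewrite wtB; lia.
rewrite vE; have [_ _ CD _] := hC J i; apply: CD => //; split; first exact: yA.
by move: Na; rewrite mulrSr exprSr -mulrA -addrA (addrC g) subrK.
Qed.

(** The Hilbert basis theorem for an algebra with homogeneous generators [L] of
    positive weight over the field [A 0]: the quotient by all the generators has at most
    two homogeneous ideals, and [gacc_addgen] restores them one at a time. *)
Lemma graded_hilbert_basis B (L : seq (D * R)) :
  (forall a, A 0 a -> a != 0 -> exists2 b, A 0 b & b * a = 1) ->
  (forall gy, gy \in L -> 0 < wt gy.1 /\ A gy.1 gy.2) -> gideal A B ->
  (forall g, g != 0 ->
     A g `<=` foldl (fun N gy => addgen N A gy.1 gy.2) B L g) ->
  gacc A B.
Proof.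
move=> fieldA; elim: L B => [|[g y] L IH] B hL hB AL /=.
  move=> N hN BN incN.
  case: (pselect (exists n, N n 0 1)) => [[J NJ]|N1].
    exists J => n h a Na; have [NA _ _ NM] := hN n; have [_ _ _ NM'] := hN J.
    by rewrite -[a]mulr1 -[h]addr0; apply: NM' => //; apply: NA.
  exists 0%N => n h a Na; have [NA _ _ NM] := hN n.
  have [h0|h0] := eqVneq h 0; last by apply/BN/AL => //; apply: NA.
  have [->|a0] := eqVneq a 0; first by have [_ + _ _] := hN 0%N; exact.
  case: N1; exists n; rewrite h0 in Na.
  have [b Ab <-] := fieldA a (NA _ _ Na) a0.
  by rewrite -[0]addr0; apply: NM.
have [g0 Ay] := hL (g, y) (mem_head _ _).
apply: (@gacc_addgen _ g y) => //; apply: IH.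
- by move=> gy Lgy; apply: hL; rewrite inE Lgy orbT.
- have [BA _ _ _] := hB; have [_ _ AM] := hA.
  apply: (@addgen_gideal _ _ A) => //; [|exact: A_gideal..].
  by move=> h a Aa; rewrite -[h](subrK g) addrC; apply: AM.
- exact: AL.
Qed.

End Ring.

End GradedIdeals.

(** * Čech cochains as sequences *)

Definition ultimately (P : nat -> Prop) : Prop :=
  exists e0, forall e, (e0 <= e)%N -> P e.

Lemma ultimatelyT (P : nat -> Prop) : (forall e, P e) -> ultimately P.
Proof. by move=> H; exists 0%N. Qed.

Lemma ultimatelyW (P Q : nat -> Prop) : (forall e, P e -> Q e) ->
  ultimately P -> ultimately Q.
Proof. by move=> PQ [e0 H]; exists e0 => e /H /PQ. Qed.

Lemma ultimatelyI (P Q : nat -> Prop) : ultimately P -> ultimately Q ->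
  ultimately (fun e => P e /\ Q e).
Proof.
move=> [e0 H0] [e1 H1]; exists (maxn e0 e1) => e.
by rewrite geq_max => /andP[/H0 ? /H1].
Qed.

Lemma ultimatelyW2 (P Q S : nat -> Prop) : (forall e, P e -> Q e -> S e) ->
  ultimately P -> ultimately Q -> ultimately S.
Proof. by move=> PQS P_ Q_; apply: ultimatelyW (ultimatelyI P_ Q_) => e []; apply: PQS. Qed.

Lemma ultimatelyS (P : nat -> Prop) : ultimately P -> ultimately (fun e => P e.+1).
Proof. by move=> [e0 H]; exists e0 => e /leqW /H. Qed.

(** The exchange of two indices kills an antisymmetric double sum; the diagonal
    does not occur, so that this holds in all characteristics. *)
Lemma antisym_sum (V : zmodType) (r : nat) (t : {set 'I_r}) (F : 'I_r -> 'I_r -> V) :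
  (forall j h, j \in t -> h \in t -> j != h -> F j h = - F h j) ->
  \sum_(j in t) \sum_(h in t :\ j) F j h = 0.
Proof.
move=> asym.
pose S := \sum_(j in t) \sum_(h in t | (h < j)%N) F j h.
suff -> : \sum_(j in t) \sum_(h in t :\ j) F j h =
    S + \sum_(j in t) \sum_(h in t | (j < h)%N) F j h.
  have -> : \sum_(j in t) \sum_(h in t | (j < h)%N) F j h =
            \sum_(j in t) \sum_(h in t | (h < j)%N) F h j.
    rewrite (exchange_big_dep (mem t)) /=; last by move=> i j _ /andP[].
    by apply: eq_bigr => j tj; apply: eq_bigl => h; rewrite /= tj.
  rewrite /S -big_split big1 // => j tj /=.
  rewrite -big_split big1 //= => h /andP[th hj].
  by rewrite asym ?addNr // neq_ltn hj orbT.
rewrite /S -big_split; apply: eq_bigr => j tj /=.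
rewrite (bigID (fun h : 'I_r => (h < j)%N)) /=; congr (_ + _); apply: eq_bigl => h.
  by rewrite !inE -val_eqE /=; case: (ltngtP h j); rewrite ?andbT ?andbF.
by rewrite !inE -val_eqE /=; case: (ltngtP h j); rewrite ?andbT ?andbF.
Qed.

Lemma ultimately_forall (T : finType) (P : T -> nat -> Prop) :
  (forall i, ultimately (P i)) -> ultimately (fun e => forall i, P i e).
Proof.
move=> /choice[f Hf]; exists (\max_i f i) => e le i.
by apply: Hf; apply: leq_trans le; apply: leq_bigmax.
Qed.

Section Cech.
Variables (K : comPzRingType) (r : nat) (x : 'I_r -> K).
Implicit Types (s t : {set 'I_r}) (j h : 'I_r) (p : int).

Definition sgn (t : {set 'I_r}) (j : 'I_r) : K :=
  (-1) ^+ #|[set h in t | (h < j)%N]|.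

Definition mon (s : {set 'I_r}) : K := \prod_(j in s) x j.

Definition deg (p : int) (e : nat) (s : {set 'I_r}) : int := p + (e * #|s|)%N%:Z.

Lemma sgn_sqr t j : sgn t j * sgn t j = 1.
Proof. by rewrite -expr2 sqrr_sign. Qed.

Lemma sgnD1 t j h : h \in t -> h != j ->
  sgn (t :\ h) j = (if (h < j)%N then -1 else 1) * sgn t j.
Proof.
move=> th hj; rewrite /sgn; case: ifP => hlt.
  rewrite [in RHS](cardsD1 h) inE th hlt exprD mulrA mulN1r opprK mul1r.
  by congr (_ ^+ #|pred_of_set _|); apply/setP => i; rewrite !inE andbA.
rewrite mul1r; congr (_ ^+ #|pred_of_set _|); apply/setP => i; rewrite !inE.
by case: (i =P h) => [->|]; rewrite // hlt !andbF.
Qed.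

Lemma sgn_antisym t j h : j \in t -> h \in t -> j != h ->
  sgn t j * sgn (t :\ j) h = - (sgn t h * sgn (t :\ h) j).
Proof.
move=> tj th jh; rewrite !sgnD1 // 1?eq_sym //.
move: jh; rewrite -val_eqE /=; case: (ltngtP h j) => // _ _.
  by rewrite mul1r mulN1r mulrN opprK mulrC.
by rewrite mulN1r mul1r mulrN mulrC.
Qed.

Lemma monD1 t j : j \in t -> mon t = x j * mon (t :\ j).
Proof. by move=> tj; rewrite /mon (big_setD1 j). Qed.

Lemma degD1 p e t j : j \in t -> deg p e (t :\ j) + e%:Z = deg p e t.
Proof. by move=> tj; rewrite /deg [in RHS](cardsD1 j t) tj mulnDr muln1 PoszD addrA addrAC. Qed.

Lemma degS p e s : deg p e s + #|s|%:Z = deg p e.+1 s.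
Proof. by rewrite /deg; lia. Qed.

Section Module.
Variable V : lmodType K.
Implicit Types (c b : nat -> {set 'I_r} -> V) (m : {set 'I_r} -> V).
Implicit Types (E Z B : int -> set V).

Definition dif (e : nat) m (t : {set 'I_r}) : V :=
  \sum_(j in t) (sgn t j * x j ^+ e) *: m (t :\ j).

Definition difs c : nat -> {set 'I_r} -> V := fun e => dif e (c e).

Definition defect c (e : nat) (s : {set 'I_r}) : V := c e.+1 s - mon s *: c e s.

(** The component [c e s] lies in [E] in the degree that it has for a cochain of
    degree [p]. *)
Definition ev E p c : Prop := ultimately (fun e => forall s, E (deg p e s) (c e s)).

(** A Čech cochain is recorded by its numerators: [c e s] stands for the fraction
    [c e s / mon s ^+ e], and two consecutive levels present the same fraction when
    [c e.+1 s = mon s *: c e s]. With coefficients in [Z / B] this is required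
    modulo [B], and only for large [e]: this is the colimit of the Koszul complexes
    of the powers of the [x j], and it involves neither quotients nor
    localizations. The cochain has degree [p] when [c e s] has degree
    [p + e * #|s|]. All cohomological degrees are treated at once. *)
Definition cochains Z B p c : Prop :=
  ev Z p c /\ ultimately (fun e => forall s, B (deg p e.+1 s) (defect c e s)).

Definition cocycles Z B p c : Prop := cochains Z B p c /\ ev B p (difs c).

Definition coboundaries Z B p c : Prop :=
  exists2 b, cochains Z B p b & ev B p (c - difs b).

Definition gsub E : Prop :=
  [/\ forall p, E p 0, forall p u v, E p u -> E p v -> E p (u - v) &
      forall p j v, E p v -> E (p + 1) (x j *: v)].

(** The cochain whose fractions are [m s / mon s ^+ e0]; below the level [e0] its
    values are meaningless. *)
Definition gen (e0 : nat) m (e : nat) (s : {set 'I_r}) : V := mon s ^+ (e - e0) *: m s.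

Section Gsub.
Variable E : int -> set V.
Hypothesis hE : gsub E.

Lemma gsub0 p : E p 0. Proof. by have [] := hE. Qed.

Lemma gsubB p u v : E p u -> E p v -> E p (u - v).
Proof. by have [_ EB _] := hE; apply: EB. Qed.

Lemma gsubN p v : E p v -> E p (- v).
Proof. by move=> Ev; rewrite -sub0r; apply: gsubB => //; apply: gsub0. Qed.

Lemma gsubD p u v : E p u -> E p v -> E p (u + v).
Proof. by move=> Eu Ev; rewrite -[v]opprK; apply: gsubB => //; apply: gsubN. Qed.

Lemma gsub_sum p (I : Type) (s : seq I) (P : pred I) (f : I -> V) :
  (forall i, P i -> E p (f i)) -> E p (\sum_(i <- s | P i) f i).
Proof. by move=> Ef; apply: big_ind => // [|a b]; [exact: gsub0|exact: gsubD]. Qed.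

Lemma gsubX p n j v : E p v -> E (p + n%:Z) (x j ^+ n *: v).
Proof.
have [_ _ Ex] := hE => Ev; elim: n => [|n IH]; first by rewrite addr0 scale1r.
by rewrite exprS -scalerA -addn1 PoszD addrA; apply: Ex.
Qed.

Lemma gsub_mon p n s v : E p v -> E (p + (n * #|s|)%N%:Z) (mon s ^+ n *: v).
Proof.
have [_ _ Ex] := hE => Ev.
have Emon : forall q w, E q w -> E (q + #|s|%:Z) (mon s *: w).
  rewrite /mon -sum1_card.
  elim/big_rec2: _ => [q w|j a k _ IH q w Ew]; first by rewrite addr0 scale1r.
  by rewrite mulrC -scalerA PoszD addrA; apply/IH/Ex.
elim: n => [|n IH]; first by rewrite mul0n addr0 expr0 scale1r.
have -> : p + (n.+1 * #|s|)%N%:Z = p + (n * #|s|)%N%:Z + #|s|%:Z by lia.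
by rewrite exprS -scalerA; apply: Emon.
Qed.

Lemma gsub_sgn p t j v : E p v -> E p (sgn t j *: v).
Proof.
by move=> Ev; rewrite /sgn -signr_odd; case: odd; rewrite ?scaleN1r ?scale1r //; apply: gsubN.
Qed.

Lemma gsub_dif p e m : (forall s, E (deg p e s) (m s)) ->
  forall t, E (deg p e t) (dif e m t).
Proof.
move=> Em t; apply: gsub_sum => j tj; rewrite -scalerA; apply: gsub_sgn.
by rewrite -(degD1 p e tj); apply: gsubX.
Qed.

Lemma ev_difs p c : ev E p c -> ev E p (difs c).
Proof. by apply: ultimatelyW => e; apply: gsub_dif. Qed.

Lemma evB p c b : ev E p c -> ev E p b -> ev E p (c - b).
Proof. by apply: ultimatelyW2 => e Ec Eb s; apply: gsubB. Qed.

Lemma evD p c b : ev E p c -> ev E p b -> ev E p (c + b).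
Proof. by apply: ultimatelyW2 => e Ec Eb s; apply: gsubD. Qed.

Lemma ev0 p : ev E p 0.
Proof. by apply: ultimatelyT => e s; apply: gsub0. Qed.

End Gsub.

Lemma evS E E' p c : (forall p, E p `<=` E' p) -> ev E p c -> ev E' p c.
Proof. by move=> EE'; apply: ultimatelyW => e Ec s; apply/EE'/Ec. Qed.

Lemma difD e m m' t : dif e (m + m') t = dif e m t + dif e m' t.
Proof. by rewrite /dif -big_split; apply: eq_bigr => j _; rewrite scalerDr. Qed.

Lemma difZ e a m t : dif e (a *: m) t = a *: dif e m t.
Proof. by rewrite /dif scaler_sumr; apply: eq_bigr => j _; rewrite !scalerA mulrC. Qed.

Lemma difB e m m' t : dif e (m - m') t = dif e m t - dif e m' t.
Proof. by rewrite /dif -sumrB; apply: eq_bigr => j _; rewrite -scalerBr. Qed.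

Lemma difs0 : difs 0 = 0.
Proof.
by apply/funext => e; apply/funext => t; rewrite /difs /dif big1 // => j _; rewrite scaler0.
Qed.

Lemma difsD c b : difs (c + b) = difs c + difs b.
Proof. by apply/funext => e; apply/funext => t; apply: difD. Qed.

Lemma difsB c b : difs (c - b) = difs c - difs b.
Proof. by apply/funext => e; apply/funext => t; apply: difB. Qed.

Lemma difsZ a c : difs (a *: c) = a *: difs c.
Proof. by apply/funext => e; apply/funext => t; apply: difZ. Qed.

Lemma dif_dif e m t : dif e (dif e m) t = 0.
Proof.
rewrite /dif; under eq_bigr do rewrite scaler_sumr.
apply: antisym_sum => j h tj th jh; rewrite !scalerA !finset.setDDl (finset.setUC [set h]) -scaleNr; congr (_ *: _).
transitivity ((sgn t j * sgn (t :\ j) h) * (x j ^+ e * x h ^+ e)); first by ring.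
by rewrite sgn_antisym //; ring.
Qed.

Lemma difs_difs c : difs (difs c) = 0.
Proof. by apply/funext => e; apply/funext => t; apply: dif_dif. Qed.

Lemma defect_difs c e t :
  defect (difs c) e t = \sum_(j in t) (sgn t j * x j ^+ e.+1) *: defect c e (t :\ j).
Proof.
rewrite /defect /difs /dif scaler_sumr -sumrB; apply: eq_bigr => j tj.
rewrite scalerBr !scalerA; congr (_ - _ *: _).
by rewrite (monD1 tj) exprS; ring.
Qed.

Lemma defectD c b e s : defect (c + b) e s = defect c e s + defect b e s.
Proof. by rewrite /defect !fctE scalerDr opprD addrACA. Qed.

Lemma defectB c b e s : defect (c - b) e s = defect c e s - defect b e s.
Proof. by rewrite /defect !fctE scalerBr !opprB addrACA [RHS]addrACA [X in _ + X]addrC. Qed.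

Lemma defectZ a c e s : defect (a *: c) e s = a *: defect c e s.
Proof. by rewrite /defect !fctE scalerBr !scalerA mulrC. Qed.

Section Pair.
Variables (Z B : int -> set V).
Hypotheses (hZ : gsub Z) (hB : gsub B).

Lemma cochains0 p : cochains Z B p 0.
Proof.
split; first exact: ev0.
apply: ultimatelyT => e s; rewrite (_ : defect _ _ _ = 0 - mon s *: 0) //.
by rewrite scaler0 subrr; apply: gsub0.
Qed.

Lemma cochainsB p c b : cochains Z B p c -> cochains Z B p b -> cochains Z B p (c - b).
Proof.
move=> [Zc Bc] [Zb Bb]; split; first exact: evB.
by apply: ultimatelyW2 Bc Bb => e Bc Bb s; rewrite defectB; apply: gsubB.
Qed.

Lemma cochainsD p c b : cochains Z B p c -> cochains Z B p b -> cochains Z B p (c + b).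
Proof.
move=> [Zc Bc] [Zb Bb]; split; first exact: evD.
by apply: ultimatelyW2 Bc Bb => e Bc Bb s; rewrite defectD; apply: gsubD.
Qed.

Lemma cochains_difs p c : cochains Z B p c -> cochains Z B p (difs c).
Proof.
move=> [Zc Bc]; split; first exact: ev_difs.
apply: ultimatelyW Bc => e Bc t; rewrite defect_difs.
by apply: (@gsub_dif _ hB p e.+1 (defect c e)).
Qed.

Lemma cochains_ev p c : (forall p, B p `<=` Z p) -> ev B p c -> cochains Z B p c.
Proof.
move=> BZ Bc; split; first exact: evS Bc.
apply: ultimatelyW2 Bc (ultimatelyS Bc) => e Be Be1 s; apply: gsubB => //.
by rewrite -degS -[#|s|]mul1n -[mon s]expr1; apply: gsub_mon.
Qed.

Lemma cocyclesB p c b : cocycles Z B p c -> cocycles Z B p b -> cocycles Z B p (c - b).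
Proof.
move=> [Zc Bc] [Zb Bb]; split; first exact: cochainsB.
by rewrite difsB; apply: evB.
Qed.

Lemma cocyclesD p c b : cocycles Z B p c -> cocycles Z B p b -> cocycles Z B p (c + b).
Proof.
move=> [Zc Bc] [Zb Bb]; split; first exact: cochainsD.
by rewrite difsD; apply: evD.
Qed.

Lemma coboundaries_cocycles p c : (forall p, B p `<=` Z p) ->
  coboundaries Z B p c -> cocycles Z B p c.
Proof.
move=> BZ [b hb Bb]; rewrite -[c](subrK (difs b)) addrC; apply: cocyclesD.
  split; first exact: cochains_difs.
  by rewrite difs_difs; apply: ev0.
split; first exact: cochains_ev.
exact: ev_difs.
Qed.

Lemma coboundariesB p c c' :
  coboundaries Z B p c -> coboundaries Z B p c' -> coboundaries Z B p (c - c').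
Proof.
move=> [b hb Bb] [b' hb' Bb']; exists (b - b'); first exact: cochainsB.
rewrite difsB.
have -> : c - c' - (difs b - difs b') = (c - difs b) - (c' - difs b').
  by rewrite !opprD !opprK addrACA.
exact: evB.
Qed.

Lemma coboundaries_ev p c : ev B p c -> coboundaries Z B p c.
Proof. by move=> Bc; exists 0; [exact: cochains0|rewrite difs0 subr0]. Qed.

Lemma coboundaries0 p : coboundaries Z B p 0.
Proof. exact/coboundaries_ev/ev0. Qed.

Lemma coboundariesN p c : coboundaries Z B p c -> coboundaries Z B p (- c).
Proof. by move=> hc; rewrite -sub0r; apply: coboundariesB => //; apply: coboundaries0. Qed.

Lemma coboundariesD p c c' :
  coboundaries Z B p c -> coboundaries Z B p c' -> coboundaries Z B p (c + c').
Proof. by move=> hc hc'; rewrite -[c']opprK; apply: coboundariesB => //; apply: coboundariesN. Qed.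

Lemma cochains_levels p c : cochains Z B p c -> ultimately (fun e =>
  forall e' s, (e <= e')%N -> B (deg p e' s) (c e' s - mon s ^+ (e' - e) *: c e s)).
Proof.
move=> [_ [e0 Bc]]; exists e0 => e le0e e' s /subnKC <-; rewrite addKn.
elim: (e' - e)%N => [|n IH].
  by rewrite addn0 expr0 scale1r subrr; apply: gsub0.
rewrite addnS.
have := Bc (e + n)%N (leq_trans le0e (leq_addr _ _)) s; rewrite /defect => B1.
have := gsub_mon hB 1%N s IH; rewrite mul1n degS expr1 => B2.
have := gsubD hB B1 B2; rewrite scalerBr addrA subrK scalerA -exprS.
by [].
Qed.

Lemma defect_gen e0 m e s : (e0 <= e)%N -> defect (gen e0 m) e s = 0.
Proof. by move=> le; rewrite /defect /gen subSn // scalerA -exprS subrr. Qed.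

Lemma dif_gen e0 m e t : (e0 <= e)%N ->
  dif e (gen e0 m e) t = mon t ^+ (e - e0) *: dif e0 m t.
Proof.
move=> le; rewrite /dif scaler_sumr; apply: eq_bigr => j tj.
rewrite /gen !scalerA (monD1 tj) exprMn; congr (_ *: _).
rewrite (_ : x j ^+ e = x j ^+ (e - e0) * x j ^+ e0); last by rewrite -exprD subnK.
by ring.
Qed.

Lemma gsub_gen E p e0 m e s : gsub E -> (e0 <= e)%N ->
  E (deg p e0 s) (m s) -> E (deg p e s) (gen e0 m e s).
Proof.
move=> hE le Em; have -> : deg p e s = deg p e0 s + ((e - e0) * #|s|)%N%:Z.
  by rewrite /deg mulnBl; have := leq_mul le (leqnn #|s|); lia.
exact: gsub_mon.
Qed.

Lemma cochains_gen p e0 m : (forall s, Z (deg p e0 s) (m s)) ->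
  cochains Z B p (gen e0 m).
Proof.
move=> Zm; split; exists e0 => e le s; first exact: gsub_gen.
by rewrite defect_gen //; apply: gsub0.
Qed.

(** Inverting [x j] contracts the Čech complex, by sending [c] to the cochain
    [s |-> c (j |: s)]; the denominators [x j ^+ e0] of one level [e0] that
    presents [c] are cleared by multiplying by [x j ^+ e0]. *)
Lemma cocycles_torsion p c j : cocycles Z B p c ->
  exists N, coboundaries Z B (p + N%:Z) (x j ^+ N *: c).
Proof.
move=> [hc Bd]; have [Zc _] := hc.
have [e0 H0] := ultimatelyI (ultimatelyI Zc Bd) (cochains_levels hc).
have [[{}Zc {}Bd] Bl] := H0 e0 (leqnn e0).
pose m s := if j \in s then 0 else sgn (j |: s) j *: c e0 (j |: s).
exists e0, (gen e0 m).
  apply: cochains_gen => s; rewrite /m; case: ifP => js; first exact: gsub0.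
  apply: gsub_sgn => //; have := Zc (j |: s); rewrite /deg cardsU1 js /=.
  by congr (Z _ _); lia.
have Bm t : B (deg (p + e0%:Z) e0 t) (x j ^+ e0 *: c e0 t - dif e0 m t).
  case: (boolP (j \in t)) => jt.
    rewrite /dif (big_setD1 j) //= big1 ?addr0 => [|h]; last first.
      by rewrite /m !inE jt andbT => /andP[hj _]; rewrite eq_sym hj /= scaler0.
    rewrite /m finset.setD11 finset.setD1K // scalerA mulrAC sgn_sqr mul1r subrr; exact: gsub0.
  have -> : deg (p + e0%:Z) e0 t = deg p e0 (j |: t).
    by rewrite /deg cardsU1 jt; lia.
  suff -> : x j ^+ e0 *: c e0 t - dif e0 m t =
      sgn (j |: t) j *: dif e0 (c e0) (j |: t) by apply: gsub_sgn.
  have jT : j \in j |: t by rewrite finset.setU11.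
  have tE : (j |: t) :\ j = t by rewrite finset.setU1K.
  rewrite [dif e0 (c e0) _](big_setD1 j) //= tE scalerDr scalerA mulrA sgn_sqr mul1r.
  congr (_ + _); rewrite /dif scaler_sumr -sumrN; apply: eq_bigr => h th.
  have jh : j != h by apply: contraNneq jt => ->.
  have hT : h \in j |: t by rewrite !inE th orbT.
  rewrite /m !inE (negPf jt) andbF !scalerA -scaleNr.
  have TE : (j |: t) :\ h = j |: (t :\ h).
    by apply/setP => i; rewrite !inE; case: (i =P j) => [->|]; rewrite ?jh.
  rewrite -TE; congr (_ *: _).
  have A := sgn_antisym jT hT jh; rewrite tE in A.
  have -> : sgn t h = sgn (j |: t) j * (sgn (j |: t) j * sgn t h).
    by rewrite mulrA sgn_sqr mul1r.
  rewrite A; move: (sgn_sqr ((j |: t) :\ h) j) (sgn _ j) => Q s.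
  move: (sgn _ j) (sgn _ h) Q => u v Q.
  by transitivity (s * (v * x h ^+ e0) * (u * u)); [ring|rewrite Q mulr1].
exists e0 => e le t.
have -> : (x j ^+ e0 *: c - difs (gen e0 m)) e t =
    x j ^+ e0 *: (c e t - mon t ^+ (e - e0) *: c e0 t) +
    mon t ^+ (e - e0) *: (x j ^+ e0 *: c e0 t - dif e0 m t).
  rewrite /difs !fctE dif_gen // !scalerBr !scalerA [_ ^+ e0 * mon t ^+ _]mulrC.
  by rewrite addrA subrK.
apply: gsubD => //.
  have -> : deg (p + e0%:Z) e t = deg p e t + e0%:Z by rewrite /deg; lia.
  by apply: gsubX => //; apply: Bl.
exact: (@gsub_gen _ _ _ (fun t => _ *: c e0 t - dif e0 m t)).
Qed.

End Pair.

End Module.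

Section Map.
Variables (V V' : lmodType K) (f : V -> V').
Hypothesis f_linear : linear f.
Variables (Z B : int -> set V) (Z' B' : int -> set V') (h : int).
Hypotheses (fZ : forall p v, Z p v -> Z' (p + h) (f v)).
Hypotheses (fB : forall p v, B p v -> B' (p + h) (f v)).

Let fmap (c : nat -> {set 'I_r} -> V) : nat -> {set 'I_r} -> V' := fun e s => f (c e s).

Lemma lin0 : f 0 = 0.
Proof. by have := f_linear 1 0 0; rewrite !scale1r addr0 => /(congr1 (fun u => u - f 0)); rewrite subrr addrK. Qed.

Lemma linZ a v : f (a *: v) = a *: f v.
Proof. by rewrite -[a *: v]addr0 f_linear lin0 addr0. Qed.

Lemma linD u v : f (u + v) = f u + f v.
Proof. by rewrite -[u]scale1r f_linear !scale1r. Qed.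

Lemma linB u v : f (u - v) = f u - f v.
Proof. by rewrite linD -scaleN1r linZ scaleN1r. Qed.

Lemma lin_sum (I : Type) (s : seq I) (P : pred I) (g : I -> V) :
  f (\sum_(i <- s | P i) g i) = \sum_(i <- s | P i) f (g i).
Proof. by elim/big_rec2: _ => [|i u v _ <-]; [exact: lin0|exact: linD]. Qed.

Lemma dif_map e m t : dif e (fun s => f (m s)) t = f (dif e m t).
Proof. by rewrite /dif lin_sum; apply: eq_bigr => j _; rewrite linZ. Qed.

Lemma deg_shift p e s : deg (p + h) e s = deg p e s + h.
Proof. by rewrite /deg; lia. Qed.

Lemma ev_map p c : ev B p c -> ev B' (p + h) (fmap c).
Proof. by apply: ultimatelyW => e Bc s; rewrite deg_shift; apply: fB. Qed.

Lemma cochains_map p c : cochains Z B p c -> cochains Z' B' (p + h) (fmap c).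
Proof.
move=> [Zc Bc]; split.
  by apply: ultimatelyW Zc => e Zc s; rewrite deg_shift; apply: fZ.
apply: ultimatelyW Bc => e Bc s; rewrite deg_shift /defect /fmap.
by rewrite -linZ -linB; apply: fB.
Qed.

Lemma difs_map c : difs (fmap c) = fun e s => f (difs c e s).
Proof. by apply/funext => e; apply/funext => s; rewrite /difs /fmap dif_map. Qed.

Lemma cocycles_map p c : cocycles Z B p c -> cocycles Z' B' (p + h) (fmap c).
Proof. by move=> [hc Bc]; split; [exact: cochains_map|rewrite difs_map; apply: ev_map]. Qed.

Lemma coboundaries_map p c : coboundaries Z B p c -> coboundaries Z' B' (p + h) (fmap c).
Proof.
move=> [b hb Bb]; exists (fmap b); first exact: cochains_map.
have := ev_map Bb; congr ev; apply/funext => e; apply/funext => s.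
by rewrite difs_map /fmap !fctE linB.
Qed.

End Map.

End Cech.

(** * Finiteness of local cohomology *)

Section Finiteness.
Variables (R : comPzRingType) (r : nat) (x : 'I_r -> R) (A : int * int -> set R).
Hypothesis hA : graded_pieces A.
Hypothesis Ax : forall j, A (1, 0) (x j).
Hypothesis A_neg : forall p q a, p < 0 -> A (p, q) a -> a = 0.
Hypothesis A_gen : forall p q a, 0 < p -> A (p, q) a ->
  exists f : 'I_r -> R, (forall j, A (p - 1, q) (f j)) /\ a = \sum_j x j * f j.
Hypothesis noeth : gacc A (fun=> [set 0]).
Implicit Types (Z B : int * int -> set R) (p q h : int).

Definition slice Z q : int -> set R^o := fun p => Z (p, q).

Local Notation cochain := (nat -> {set 'I_r} -> R^o).
Local Notation coch Z B p q := (cochains x (slice Z q) (slice B q) p).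
Local Notation cocy Z B p q := (cocycles x (slice Z q) (slice B q) p).
Local Notation cobd Z B p q := (coboundaries x (slice Z q) (slice B q) p).

(** Submodules of the cohomology in degree [p] are graded by the second degree, and
    correspond to families of sets of cocycles that contain the coboundaries. *)
Definition hsub Z B p (N : int -> set cochain) : Prop :=
  [/\ forall q, cobd Z B p q `<=` N q, forall q, N q `<=` cocy Z B p q,
      forall q c b, N q c -> N q b -> N q (c + b) &
      forall h q a c, A (0, h) a -> N q c -> N (h + q) (a *: c)].

Definition hacc Z B p : Prop := forall N : nat -> int -> set cochain,
  (forall n, hsub Z B p (N n)) -> (forall n q, N n q `<=` N n.+1 q) ->
  exists J, forall n q, N n q `<=` N J q.

Definition cohomology_bounded Z B : Prop :=
  exists p0, forall p q, p0 <= p -> cocy Z B p q `<=` cobd Z B p q.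

Lemma noeth_chain (N : nat -> int * int -> set R) : (forall n, gideal A (N n)) ->
  (forall n g, N n g `<=` N n.+1 g) -> exists J, forall n g, N n g `<=` N J g.
Proof. by move=> hN; apply: noeth => // n g _ ->; have [] := hN n. Qed.

Lemma gidealx Z p q v j : gideal A Z -> Z (p, q) v -> Z (p + 1, q) (x j * v).
Proof.
move=> [_ _ _ ZM] Zv; have -> : (p + 1, q) = (1, 0) + (p, q).
  by rewrite [p + 1]addrC -[q in LHS]add0r.
exact: ZM.
Qed.

Lemma slice_gsub Z q : gideal A Z -> gsub x (slice Z q).
Proof.
move=> hZ; split=> [p|p u v|p j v].
- by have [_ + _ _] := hZ; exact.
- exact: (gidealB hA hZ).
- exact: gidealx.
Qed.

Lemma gidealMp Z h p q a v : gideal A Z -> A (0, h) a -> Z (p, q) v -> Z (p, h + q) (a * v).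
Proof. by move=> [_ _ _ ZM] Aa Zv; rewrite -[p]add0r; apply: (ZM (0, h) (p, q)). Qed.

Lemma scale_linear (a : R) : linear (fun v : R^o => a *: v).
Proof. by move=> b u v; rewrite scalerDr !scalerA mulrC. Qed.

Lemma cobdM Z B p q h a c : gideal A Z -> gideal A B -> A (0, h) a ->
  cobd Z B p q c -> cobd Z B p (h + q) (a *: c).
Proof.
move=> hZ hB Aa hc; rewrite -[p]addr0.
by apply: coboundaries_map hc; [exact: scale_linear|
  move=> p' v; rewrite addr0; apply: gidealMp..].
Qed.

Lemma cocyM Z B p q h a c : gideal A Z -> gideal A B -> A (0, h) a ->
  cocy Z B p q c -> cocy Z B p (h + q) (a *: c).
Proof.
move=> hZ hB Aa hc; rewrite -[p]addr0.
by apply: cocycles_map hc; [exact: scale_linear|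
  move=> p' v; rewrite addr0; apply: gidealMp..].
Qed.

Lemma cocyx Z B p q j c : gideal A Z -> gideal A B ->
  cocy Z B p q c -> cocy Z B (p + 1) q (x j *: c).
Proof.
move=> hZ hB; apply: cocycles_map => [|p' v|p' v]; [exact: scale_linear|exact: gidealx..].
Qed.

Lemma hsubB Z B p N q c b : hsub Z B p N -> N q c -> N q b -> N q (c - b).
Proof.
move=> [_ _ ND NM] Nc Nb; apply: ND => //.
by rewrite -scaleN1r -[q]add0r; apply: NM => //; exact: (piecesN1 hA).
Qed.

Section Killed.
Variables Z B : int * int -> set R.
Hypotheses (hZ : gideal A Z) (hB : gideal A B) (BZ : forall g, B g `<=` Z g).
Hypothesis killed : forall j p q v, Z (p, q) v -> B (p + 1, q) (x j * v).

Lemma killedM h h' p q a v : h != 0 -> A (h, h') a -> Z (p, q) v ->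
  B (h + p, h' + q) (a * v).
Proof.
have [_ B0 _ BM] := hB; have [_ _ _ ZM] := hZ.
case: (ltgtP h 0) => // [h0 _ Aa Zv|h0 _ Aa Zv].
  by rewrite (A_neg h0 Aa) mul0r; apply: B0.
have [f [Af ->]] := A_gen h0 Aa; rewrite mulr_suml; apply: (gideal_sum _ hB) => j _.
have -> : h + p = (h - 1 + p) + 1 by lia.
rewrite -mulrA; apply: killed.
exact: (ZM (h - 1, h') (p, q)).
Qed.

Definition const_cochain (v : R) : cochain := fun e s => if s == finset.set0 then v else 0.

Lemma const_cochainD u v : const_cochain (u + v) = const_cochain u + const_cochain v.
Proof.
by apply/funext => e; apply/funext => s; rewrite !fctE /const_cochain; case: ifP; rewrite ?addr0.
Qed.

Lemma const_cochainZ a v : const_cochain (a * v) = a *: const_cochain v.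
Proof.
by apply/funext => e; apply/funext => s; rewrite !fctE /const_cochain; case: ifP; rewrite ?scaler0.
Qed.

Lemma const_ev E p q v : gideal A E -> E (p, q) v -> ev (slice E q) p (const_cochain v).
Proof.
move=> hE Ev; apply: ultimatelyT => e s; rewrite /const_cochain /slice; case: eqP => [->|_].
  by rewrite /deg cards0 muln0 addr0.
by have [_ + _ _] := hE; exact.
Qed.

(** When all the [x j] kill [Z / B], the fractions with a denominator vanish, and a
    cochain amounts to its component at [set0], an element of [Z / B]. *)
Lemma killed_cochain p q c : coch Z B p q c ->
  exists2 v, Z (p, q) v & ev (slice B q) p (c - const_cochain v).
Proof.
move=> hc; have [Zc _] := hc.
have [e0 /(_ _ (leqnn e0))[{}Zc Bl]] :=
  ultimatelyI Zc (cochains_levels (slice_gsub q hB) hc).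
exists (c e0 finset.set0); first by have := Zc finset.set0; rewrite /deg cards0 muln0 addr0.
exists e0.+1 => e lt s; rewrite !fctE /const_cochain.
have [->|[j js]] := set_0Vmem s.
  rewrite eqxx; have := Bl e finset.set0 (ltnW lt).
  by rewrite /mon big_set0 expr1n scale1r.
have /negPf -> : s != finset.set0 by apply/set0Pn; exists j.
rewrite subr0 -[c e s](subrK (mon x s ^+ (e - e0) *: c e0 s)).
have [_ _ BD _] := hB; apply: BD; first exact: Bl (ltnW lt).
rewrite -(subnSK lt) exprS -scalerA {1}(monD1 x js) -scalerA.
rewrite -(degD1 p e js).
have -> : deg p e (s :\ j) + e%:Z = deg p e0 s + ((e - e0.+1) * #|s|)%N%:Z +
    (1 * #|s :\ j|)%N%:Z + 1.
  rewrite /deg (cardsD1 j s) js; move: #|_| => a.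
  by rewrite -(subnK lt) addnK; lia.
apply: killed; rewrite -[mon x (s :\ j)]expr1.
have Zs := gsub_mon (slice_gsub q hZ) (e - e0.+1) s (Zc s).
exact: (gsub_mon (slice_gsub q hZ) 1%N (s :\ j) Zs).
Qed.

(** The ideals [N_n] of the elements of [Z] that lie in [B] when their first degree is
    at least [n] increase with [n]. *)
Lemma killed_bounded : cohomology_bounded Z B.
Proof.
have [ZA Z0 ZD ZM] := hZ; have [BA B0 BD BM] := hB.
have [||J HJ] := @noeth_chain (fun n g => [set v | Z g v /\ (n%:Z <= g.1 -> B g v)]).
- move=> n; split.
  + by move=> g v [/ZA].
  + by move=> g; split=> [|_]; [exact: Z0|exact: B0].
  + by move=> g u v [Zu Bu] [Zv Bv]; split=> [|ng]; [exact: ZD|apply: BD; auto].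
  move=> [h h'] [p q] a v Aa [Zv Bv]; split=> [|/= ng]; first exact: ZM.
  have [h0|h0] := eqVneq h 0; last exact: killedM.
  by apply: BM => //; apply: Bv => /=; rewrite h0 add0r in ng.
- by move=> n g v [Zv Bv]; split=> // ng; apply: Bv; lia.
exists J%:Z => p q Jp c [hc _]; apply: (coboundaries_ev (slice_gsub q hZ) (slice_gsub q hB)).
have [v Zv Bv] := killed_cochain hc; rewrite -[c](subrK (const_cochain v)).
apply: (evD (slice_gsub q hB)) => //; apply: const_ev => //.
have [|_] := HJ `|p|.+1 (p, q) v; last exact.
by split=> // /=; lia.
Qed.

Lemma killed_hacc p : hacc Z B p.
Proof.
have [ZA Z0 ZD ZM] := hZ; have [BA B0 BD BM] := hB.
move=> N hN incN.
have Nev n q c : ev (slice B q) p c -> N n q c.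
  move=> Bc; have [+ _ _ _] := hN n; apply.
  exact: (coboundaries_ev (slice_gsub q hZ) (slice_gsub q hB)).
have [||J HJ] := @noeth_chain (fun n g =>
    [set v | Z g v /\ (g.1 = p -> N n g.2 (const_cochain v))]).
- move=> n; have [_ _ ND NM] := hN n; split.
  + by move=> g v [/ZA].
  + move=> [p' q]; split=> [|_]; first exact: Z0.
    by apply/Nev/const_ev => //; apply: B0.
  + move=> g u v [Zu Nu] [Zv Nv]; split=> [|gp]; first exact: ZD.
    by rewrite const_cochainD; apply: ND; auto.
  move=> [h h'] [p' q] a v Aa [Zv Nv]; split=> [|/= hp]; first exact: ZM.
  have [h0|h0] := eqVneq h 0.
    rewrite h0 add0r in hp Aa *; rewrite const_cochainZ.
    by apply: NM => //; apply: Nv.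
  by apply/Nev/const_ev => //; rewrite -hp; apply: killedM.
- by move=> n g v [Zv Nv]; split=> // gp; apply/incN/Nv.
exists J => n q c Nc; have [_ Ncy ND _] := hN n.
have [v Zv Bv] := killed_cochain (Ncy _ _ Nc).1.
have [_ _ NDJ _] := hN J; rewrite -[c](subrK (const_cochain v)); apply: NDJ.
  exact: Nev.
have [|_] := HJ n (p, q) v; last exact.
split=> // _ /=; rewrite -[const_cochain v](subKr c).
by apply: hsubB (hN n) _ _ => //; apply: Nev.
Qed.

End Killed.

Section Step.
Variables Z B : int * int -> set R.
Hypotheses (hZ : gideal A Z) (hB : gideal A B) (BZ : forall g, B g `<=` Z g).
Variable j : 'I_r.

(** The kernel and the cokernel of the multiplication by [x j] on [Z / B] are
    [Kx / B] and [Z / Qx]. *)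
Let Kx := colon B Z (1, 0) (x j).
Let Qx := addgen B Z (1, 0) (x j).

Lemma Kx_gideal : gideal A Kx. Proof. exact: colon_gideal. Qed.

Lemma Qx_gideal : gideal A Qx.
Proof.
apply: (@addgen_gideal _ _ _ _ _ Z) => //; move=> [p q] a Za.
have := gidealx j hZ Za; congr (Z (_, _) _); [exact: subrK|exact: subr0].
Qed.

Lemma KxP p q v : Kx (p, q) v <-> Z (p, q) v /\ B (p + 1, q) (x j * v).
Proof.
rewrite /Kx /colon /=; have -> // : (1, 0) + (p, q) = (p + 1, q).
by rewrite [p + 1]addrC -[q in RHS]add0r.
Qed.

Lemma QxP p q v : Qx (p + 1, q) v <->
  exists b a, [/\ B (p + 1, q) b, Z (p, q) a & v = b + x j * a].
Proof.
rewrite /Qx /addgen /=; have -> // : (p + 1, q) - (1, 0) = (p, q).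
by congr (_, _); [exact: addrK|exact: subr0].
Qed.

Lemma B_Kx g : B g `<=` Kx g.
Proof.
by case: g => p q v Bv; apply/KxP; split; [exact: BZ|exact: gidealx].
Qed.

Lemma B_Qx g : B g `<=` Qx g.
Proof.
move=> v Bv; exists v, 0; split=> //; last by rewrite mulr0 addr0.
by have [_ + _ _] := hZ; exact.
Qed.

Lemma Qx_Z g : Qx g `<=` Z g.
Proof.
case: g => p q; rewrite -[p](subrK 1) => _ /QxP[b [a [Bb Za ->]]].
by have [_ _ ZD _] := hZ; apply: ZD; [exact: BZ|exact: gidealx].
Qed.

(** A cochain modulo [Qx] lifts to a cochain that is compatible between levels on
    the nose: the one generated by one of its levels. *)
Lemma lift_cochain p q b : coch Z Qx p q b ->
  exists2 b', coch Z B p q b' & ev (slice Qx q) p (b - b').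
Proof.
move=> hb; have [Zb _] := hb.
have [e0 /(_ _ (leqnn e0))[{}Zb Bl]] :=
  ultimatelyI Zb (cochains_levels (slice_gsub q Qx_gideal) hb).
exists (gen x e0 (b e0)).
  exact: (cochains_gen (slice_gsub q hZ) (slice_gsub q hB)).
by exists e0 => e le s; apply: Bl.
Qed.

Lemma divide_cochain p q b : coch Z B (p + 1) q b -> ev (slice Qx q) (p + 1) b ->
  exists2 z, coch Z B p q z & ev (slice B q) (p + 1) (b - x j *: z).
Proof.
move=> hb Qb.
have [e0 /(_ _ (leqnn e0))[{}Qb Bl]] :=
  ultimatelyI Qb (cochains_levels (slice_gsub q hB) hb).
have degE e s : deg (p + 1) e s = deg p e s + 1 by rewrite /deg; lia.
have /choice[z Hz] : forall s : {set 'I_r}, exists a : R^o,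
    Z (deg p e0 s, q) a /\ B (deg p e0 s + 1, q) (b e0 s - x j *: a).
  move=> s; have := Qb s; rewrite degE => /QxP[b' [a [Bb' Za bE]]].
  exists a; split=> //; have -> // : b e0 s - x j *: (a : R^o) = b'.
  by rewrite bE; apply: addrK.
exists (gen x e0 z).
  by apply: (cochains_gen (slice_gsub q hZ) (slice_gsub q hB)) => s; have [] := Hz s.
exists e0 => e le s; rewrite !fctE.
rewrite -[b e s](subrK (mon x s ^+ (e - e0) *: b e0 s)) -addrA.
have [_ _ BD _] := hB; apply: BD; first exact: Bl.
have -> : mon x s ^+ (e - e0) *: b e0 s - x j *: gen x e0 z e s =
    gen x e0 (fun s => b e0 s - x j *: z s) e s.
  by rewrite /gen scalerBr !scalerA [x j * _]mulrC.
apply: (gsub_gen (slice_gsub q hB)) le _.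
by rewrite degE; have [] := Hz s.
Qed.

(** With [kernel_cocycle], this replaces the long exact sequences of the
    multiplication by [x j]: when [x j *: c] is a coboundary [d b], the class of [b]
    modulo [Qx] is the obstruction to moving [c] into the kernel. The connecting map is
    thus only a relation, which is all that the two finiteness statements need. *)
Lemma connect_cocycle p q c b : cocy Z B p q c -> coch Z B (p + 1) q b ->
  ev (slice B q) (p + 1) (x j *: c - difs x b) -> cocy Z Qx (p + 1) q b.
Proof.
move=> [[Zc _] _] [Zb Bb] xc; split; first split=> //.
  by apply: ultimatelyW Bb => e Bb s; apply: (@B_Qx (_, q)) (Bb s).
rewrite -[difs x b](subKr (x j *: c)); apply: (evB (slice_gsub q Qx_gideal)).
  apply: ultimatelyW Zc => e Zc s.
  have -> : deg (p + 1) e s = deg p e s + 1 by rewrite /deg; lia.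
  apply/QxP; exists 0, (c e s); split; [|exact: Zc|by rewrite add0r].
  by have [_ + _ _] := hB; exact.
by apply: evS xc => p'; apply: (@B_Qx (p', q)).
Qed.

Lemma kernel_cocycle p q c b : cocy Z B p q c -> coch Z B (p + 1) q b ->
  ev (slice B q) (p + 1) (x j *: c - difs x b) -> ev (slice Qx q) (p + 1) b ->
  exists2 z, coch Z B p q z & cocy Kx B p q (c - difs x z).
Proof.
move=> hc hb xc Qb; have [z hz bz] := divide_cochain hb Qb; exists z => //.
have hdz := cochains_difs (slice_gsub q hZ) (slice_gsub q hB) hz.
have [[Zc Bc] Bd] : cocy Z B p q (c - difs x z).
  apply: (cocyclesB (slice_gsub q hZ) (slice_gsub q hB)) => //; split=> //.
  by rewrite difs_difs; apply: ev0; apply: slice_gsub.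
split=> //; split=> //.
have xcz : ev (slice B q) (p + 1) (x j *: (c - difs x z)).
  have -> : x j *: (c - difs x z) = (x j *: c - difs x b) + difs x (b - x j *: z).
    by rewrite difsB difsZ scalerBr addrA subrK.
  by apply: (evD (slice_gsub q hB)) => //; apply: (ev_difs (slice_gsub q hB)).
apply: ultimatelyW2 Zc xcz => e Ze Be s; apply/KxP; split; first exact: Ze.
by have := Be s; rewrite /slice; congr (B (_, _) _); rewrite /deg; lia.
Qed.

Lemma cobd_Kx p q c : cobd Kx B p q c -> cobd Z B p q c.
Proof.
move=> [b [Zb Bb] cb]; exists b => //; split=> //.
by apply: evS Zb => p' v [].
Qed.

(** In large degrees the cohomologies of [Kx / B] and [Z / Qx] vanish, so that the
    multiplication by [x j] is injective on the cohomology of [Z / B], on which it is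
    also locally nilpotent. *)
Lemma step_bounded : cohomology_bounded Kx B -> cohomology_bounded Z Qx ->
  cohomology_bounded Z B.
Proof.
move=> [p1 H1] [p2 H2]; exists (Num.max p1 p2) => p q.
rewrite ge_max => /andP[p1p p2p] c hc.
have inj p' c' : p1 <= p' -> p2 <= p' -> cocy Z B p' q c' ->
    cobd Z B (p' + 1) q (x j *: c') -> cobd Z B p' q c'.
  move=> p1p' p2p' hc' [b hb xcb].
  have [|b1 hb1 bb1] := H2 (p' + 1) q _ b (connect_cocycle hc' hb xcb); first by lia.
  have [b2 hb2 b12] := lift_cochain hb1.
  have hdb2 := cochains_difs (slice_gsub q hZ) (slice_gsub q hB) hb2.
  have hbb : coch Z B (p' + 1) q (b - difs x b2).
    exact: (cochainsB (slice_gsub q hZ) (slice_gsub q hB)).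
  have [||z hz hk] := kernel_cocycle hc' hbb.
  - by rewrite difsB difs_difs subr0.
  - have -> : b - difs x b2 = (b - difs x b1) + difs x (b1 - b2).
      by rewrite difsB addrA subrK.
    apply: (evD (slice_gsub q Qx_gideal)) => //.
    exact: (ev_difs (slice_gsub q Qx_gideal)).
  have := cobd_Kx (H1 p' q p1p' _ hk); move: hz => + [b3 hb3 cb3].
  exists (z + b3); first exact: (cochainsD (slice_gsub q hZ) (slice_gsub q hB)).
  by rewrite difsD opprD addrA.
have [N] := cocycles_torsion (slice_gsub q hZ) (slice_gsub q hB) j hc.
elim: N => [|N IH]; first by rewrite addr0 expr0 scale1r.
rewrite exprS -scalerA -addn1 PoszD addrA => H; apply/IH/inj => //; try lia.
elim: N {IH H} => [|N IH]; first by rewrite addr0 expr0 scale1r.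
by rewrite exprS -scalerA -addn1 PoszD addrA; apply: cocyx.
Qed.

(** A chain of submodules in degree [p] is stationary as soon as three chains are: its
    image under [x j], its intersection with the cocycles of the kernel, and
    the classes modulo [Qx] that the relation of [connect_cocycle] attaches to it. *)
Lemma step_hacc p : hacc Z B (p + 1) -> hacc Kx B p -> hacc Z Qx (p + 1) -> hacc Z B p.
Proof.
move=> acc1 acc2 acc3 N hN incN.
have gZ q := slice_gsub q hZ; have gB q := slice_gsub q hB.
have gQ q := slice_gsub q Qx_gideal.
have [||J1 HJ1] := acc1 (fun n q => [set c' | cocy Z B (p + 1) q c' /\
    exists2 c, N n q c & cobd Z B (p + 1) q (c' - x j *: c)]).
- move=> n; have [NB Ncy ND NM] := hN n; split.
  + move=> q c hc; split; first by apply: coboundaries_cocycles => // p'; apply: BZ.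
    exists 0; first exact/NB/coboundaries0.
    by rewrite scaler0 subr0.
  + by move=> q c [].
  + move=> q c c' [hc [b Nb cb]] [hc' [b' Nb' cb']]; split; first exact: cocyclesD.
    exists (b + b'); first exact: ND.
    by rewrite scalerDr opprD addrACA; apply: coboundariesD.
  + move=> h q a c Aa [hc [b Nb cb]]; split; first exact: cocyM.
    exists (a *: b); first exact: NM.
    have := cobdM hZ hB Aa cb; congr (cobd _ _ _ _ _).
    by rewrite scalerBr !scalerA mulrC.
- by move=> n q c [hc [b Nb cb]]; split=> //; exists b => //; apply: incN.
have [||J2 HJ2] := acc2 (fun n q => [set c | cocy Kx B p q c /\ N n q c]).
- move=> n; have [NB Ncy ND NM] := hN n; split.
  + move=> q c hc; split; last exact/NB/cobd_Kx.
    apply: coboundaries_cocycles hc => //; first exact/slice_gsub/Kx_gideal.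
    by move=> p'; apply: B_Kx.
  + by move=> q c [].
  + move=> q c c' [hc Nc] [hc' Nc']; split; last exact: ND.
    by apply: cocyclesD => //; apply/slice_gsub/Kx_gideal.
  + move=> h q a c Aa [hc Nc]; split; last exact: NM.
    by apply: cocyM => //; apply: Kx_gideal.
- by move=> n q c [hc Nc]; split=> //; apply: incN.
have [||J3 HJ3] := acc3 (fun n q => [set b | exists c b0, [/\ N n q c,
    coch Z B (p + 1) q b0, ev (slice Qx q) (p + 1) (b - b0), coch Z Qx (p + 1) q b &
    ev (slice B q) (p + 1) (x j *: c - difs x b0)]]).
- move=> n; have [NB Ncy ND NM] := hN n; split.
  + move=> q b hb; have [b1 hb1 bb1] := hb; have [b2 hb2 bb2] := lift_cochain hb1.
    exists 0, (difs x b2); split.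
    * exact/NB/coboundaries0.
    * exact: cochains_difs.
    * have -> : b - difs x b2 = (b - difs x b1) + difs x (b1 - b2).
        by rewrite difsB addrA subrK.
      by apply: evD => //; apply: ev_difs.
    * by have [] := coboundaries_cocycles (gZ q) (gQ q) (fun p' => @Qx_Z (p', q)) hb.
    * by rewrite difs_difs scaler0 subr0; apply: ev0.
  + move=> q b [c [b0 [Nc hb0 bb0 hb cb0]]]; split=> //.
    have -> : difs x b = difs x b0 + difs x (b - b0) by rewrite difsB addrC subrK.
    apply: evD => //; last exact: ev_difs.
    by have [] := connect_cocycle (Ncy _ _ Nc) hb0 cb0.
  + move=> q b b' [c [b0 [Nc hb0 bb0 hb cb0]]] [c' [b0' [Nc' hb0' bb0' hb' cb0']]].
    exists (c + c'), (b0 + b0'); split.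
    * exact: ND.
    * exact: cochainsD.
    * by rewrite opprD addrACA; apply: evD.
    * exact: cochainsD.
    * by rewrite difsD scalerDr opprD addrACA; apply: evD.
  + move=> h q a b Aa [c [b0 [Nc hb0 bb0 hb cb0]]].
    have evM E p' c' : gideal A E -> ev (slice E q) p' c' -> ev (slice E (h + q)) p' (a *: c').
      by move=> hE; apply: ultimatelyW => e Ee s; apply: gidealMp (Ee s).
    have cochM E p' c' : gideal A E -> coch Z E p' q c' -> coch Z E p' (h + q) (a *: c').
      move=> hE [Zc Ec]; split; first exact: evM.
      by apply: ultimatelyW Ec => e Ec s; rewrite defectZ; apply: gidealMp (Ec s).
    exists (a *: c), (a *: b0); split.
    * exact: NM.
    * exact: cochM.
    * by rewrite -scalerBr; apply: evM => //; apply: Qx_gideal.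
    * by apply: cochM => //; apply: Qx_gideal.
    * have -> : x j *: (a *: c) - difs x (a *: b0) = a *: (x j *: c - difs x b0).
        by rewrite difsZ scalerBr !scalerA mulrC.
      exact: evM.
- move=> n q b [c [b0 [Nc hb0 bb0 hb cb0]]]; exists c, b0; split=> //.
  exact: incN.
pose J := maxn J1 (maxn J2 J3); exists J => n q c Nc.
have Nle i i' : (i <= i')%N -> N i q `<=` N i' q.
  by move=> le c'; exact: (chain_le (U := fun n c => N n q c) (fun n => @incN n q) le).
pose m := maxn n J.
have [NB Ncy ND NM] := hN m; have [NBJ NcyJ NDJ NMJ] := hN J.
have J1J : (J1 <= J)%N by rewrite leq_maxl.
have J2J : (J2 <= J)%N by rewrite /J !leq_max leqnn orbT.
have J3J : (J3 <= J)%N by rewrite /J !leq_max leqnn !orbT.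
have Jm : (J <= m)%N by rewrite leq_maxr.
have {Nc}Nc : N m q c by apply: Nle Nc; rewrite leq_maxl.
have [|_ [c1 Nc1 [b hb cb]]] := HJ1 m q (x j *: c).
  split; first by apply/cocyx => //; apply: Ncy.
  by exists c => //; rewrite subrr; apply: coboundaries0.
have {Nc1}Nc1 := Nle _ _ J1J _ Nc1.
have Nd : N m q (c - c1) by apply: hsubB (hN m) _ _ => //; apply: Nle Nc1.
have hxd : ev (slice B q) (p + 1) (x j *: (c - c1) - difs x b) by rewrite scalerBr.
have hbQ := connect_cocycle (Ncy _ _ Nd) hb hxd.
have [|c2 [b0 [Nc2 hb0 bb0 _ cb0]]] := HJ3 m q b.
  exists (c - c1), b; split=> //; last by have [] := hbQ.
  by rewrite subrr; apply: ev0.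
have {Nc2}Nc2 := Nle _ _ J3J _ Nc2.
have Nd2 : N m q (c - c1 - c2) by apply: hsubB (hN m) _ _ => //; apply: Nle Nc2.
have [|z hz hk] := kernel_cocycle (Ncy _ _ Nd2) (cochainsB (gZ q) (gB q) hb hb0) _ bb0.
  have -> : x j *: (c - c1 - c2) - difs x (b - b0) =
      (x j *: (c - c1) - difs x b) - (x j *: c2 - difs x b0).
    by rewrite difsB [x j *: (_ - c2)]scalerBr !opprD !opprK addrACA.
  exact: evB.
have Ndz n' : N n' q (difs x z).
  by have [+ _ _ _] := hN n'; apply; exists z => //; rewrite subrr; apply: ev0.
have [|_ Nk] := HJ2 m q (c - c1 - c2 - difs x z).
  by split=> //; apply: hsubB (hN m) _ _.
rewrite -[c](subrK c1); apply: (NDJ) => //; rewrite -[c - c1](subrK c2).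
apply: (NDJ) => //; rewrite -[c - c1 - c2](subrK (difs x z)); apply: NDJ => //.
exact: Nle Nk.
Qed.

End Step.

(** The induction is on the number of indices outside [D], where the [x j] with [j] in
    [D] kill [Z / B]; the kernel and the cokernel of [x j] add [j] to [D]. *)
Theorem cohomology_finite Z B : gideal A Z -> gideal A B -> (forall g, B g `<=` Z g) ->
  cohomology_bounded Z B /\ forall p, hacc Z B p.
Proof.
suff main : forall n (D : {set 'I_r}) Z B, #|~: D| = n ->
    gideal A Z -> gideal A B -> (forall g, B g `<=` Z g) ->
    (forall j p q v, j \in D -> Z (p, q) v -> B (p + 1, q) (x j * v)) ->
    cohomology_bounded Z B /\ forall p, hacc Z B p.
  by move=> hZ hB BZ; apply: (main #|~: (finset.set0 : {set 'I_r})| finset.set0) => // j p q v; rewrite inE.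
move=> n; elim: n => [|n IH] D {}Z {}B Dn hZ hB BZ killed.
  have {}killed j p q v : Z (p, q) v -> B (p + 1, q) (x j * v).
    apply: killed; have := cards0_eq Dn => /setP/(_ j).
    by rewrite !inE => /negbFE.
  by split=> [|p]; [exact: killed_bounded|exact: killed_hacc].
have /card_gt0P[j] : (0 < #|~: D|)%N by rewrite Dn.
rewrite inE => jD.
have Dn' : #|~: (j |: D)| = n.
  move: Dn; rewrite (cardsD1 j) inE jD add1n => -[<-].
  by congr #|pred_of_set _|; apply/setP => i; rewrite !inE negb_or.
have [bK aK] : cohomology_bounded (colon B Z (1, 0) (x j)) B /\
    forall p, hacc (colon B Z (1, 0) (x j)) B p.
  apply: (IH (j |: D)) => //; first exact: Kx_gideal.
    exact: B_Kx.
  by move=> i p q v /setU1P[->|iD] /KxP[] // Zv _; apply: killed.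
have [bQ aQ] : cohomology_bounded Z (addgen B Z (1, 0) (x j)) /\
    forall p, hacc Z (addgen B Z (1, 0) (x j)) p.
  apply: (IH (j |: D)) => //; first exact: Qx_gideal.
    exact: Qx_Z.
  move=> i p q v /setU1P[->|iD] Zv; last exact/B_Qx/killed.
  apply/QxP; exists 0, v; split=> //; last by rewrite add0r.
  by have [_ + _ _] := hB; exact.
have [p0 Hp0] : cohomology_bounded Z B by apply: step_bounded bK bQ.
split=> [|p]; first by exists p0.
have [k] : exists k : nat, p0 - p <= k%:Z by exists `|p0 - p|%N; lia.
elim: k p => [|k IHk] p hk; last first.
  by apply: (@step_hacc _ _ hZ hB BZ j) => //; apply: IHk; lia.
move=> N hN _; exists 0%N => m q c Nc; have [+ _ _ _] := hN 0%N; apply.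
apply: Hp0; first by lia.
by have [_ + _ _] := hN m; apply.
Qed.

End Finiteness.

(** * Support of cochains and non-vanishing *)

Section Support.
Variables (K : comPzRingType) (r : nat) (x : 'I_r -> K) (V : lmodType K).
Implicit Types (c b : nat -> {set 'I_r} -> V) (Z B : int -> set V).
Implicit Types (s t : {set 'I_r}) (j : 'I_r).

Definition supported (i : nat) c : Prop := forall e (s : {set 'I_r}), #|s| != i -> c e s = 0.

Definition cohomology_neq0 Z B (i : nat) (p : int) : Prop := exists c,
  [/\ supported i c, cocycles x Z B p c & ~ coboundaries x Z B p c].

(** The differential raises the size of the support by one, so that the components of
    [b] on the sets of other sizes can be dropped. *)
Lemma coboundaries_supported Z B i p c : gsub x Z -> gsub x B -> supported i c ->
  coboundaries x Z B p c -> exists b, [/\ cochains x Z B p b,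
    forall e (s : {set 'I_r}), #|s|.+1 != i -> b e s = 0 & ev B p (c - difs x b)].
Proof.
move=> hZ hB ci [b [Zb Bb] cb].
exists (fun e s => if #|s|.+1 == i then b e s else 0); split.
- split.
    by apply: ultimatelyW Zb => e Zb s; case: ifP => _; [exact: Zb|exact: (gsub0 hZ)].
  apply: ultimatelyW Bb => e Bb s; rewrite /defect; case: ifP => _; first exact: Bb.
  by rewrite scaler0 subrr; apply: (gsub0 hB).
- by move=> e s /negPf ->.
apply: ultimatelyW cb => e cb t; have := cb t; rewrite !fctE /difs /dif.
have [ti|ti] := eqVneq #|t| i.
  congr (B _ (_ - _)); apply: eq_bigr => j tj.
  by move: ti; rewrite (cardsD1 j) tj add1n => ->; rewrite eqxx.
rewrite (ci e t ti) [X in _ -> B _ (_ - X)]big1 => [|j tj]; last first.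
  by move: ti; rewrite (cardsD1 j) tj add1n => /negPf ->; rewrite scaler0.
by rewrite subr0 => _; apply: (gsub0 hB).
Qed.

End Support.

Section NonVanishing.
Variables (K : comPzRingType) (r : nat) (x : 'I_r -> K) (Z : int -> set K^o).
Hypotheses (hZ : gsub x Z) (Z1 : Z 0 1) (ZN1 : forall v, Z (- 1) v -> v = 0).
Hypothesis K1 : (1 : K) != 0.
Implicit Types (s t : {set 'I_r}) (j : 'I_r).

Let B : int -> set K^o := fun=> [set 0].

Lemma gsub_zero (V : lmodType K) : gsub x (fun=> [set (0 : V)]).
Proof. by split=> [|p u v -> ->|p j v ->]; rewrite ?subrr ?scaler0. Qed.

Let hB : gsub x B. Proof. exact: gsub_zero. Qed.

Lemma sum_cochainE (I : finType) (P : pred I) (F : I -> nat -> {set 'I_r} -> K^o) e s :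
  (\sum_(i | P i) F i) e s = \sum_(i | P i) F i e s.
Proof. by elim/big_rec2: _ => // i u v _ <-. Qed.

(** The cochain with the single component [1 / mon x t], at [t]. *)
Definition inv_mon (t : {set 'I_r}) : nat -> {set 'I_r} -> K^o :=
  fun e s => if s == t then mon x t ^+ e.-1 else 0.

Lemma sgnU1 t j : j \notin t -> sgn K (j |: t) j = sgn K t j.
Proof.
move=> jt; rewrite /sgn; congr (_ ^+ #|pred_of_set _|); apply/setP => h.
by rewrite !inE; case: eqP => // ->; rewrite ltnn (negPf jt).
Qed.

Lemma inv_mon_cochain t : cochains x Z B (- #|t|%:Z) (inv_mon t).
Proof.
split; exists 1%N => e e0 s; rewrite /defect /inv_mon; case: eqP => [->|_].
- have := gsub_mon hZ e.-1 t Z1; rewrite add0r [_ *: _]mulr1.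
  by congr (Z _ _); rewrite /deg; case: e e0 => // e _ /=; lia.
- exact: (gsub0 hZ).
- by rewrite /= -[e in X in X - _](prednK e0) exprS [_ *: _]/(_ * _) subrr.
by rewrite scaler0 subrr.
Qed.

Lemma difs_inv_mon t e s : (0 < e)%N ->
  difs x (inv_mon t) e s =
  \sum_(j in ~: t) (sgn K t j * x j) *: inv_mon (j |: t) e s.
Proof.
move=> e0; rewrite /difs /dif /inv_mon.
have [[j jt ->]|ns] := pselect (exists2 j, j \notin t & s = j |: t).
  have js : j \in j |: t by rewrite setU11.
  have jC : j \in ~: t by rewrite inE.
  rewrite (big_setD1 j) //= finset.setU1K // eqxx big1 ?addr0 => [|h]; last first.
    move=> ht; case: eqP => [E|_]; last by rewrite scaler0.
    by move: ht; rewrite -E !inE eqxx.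
  rewrite [RHS](big_setD1 j) //= eqxx big1 ?addr0 => [|h]; last first.
    rewrite !inE => /andP[hj ht]; case: eqP => [E|_]; last by rewrite scaler0.
    by move: js; rewrite E !inE eq_sym (negPf hj) (negPf jt).
  rewrite sgnU1 // (monD1 x js) finset.setU1K // exprMn.
  rewrite (_ : x j ^+ e = x j * x j ^+ e.-1); last by rewrite -exprS prednK.
  have H (a b c d : K) : (a * (b * c)) * d = (a * b) * (c * d) by ring.
  exact: H.
rewrite !big1 // => j.
  rewrite inE => jt; case: eqP => [E|_]; last by rewrite scaler0.
  by case: ns; exists j.
move=> js; case: eqP => [E|_]; last by rewrite scaler0.
by case: ns; exists j; rewrite -E ?setD11 ?finset.setD1K // !inE eqxx.
Qed.

(** If the cohomology vanishes, descending induction on the set [t] gives cochains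
    [v t] such that [d (v t) = 1 / mon x t - \sum_j +/- x j v (j |: t)], where the
    right hand side is closed by the equations for the larger sets. For [t = set0]
    this writes [1] as a combination of the [x j] with coefficients of degree [-1]. *)
Theorem cohomology_nonvanishing : exists i p, cohomology_neq0 x Z B i p.
Proof.
apply: contrapT => H0.
have exact_coh i p c : supported i c -> cocycles x Z B p c ->
    exists b, [/\ cochains x Z B p b, forall e (s : {set 'I_r}), #|s|.+1 != i -> b e s = 0
      & ev B p (c - difs x b)].
  move=> ci hc; apply: coboundaries_supported => //; apply: contrapT => nc.
  by apply: H0; exists i, p, c.
pose rest v t := inv_mon t - \sum_(j in ~: t) (sgn K t j * x j) *: v (j |: t).
pose good v t := [/\ cochains x Z B (- #|t|%:Z) (v t),
  forall e (s : {set 'I_r}), #|s|.+1 != #|t| -> v t e s = 0 & ev B (- #|t|%:Z) (rest v t - difs x (v t))].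
have cardU (t : {set 'I_r}) j : j \in ~: t -> #|j |: t| = #|t|.+1.
  by rewrite inE => jt; rewrite cardsU1 jt.
have [v Hv] : exists v : {set 'I_r} -> nat -> {set 'I_r} -> K^o, forall t, good v t.
  suff Hn n : exists v : {set 'I_r} -> nat -> {set 'I_r} -> K^o,
      forall t, (r < n + #|t|)%N -> good v t.
    have [v Hv] := Hn r.+1.
    by exists v => t; apply: Hv; rewrite addSn ltnS leq_addr.
  elim: n => [|n [v Hv]].
    exists (fun=> 0) => t; rewrite add0n ltnNge.
    by rewrite -[X in (_ <= X)%N](card_ord r) max_card.
  have /choice[w Hw] : forall t, exists w : nat -> {set 'I_r} -> K^o,
      (r < n.+1 + #|t|)%N -> good (fun t' => if t' == t then w else v t') t.
    move=> t; case: (pselect (r < n.+1 + #|t|)%N) => [tr|]; last by exists 0.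
    have Hvj j : j \in ~: t -> good v (j |: t).
      by move=> jt; apply: Hv; rewrite cardU // addnS -addSn.
    have hin := inv_mon_cochain.
    have scl_lin (a : K) : linear (fun u : K^o => a *: u).
      by move=> a' u u'; rewrite scalerDr !scalerA mulrC.
    have hterm j c p : cochains x Z B (p - 1) c ->
        cochains x Z B p ((sgn K t j * x j) *: c).
      move=> hc; rewrite -[p](subrK 1).
      apply: (cochains_map _ _ _ hc) => // p' u; last by move->; rewrite [_ *: _]mulr0.
      move=> Zu; rewrite -scalerA; apply: (gsub_sgn hZ).
      by have [_ _ H] := hZ; apply: H.
    have hrest : cochains x Z B (- #|t|%:Z) (rest v t).
      apply: (cochainsB hZ hB) => //; elim/big_rec: _ => [|j c jt hc].
        exact: cochains0.
      apply: (cochainsD hZ hB) => //; apply: hterm; have [hv _ _] := Hvj j jt.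
      by move: hv; rewrite cardU //; congr (cochains _ _ _ _ _); lia.
    have drest : ev B (- #|t|%:Z) (difs x (rest v t)).
      have [e0 He0] : ultimately (fun e => forall j, j \in ~: t ->
          forall s, rest v (j |: t) e s = difs x (v (j |: t)) e s).
        apply: ultimately_forall => j.
        case: (pselect (j \in ~: t)) => [jt|jt]; last by exists 0%N => e _ /jt.
        have [_ _] := Hvj j jt; apply: ultimatelyW => e He _ s.
        by apply/eqP; rewrite -subr_eq0; apply/eqP/(He s).
      exists e0.+1 => e le s.
      rewrite /B /= /rest difsB fctE; apply/eqP; rewrite subr_eq0; apply/eqP.
      rewrite difs_inv_mon; last by apply: leq_trans le.
      have dsum (I : finType) (P : pred I) (F : I -> nat -> {set 'I_r} -> K^o) :
          difs x (\sum_(i | P i) F i) e s = \sum_(i | P i) difs x (F i) e s.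
        elim/big_rec2: _ => [|i u1 u2 _ <-]; first by rewrite difs0.
        by rewrite difsD.
      rewrite dsum.
      have E j : j \in ~: t -> inv_mon (j |: t) e s = difs x (v (j |: t)) e s +
          \sum_(h in ~: (j |: t)) (sgn K (j |: t) h * x h) *: v (h |: (j |: t)) e s.
        move=> jt; rewrite -(He0 e (ltnW le) j jt s).
        by rewrite /rest !fctE !sum_cochainE subrK.
      under eq_bigr => j jt do rewrite E // scalerDr -[_ *: difs x _ e s]/((_ *: difs x _) e s) -difsZ.
      rewrite big_split /= [X in _ + X](_ : _ = 0) ?addr0 //.
      under eq_bigr => j jt do rewrite scaler_sumr.
      under eq_bigr => j jt do rewrite finset.setCU finset.setIC -finset.setDE.
      apply: antisym_sum => j h; rewrite !inE => jt ht jh.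
      rewrite !scalerA -scaleNr !finset.setUA [[set h] :|: _]finset.setUC.
      congr (_ *: _).
      pose T := h |: (j |: t).
      have TE : T = j |: (h |: t) by rewrite /T !finset.setUA [[set h] :|: _]finset.setUC.
      have jT : j \in T by rewrite !inE eqxx orbT.
      have hT : h \in T by rewrite !inE eqxx.
      have := sgn_antisym K jT hT jh.
      have -> : T :\ j = h |: t by rewrite TE finset.setU1K // !inE negb_or jh.
      have -> : T :\ h = j |: t.
        by rewrite /T finset.setU1K // !inE negb_or eq_sym jh.
      have -> : sgn K T j = sgn K (h |: t) j.
        by rewrite TE sgnU1 // !inE negb_or jh.
      have -> : sgn K T h = sgn K (j |: t) h.
        by rewrite /T sgnU1 // !inE negb_or eq_sym jh.
      rewrite [sgn K (h |: t) h]sgnU1 // [sgn K (j |: t) j]sgnU1 // => A.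
      rewrite [in RHS](_ : _ * _ = (sgn K (h |: t) j * sgn K t h) * (x h * x j)); last by ring.
      by rewrite A; ring.
    have [] := exact_coh #|t| (- #|t|%:Z) (rest v t) _ (conj hrest drest).
      move=> e s st; rewrite /rest !fctE !sum_cochainE /inv_mon.
      case: eqP => [E|_]; first by rewrite E eqxx in st.
      rewrite big1 ?subr0 // => j jt; have [_ sv _] := Hvj j jt.
      rewrite (_ : (_ *: _) e s = (sgn K t j * x j) *: v (j |: t) e s) //.
      by rewrite sv ?scaler0 // cardU // eqSS.
    move=> w [hw sw ew]; exists w => _; rewrite /good eqxx; split=> //.
    move: ew; congr ev; congr (_ - _); rewrite /rest; congr (_ - _).
    apply: eq_bigr => j jt; case: eqP => // E.
    by move: jt; rewrite inE -{1}E setU11.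
  exists (fun t => if (r < n + #|t|)%N then v t else w t) => t tr.
  have Er : rest (fun t => if (r < n + #|t|)%N then v t else w t) t = rest v t.
    rewrite /rest; congr (_ - _); apply: eq_bigr => j jt.
    by rewrite cardU // addnS -addSn tr.
  rewrite /good Er; case: ifP => [tr'|_]; first exact: Hv.
  have := Hw t tr; rewrite /good eqxx.
  suff -> : rest (fun t' => if t' == t then w t else v t') t = rest v t by [].
  rewrite /rest; congr (_ - _); apply: eq_bigr => j jt; case: eqP => // E.
  by move: jt; rewrite inE -{1}E setU11.
have [_ _ He] := Hv finset.set0.
have H1 : ultimately (fun e => forall j, v (j |: finset.set0) e finset.set0 = 0).
  apply: ultimately_forall => j; have [[Zv _] _ _] := Hv (j |: finset.set0).
  apply: ultimatelyW Zv => e Zv; apply: ZN1; have := Zv finset.set0.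
  by rewrite finset.setU0 cards1 /deg cards0 muln0 addr0.
have [e /(_ e (leqnn e))[{}He {}H1]] := ultimatelyI He H1.
have /eqP := He finset.set0.
rewrite /rest !fctE !sum_cochainE /difs /dif big_set0 subr0 big1 ?subr0 => [|j _].
  by rewrite /inv_mon eqxx /mon big_set0 expr1n (negPf K1).
rewrite (_ : (_ *: _) e _ = (sgn K finset.set0 j * x j) *: v (j |: finset.set0) e finset.set0) //.
by rewrite H1 scaler0.
Qed.

End NonVanishing.

(** * Čech cohomology by sequences *)

Section Unpack.
Variables (A : comPzRingType) (GA : nat -> set A) (r : nat) (x : 'I_r -> A).
Variables (M : lmodType A) (GM : nat -> set M).
Hypothesis GA_x : forall j, GA 1%N (x j).
Hypothesis GA_1 : GA 0%N 1.
Hypothesis GA_M : forall p q a b, GA p a -> GA q b -> GA (p + q)%N (a * b).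
Hypothesis GA_inj : forall p q a, GA p a -> GA q a -> p != q -> a = 0.
Hypothesis GM_0 : forall p, GM p 0.
Hypothesis GM_B : forall p u v, GM p u -> GM p v -> GM p (u - v).
Hypothesis GM_x : forall p j v, GM p v -> GM p.+1 (x j *: v).
Local Notation frac := Defs.frac.
Implicit Types (s t : {set 'I_r}) (c : cochain x M) (g : nat -> {set 'I_r} -> M).

(** The grading of the numerators at a low level of a cochain of negative degree
    involves negative degrees. *)
Definition zpiece (T : Type) (z0 : T) (G : nat -> set T) (p : int) : set T :=
  if p is Posz n then G n else [set z0].

Let Z : int -> set M := zpiece 0 GM.
Let B : int -> set M := fun=> [set 0].

Lemma zpiece_gsub : gsub x Z.
Proof.
split=> [[p|p]|[p|p] u v|[p|p] j v] //=.
- exact: GM_B.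
- by move=> -> ->; rewrite subrr.
- by move=> Gv; rewrite /Z /zpiece addn1; apply: GM_x.
- by move=> ->; rewrite scaler0 NegzE; case: p => [|p]; [apply: GM_0|].
Qed.

Let hZ := zpiece_gsub.
Let hB : gsub x B := gsub_zero x M.

Lemma mon_monomial s e : mon x s ^+ e \in monomials x s.
Proof. by apply/monomialsP; exists (fun=> e); rewrite /mon prodrXl. Qed.

Definition monset s e : mulset (monomials x s) := MulSet (mon_monomial s e).

Lemma frac_cancel s (m : M) (w w' : mulset (monomials x s)) a :
  val w' = a * val w -> frac m w = frac (a *: m) w'.
Proof.
move=> E; apply/eqP/fracP; exists 1; first exact: rpred1.
by rewrite scale1r E scalerA mulrC subrr.
Qed.

Lemma fracDs s (m m' : M) (w : mulset (monomials x s)) : frac m w + frac m' w = frac (m + m') w.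
Proof. by rewrite fracD -scalerDr; symmetry; apply: frac_cancel. Qed.

Lemma frac_sum s (I : Type) (q : seq I) (P : pred I) (f : I -> M) (w : mulset (monomials x s)) :
  \sum_(i <- q | P i) frac (f i) w = frac (\sum_(i <- q | P i) f i) w.
Proof.
elim/big_rec2: _ => [|i u v _ ->]; first by rewrite frac0.
exact: fracDs.
Qed.

Lemma frac_sign s (m : M) (w : mulset (monomials x s)) k :
  frac m w *~ ((-1) ^+ k) = frac ((-1) ^+ k *: m) w.
Proof.
by rewrite -[in LHS]signr_odd -[in RHS]signr_odd; case: odd; rewrite ?scale1r ?scaleN1r // mulrN1z fracN.
Qed.

(** A monomial in the [x j] with [j] in [s] divides a power of [mon x s]. *)
Lemma frac_mon0 s (m : M) e : frac m (monset s e) = 0 ->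
  ultimately (fun n => mon x s ^+ n *: m = 0).
Proof.
rewrite -(frac0 M (mulset1 (monomials x s))) => /eqP/fracP[w /monomialsP[f ->]].
rewrite /= scaler0 subr0 scale1r => fm.
exists (\max_j f j) => n fn.
suff -> : mon x s ^+ n = (\prod_(j in s) x j ^+ (n - f j)) * \prod_(j in s) x j ^+ f j.
  by rewrite -scalerA fm scaler0.
rewrite /mon -prodrXl -big_split; apply: eq_bigr => j _ /=.
by rewrite -exprD subnK // (leq_trans _ fn) // leq_bigmax.
Qed.

Definition presents c g : Prop :=
  ultimately (fun e => forall s, c s = frac (g e s) (monset s e)).

Lemma presents_difs c g : presents c g -> presents (cech_d c) (difs x g).
Proof.
apply: ultimatelyW => e cg t; rewrite /cech_d /difs /dif -frac_sum.
apply: eq_bigr => j tj; rewrite cg locm_widenE frac_sign.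
rewrite mulrC -scalerA; apply: frac_cancel => /=.
by rewrite (monD1 x tj) exprMn.
Qed.

Lemma GA_prod s (f : 'I_r -> nat) : GA (\sum_(j in s) f j)%N (\prod_(j in s) x j ^+ f j).
Proof.
have GX j n : GA n (x j ^+ n).
  by elim: n => [|n IH]; rewrite ?expr0 // exprS -add1n; apply: GA_M.
by elim/big_rec2: _ => // j a n _ IH; apply: GA_M.
Qed.

Lemma Z_prod s (f : 'I_r -> nat) p v : Z p v ->
  Z (p + (\sum_(j in s) f j)%N%:Z) ((\prod_(j in s) x j ^+ f j) *: v).
Proof.
elim/big_rec2: _ p v => [p v|j a n _ IH p v Zv]; first by rewrite addr0 scale1r.
by rewrite mulrC -scalerA PoszD addrA; apply/IH/(gsubX hZ).
Qed.

(** The degree of a monomial in the [x j] is only determined when the monomial is not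
    zero; a zero monomial makes the whole localization vanish. *)
Lemma frac_present l c : cochain_deg GA GM l c -> exists g,
  [/\ cochains x Z B l g, presents c g & forall s, c s = 0 -> forall e, g e s = 0].
Proof.
move=> hc.
have [E /(_ E (leqnn E))/choice[m Hm]] : ultimately (fun E => forall s, exists m : M,
    [/\ Z (deg l E s) m, c s = frac m (monset s E) & c s = 0 -> m = 0]).
  apply: ultimately_forall => s; case: (pselect (c s = 0)) => [c0|c0].
    by exists 0%N => E _; exists 0; split=> //; [apply: (gsub0 hZ)|rewrite frac0].
  have [//|[p [e [m [[w Ww] [Gm Gw csE lE]]]]]] := hc s.
  have /monomialsP[f wE] := Ww; rewrite /= in Gw.
  have w0 : w != 0.
    apply/eqP => w0; apply: c0; rewrite csE -(frac0 M (mulset1 (monomials x s))).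
    have wz (v : M) : w *: v = 0 by rewrite w0 scale0r.
    by apply/eqP/fracP; exists w => //; apply: wz.
  have eE : e = (\sum_(j in s) f j)%N.
    apply/eqP; apply: contraNT w0 => ne; apply/eqP/(GA_inj Gw _ ne).
    by rewrite wE; apply: GA_prod.
  exists (\max_j f j) => E fE; exists ((\prod_(j in s) x j ^+ (E - f j)) *: m); split=> //.
    have -> : deg l E s = p%:Z + (\sum_(j in s) (E - f j))%N%:Z.
      suff : (\sum_(j in s) (E - f j) + \sum_(j in s) f j = E * #|s|)%N.
        by rewrite /deg lE eE; lia.
      rewrite -big_split /= (eq_bigr (fun=> E)) => [|j _].
        by rewrite sum_nat_const mulnC.
      by rewrite subnK // (leq_trans _ fE) // leq_bigmax.
    exact: Z_prod.
  rewrite csE; apply: frac_cancel; rewrite /= wE /mon -prodrXl -big_split.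
  apply: eq_bigr => j _ /=; rewrite -exprD subnK // (leq_trans _ fE) // leq_bigmax.
  by [].
exists (gen x E m); split.
- by apply: (cochains_gen hZ hB) => s; have [] := Hm s.
- exists E => e le s; have [_ -> _] := Hm s; apply: frac_cancel => /=.
  by rewrite -exprD subnK.
- by move=> s /(let: And3 _ _ H := Hm s in H) m0 e; rewrite /gen m0 scaler0.
Qed.

Lemma cochain_of_sequence l g : cochains x Z B l g -> exists c,
  [/\ cochain_deg GA GM l c, presents c g & forall s, (forall e, g e s = 0) -> c s = 0].
Proof.
move=> hg; have [Zg _] := hg.
have [e0 He0] := ultimatelyI Zg (cochains_levels hB hg).
have [Zg0 lev] := He0 e0 (leqnn _).
exists (fun s => frac (g e0 s) (monset s e0)); split.
- move=> s; have := Zg0 s; case E: (deg l e0 s) => [p|p] Zs; last by left; rewrite Zs frac0.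
  right; exists p, (e0 * #|s|)%N, (g e0 s), (monset s e0); split=> //=.
    have := GA_prod s (fun=> e0); rewrite sum_nat_const mulnC /mon -prodrXl.
    by [].
  by rewrite -E /deg addrK.
- exists e0 => e le s; have /eqP := lev e s le; rewrite subr_eq0 => /eqP ->.
  by apply: frac_cancel => /=; rewrite -exprD subnK.
- by move=> s ->; rewrite frac0.
Qed.

Lemma presents0 l c g : cochains x Z B l g -> presents c g ->
  (forall s, c s = 0) <-> ev B l g.
Proof.
move=> hg cg; split=> [c0|[e1 g0] s]; last first.
  have [e0 He0] := cg; rewrite (He0 (maxn e0 e1) (leq_maxl _ _)).
  by rewrite (g0 _ (leq_maxr _ _)) frac0.
have [e0 He0] := ultimatelyI cg (cochains_levels hB hg).
have [ce lev] := He0 e0 (leqnn _).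
have [n0 Hn] : ultimately (fun n => forall s, mon x s ^+ n *: g e0 s = 0).
  by apply: ultimately_forall => s; apply: (@frac_mon0 s _ e0); rewrite -ce.
exists (e0 + n0)%N => e le s.
have le0 : (e0 <= e)%N by apply: leq_trans le; rewrite leq_addr.
have /eqP := lev e s le0; rewrite subr_eq0 => /eqP ->; apply: Hn.
by rewrite leq_subRL.
Qed.

Lemma presentsB c c' g g' : presents c g -> presents c' g' ->
  presents (fun s => c s - c' s) (g - g').
Proof. by apply: ultimatelyW2 => e cg cg' s; rewrite cg cg' -fracN fracDs. Qed.

(** A cochain has finitely many components, which have a common denominator
    [mon x s ^+ e] for all large [e]; its numerators form the sequence. *)
Theorem local_cohomologyP (i : nat) (l : int) :
  local_cohomology_neq0 GA x GM i l <-> cohomology_neq0 x Z B i l.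
Proof.
split=> [[c [ci cl dc nb]]|[g [gi [hg dg] nb]]].
  have [g [hg cg g0]] := frac_present cl; exists g; split.
  - by move=> e s si; apply/g0/ci.
  - split=> //; apply/(presents0 (cochains_difs hZ hB hg) (presents_difs cg)).
    exact: dc.
  move=> hb; apply: nb.
  have gi : supported i g by move=> e s si; apply/g0/ci.
  have [b [hb' bi gb]] := coboundaries_supported hZ hB gi hb.
  have [b' [b'l b'b b'0]] := cochain_of_sequence hb'; exists b'; split=> //.
    by move=> s si; apply: b'0 => e; apply: bi.
  move=> t; apply/esym/eqP; rewrite -subr_eq0; apply/eqP.
  have hgb := cochainsB hZ hB hg (cochains_difs hZ hB hb').
  by apply: (proj2 (presents0 hgb (presentsB cg (presents_difs b'b)))).
have [c [cl cg c0]] := cochain_of_sequence hg; exists c; split=> //.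
- by move=> s si; apply: c0 => e; apply: gi.
- by move=> t; apply: (proj2 (presents0 (cochains_difs hZ hB hg) (presents_difs cg))).
move=> [b [bi bl bc]]; apply: nb.
have [b' [hb' bb' b'0]] := frac_present bl; exists b' => //.
have hgb := cochainsB hZ hB hg (cochains_difs hZ hB hb').
apply: (proj1 (presents0 hgb (presentsB cg (presents_difs bb')))) => t.
by rewrite bc subrr.
Qed.

End Unpack.

(** * The bigraded pieces of the Rees algebra *)

Section GradedRing.
Variables (R : comPzRingType) (G : nat -> set R).
Hypothesis hG : graded_ring G.

Lemma graded0 p : G p 0. Proof. by have [H _ _ _ _] := hG; have [] := H p. Qed.

Lemma gradedB p u v : G p u -> G p v -> G p (u - v).
Proof. by have [H _ _ _ _] := hG; have [_ GB] := H p; apply: GB. Qed.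

Lemma gradedM p q u v : G p u -> G q v -> G (p + q)%N (u * v).
Proof. by have [_ _ GM _ _] := hG; apply: GM. Qed.

Lemma graded_decomp v : exists c : nat -> R,
  (forall p, G p (c p)) /\ ultimately (fun N => v = \sum_(p < N) c p).
Proof.
have [_ _ _ /(_ v)[N [c [Gc vE]]] _] := hG.
exists (fun p => if (p < N)%N then c p else 0); split=> [p|].
  by case: ifP => // _; apply: graded0.
by exists N => N' le; rewrite vE (big_ord_widen _ c le) big_mkcond.
Qed.

Lemma graded_coef e (c : nat -> R) v : G e v -> (forall p, G p (c p)) ->
  ultimately (fun N => v = \sum_(p < N) c p) -> v = c e.
Proof.
move=> Gv Gc [N0 vE]; have [_ _ _ _ uniq] := hG.
have lt : (e < maxn N0 e.+1)%N by rewrite leq_maxr.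
suff : c e - (if e == e then v else 0) = 0.
  by rewrite eqxx => /eqP; rewrite subr_eq0 => /eqP ->.
apply: (uniq (maxn N0 e.+1) (fun p => c p - (if p == e then v else 0))) => // [p|].
  by apply: gradedB => //; case: eqP => [->|] // _; apply: graded0.
by rewrite sumrB -vE ?leq_maxl // -big_mkcond (big_pred1 (Ordinal lt)) ?subrr.
Qed.

Lemma graded_coef_shift s e (c : nat -> R) v : G e v -> (forall p, G (p + s)%N (c p)) ->
  ultimately (fun N => v = \sum_(p < N) c p) -> v = if (s <= e)%N then c (e - s)%N else 0.
Proof.
move=> Gv Gc [N0 vE]; apply: (graded_coef (c := fun p => if (s <= p)%N then c (p - s)%N else 0)) Gv _ _.
  by move=> p; case: ifP => [sp|_]; [rewrite -[p in G p](subnK sp)|exact: graded0].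
exists (s + N0)%N => N le; have sN : (s <= N)%N by apply: leq_trans le; rewrite leq_addr.
rewrite -(subnKC sN) big_split_ord /= big1 ?add0r => [|i _]; last by rewrite leqNgt ltn_ord.
rewrite (vE (N - s)%N); last by rewrite leq_subRL.
by apply: eq_bigr => i _; rewrite leq_addr addKn.
Qed.

Lemma graded_inj p q a : G p a -> G q a -> p != q -> a = 0.
Proof.
move=> Gp Gq pq.
rewrite (graded_coef (c := fun i => if i == q then a else 0) Gp) ?(negPf pq) //.
  by move=> i; case: eqP => [->|_]; [|exact: graded0].
exists q.+1 => N lt; rewrite (bigD1 (Ordinal lt)) //= eqxx big1 ?addr0 // => i.
by rewrite -val_eqE /= => /negPf ->.
Qed.

End GradedRing.

Section Pieces.
Variables (k : fieldType) (R : comAlgType k) (G : nat -> set R) (n : nat)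
  (x : 'I_n -> R) (m d : nat) (F : 'I_m -> R).
Hypothesis hR : standard_graded G x.
Hypothesis hF : forall i, G d (F i).

Local Notation I := (base_ideal F).

Let hG : graded_ring G. Proof. by have [] := hR. Qed.

(** The piece of bidegree [(p, q)] of the Rees algebra, as a subset of [R]. *)
Definition rees_piece (g : int * int) : set R :=
  match g with
  | (Posz p, Posz q) => [set v | idealX I q v /\ G (p + q * d)%N v]
  | _ => [set 0]
  end.

Local Notation A := rees_piece.

Lemma piece0 g : A g 0.
Proof.
case: g => [[p|p] [q|q]] //=; split; last exact: graded0.
by have [] := idealX_ideal I q.
Qed.

Lemma piece_neg1 p q a : p < 0 -> A (p, q) a -> a = 0.
Proof. by case: p. Qed.

Lemma piece_neg2 p q a : q < 0 -> A (p, q) a -> a = 0.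
Proof. by case: p; case: q. Qed.

Lemma pieces_graded : graded_pieces A.
Proof.
split.
- by split=> //; rewrite mul0n; have [] := hG.
- move=> [[p|p] [q|q]] a b //=; try by move=> -> ->; rewrite subrr.
  move=> [Ia Ga] [Ib Gb]; split; last exact: gradedB.
  by apply: is_idealB => //; apply: idealX_ideal.
move=> [[p|p] [q|q]] [[p'|p'] [q'|q']] a b;
  try (by move=> -> _; rewrite mul0r; apply: piece0);
  try (by move=> _ ->; rewrite mulr0; apply: piece0).
move=> [Ia Ga] [Ib Gb]; split; first exact: idealXD.
by have := gradedM hG Ga Gb; rewrite mulnDl addnACA.
Qed.

Lemma piece_x j : A (1, 0) (x j).
Proof. by split=> //; rewrite mul0n addn0; have [] := hR. Qed.

Lemma piece_cst c : A (0, 0) (c%:A).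
Proof. by split=> //; have [_ -> _ _] := hR; exists c. Qed.

Lemma piece00 a : A (0, 0) a -> exists c : k, a = c%:A.
Proof. by move=> [_]; rewrite mul0n; have [_ -> _ _] := hR => -[c _ <-]; exists c. Qed.

(** One step of the description of the elements of [I ^ q] as the combinations of the
    products of [q] generators. *)
Lemma idealXS q v : idealX I q.+1 v <->
  exists2 f : 'I_m -> R, forall i, idealX I q (f i) & v = \sum_i F i * f i.
Proof.
have hq := idealX_ideal I q; have [J0 JD JM] := hq; split; last first.
  move=> [f If ->]; apply: is_ideal_sum => [|i _]; first exact: idealX_ideal.
  move=> J [hJ]; apply; exists (F i) => [|]; last by exists (f i).
  by move=> J' [_]; apply; exists i.
pose E := [set v | exists2 f : 'I_m -> R, forall i, idealX I q (f i) & v = \sum_i F i * f i].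
have hE : is_ideal E.
  split.
  - by exists (fun=> 0) => //; rewrite big1 // => i _; rewrite mulr0.
  - move=> _ _ [f If ->] [g Ig ->]; exists (fun i => f i + g i).
      by move=> i; apply: JD.
    by rewrite -big_split; apply: eq_bigr => i _; rewrite mulrDr.
  - move=> a _ [f If ->]; exists (fun i => a * f i); first by move=> i; apply: JM.
    by rewrite mulr_sumr; apply: eq_bigr => i _; rewrite mulrCA.
move=> Iv; apply: (Iv E); split=> // _ [a Ia [b Ib <-]].
apply: (Ia [set a | E (a * b)]); split.
  have [E0 ED EM] := hE; split=> /= [|u w Eu Ew|u w Ew].
  - by rewrite mul0r.
  - by rewrite mulrDl; apply: ED.
  - by rewrite -mulrA; apply: EM.
move=> _ [i _ <-] /=; exists (fun j => if j == i then b else 0) => [j|].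
  by case: ifP.
by rewrite (bigD1 i) //= eqxx big1 ?addr0 // => j /negPf ->; rewrite mulr0.
Qed.

Lemma pieceMF i p q v : A (p%:Z, q%:Z) v -> A (p%:Z, q.+1%:Z) (F i * v).
Proof.
move=> [Iv Gv]; split.
  apply/idealXS; exists (fun j => if j == i then v else 0) => [j|].
    by case: ifP => // _; have [] := idealX_ideal I q.
  by rewrite (bigD1 i) //= eqxx big1 ?addr0 // => j /negPf ->; rewrite mulr0.
by have := gradedM hG (hF i) Gv; rewrite mulSn addnCA.
Qed.

(** The powers of [I] are generated by forms of the same degree. *)
Lemma idealX_decomp q v : idealX I q v -> exists c : nat -> R,
  (forall p, A (p%:Z, q%:Z) (c p)) /\ ultimately (fun N => v = \sum_(p < N) c p).
Proof.
elim: q v => [|q IH] v.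
  move=> _; have [c [Gc vE]] := graded_decomp hG v.
  by exists c; split=> // p; split=> //; rewrite mul0n addn0.
move=> /idealXS[f If ->].
have /choice[c Hc] := fun i => IH _ (If i).
exists (fun p => \sum_i F i * c i p); split=> [p|].
  apply: (pieces_sum pieces_graded); first exact: piece0.
  by move=> i _; apply: pieceMF; have [] := Hc i.
apply: ultimatelyW (ultimately_forall (fun i => (Hc i).2)) => N fE.
by rewrite exchange_big; apply: eq_bigr => i _; rewrite -mulr_sumr -fE.
Qed.

Lemma idealX_low q e v : idealX I q v -> G e v -> (e < q * d)%N -> v = 0.
Proof.
move=> /idealX_decomp[c [Ac vE]] Gv lt.
rewrite (graded_coef_shift hG (s := q * d) Gv _ vE) 1?leqNgt ?lt // => p.
by have [] := Ac p.
Qed.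

Lemma piece_genF p q v : 0 < q -> A (p, q) v -> exists f : 'I_m -> R,
  (forall i, A (p, q - 1) (f i)) /\ v = \sum_i F i * f i.
Proof.
case: p q => [p|p] [[|q]|q] // _; last first.
  move=> ->; exists (fun=> 0); split=> [i|]; last by rewrite big1 // => i _; rewrite mulr0.
  exact: piece0.
have -> : q.+1%:Z - 1 = q%:Z by lia.
move=> -[/idealXS[f If vE] Gv].
have /choice[c Hc] := fun i => idealX_decomp (If i).
have Ac i p' : A (p'%:Z, q%:Z) (c i p') by have [] := Hc i.
exists (c^~ p); split=> //.
rewrite (graded_coef_shift hG (s := q.+1 * d) (c := fun p => \sum_i F i * c i p) Gv).
- by rewrite leq_addl addnK.
- move=> p'; suff [] : A (p'%:Z, q.+1%:Z) (\sum_i F i * c i p') by [].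
  apply: (pieces_sum pieces_graded); first exact: piece0.
  by move=> i _; apply: pieceMF.
apply: ultimatelyW (ultimately_forall (fun i => (Hc i).2)) => N fE.
by rewrite vE exchange_big; apply: eq_bigr => i _; rewrite -mulr_sumr -fE.
Qed.

(** The right hand sides form a subring that contains the constants and the [x j]. *)
Lemma ring_gen_x v : exists (c : k) (f : 'I_n -> R), v = c%:A + \sum_j x j * f j.
Proof.
have [_ _ _ gen] := hR.
have gv : subring_gen (range (fun c : k => c%:A) `|` range x) v by rewrite gen.
apply: (gv [set w | exists (c : k) (f : 'I_n -> R), w = c%:A + \sum_j x j * f j]); split.
  split.
  - exists 1, (fun=> 0); rewrite big1 ?addr0 ?scale1r // => j _; exact: mulr0.
  - move=> _ _ [c [f ->]] [c' [f' ->]]; exists (c - c'), (fun j => f j - f' j).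
    rewrite scalerBl opprD addrACA -sumrB; congr (_ + _).
    by apply: eq_bigr => j _; rewrite mulrBr.
  - move=> _ _ [c [f ->]] [c' [f' ->]]; exists (c * c').
    exists (fun j => c%:A * f' j + f j * (c'%:A + \sum_j x j * f' j)).
    rewrite mulrDl mulrDr -scalerAl mul1r scalerA -addrA; congr (_ + _).
    rewrite mulr_sumr mulr_suml -big_split; apply: eq_bigr => j _ /=; ring.
move=> _ [[c _ <-]|[j _ <-]].
  by exists c, (fun=> 0); rewrite big1 ?addr0 // => j _; rewrite mulr0.
exists 0, (fun i => if i == j then 1 else 0); rewrite scale0r add0r.
by rewrite (bigD1 j) //= eqxx mulr1 big1 ?addr0 // => i /negPf ->; rewrite mulr0.
Qed.

Lemma graded_gen_x p v : G p.+1 v ->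
  exists f : 'I_n -> R, (forall j, G p (f j)) /\ v = \sum_j x j * f j.
Proof.
move=> Gv; have [a [f vE]] := ring_gen_x v; have [_ G0 Gx _] := hR.
have /choice[c Hc] := fun i => graded_decomp hG (f i).
have Gc i p' : G p' (c i p') by have [] := Hc i.
exists (c^~ p); split=> //.
apply: (graded_coef hG (c := fun p => if p is p'.+1 then \sum_i x i * c i p' else a%:A) Gv).
- move=> [|p']; first by rewrite G0; exists a.
  apply: (big_ind (G p'.+1)) => [|u w Gu Gw|i _]; first exact: graded0.
    rewrite -[w]opprK; apply: gradedB => //; rewrite -sub0r; apply: gradedB => //.
    exact: graded0.
  by rewrite -add1n; apply: gradedM.
have [N0 fE] := ultimately_forall (fun i => (Hc i).2).
exists N0.+1 => -[//|N] le; rewrite vE big_ord_recl; congr (_ + _).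
by rewrite exchange_big; apply: eq_bigr => i _; rewrite -mulr_sumr -fE.
Qed.

(** By [piece_genF], the coefficients of [v] with respect to the products of the [F i] have
    the first degree of [v], and [graded_gen_x] applies to them. *)
Lemma piece_genx p q v : 0 < p -> A (p, q) v -> exists f : 'I_n -> R,
  (forall j, A (p - 1, q) (f j)) /\ v = \sum_j x j * f j.
Proof.
case: p q => [[|p]|p] [q|q] // _; last first.
  move=> ->; exists (fun=> 0); split=> [i|]; last by rewrite big1 // => i _; rewrite mulr0.
  exact: piece0.
have -> : p.+1%:Z - 1 = p%:Z by lia.
elim: q v => [|q IH] v.
  move=> [_]; rewrite mul0n addn0 => /graded_gen_x[f [Gf vE]].
  by exists f; split=> // j; split=> //; rewrite mul0n addn0.
move=> Av; have q0 : 0 < q.+1%:Z by [].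
have [f [Af ->]] := piece_genF q0 Av.
have {}Af i : A (p.+1%:Z, q%:Z) (f i) by have := Af i; have -> : q.+1%:Z - 1 = q%:Z by lia.
have /choice[g Hg] := fun i => IH _ (Af i).
exists (fun j => \sum_i F i * g i j); split=> [j|].
  apply: (pieces_sum pieces_graded); first exact: piece0.
  by move=> i _; apply: pieceMF; have [] := Hg i.
under [RHS]eq_bigr => j _ do rewrite mulr_sumr.
rewrite exchange_big; apply: eq_bigr => i _ /=.
have [_ {1}->] := Hg i; rewrite mulr_sumr; apply: eq_bigr => j _.
by rewrite mulrCA.
Qed.

Lemma piece_F i : A (0, 1) (F i).
Proof.
have [A1 _ _] := pieces_graded; rewrite -[F i]mulr1; exact: (@pieceMF i 0 0 1 A1).
Qed.

Lemma pieces_noetherian : gacc A (fun=> [set 0]).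
Proof.
pose wt (g : int * int) : int := g.1 + g.2.
pose L := [seq ((1, 0) : int * int, x j) | j <- enum 'I_n] ++
          [seq ((0, 1) : int * int, F i) | i <- enum 'I_m].
have h0 : gideal A (fun=> [set 0]).
  split=> [g _ ->|g|g a b -> ->|g h a b _ ->]; rewrite ?addr0 ?mulr0 //.
  exact: piece0.
have hL gy : gy \in L -> 0 < wt gy.1 /\ A gy.1 gy.2.
  rewrite mem_cat => /orP[/mapP[j _ ->]|/mapP[i _ ->]].
    by split=> //; apply: piece_x.
  by split=> //; apply: piece_F.
have key (L' : seq (int * int * R)) N : {subset L' <= L} -> gideal A N ->
    let N' := foldl (fun N gy => addgen N A gy.1 gy.2) N L' in
    [/\ gideal A N', forall g, N g `<=` N' g & forall gy g a, gy \in L' ->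
        A (g - gy.1) a -> N' g (gy.2 * a)].
  elim: L' N => [|gy L' IH] N sL hN /=; first by split=> // g v.
  have gyL : gy \in L by apply: sL; rewrite mem_head.
  have [//||hN' NN' LN'] := IH (addgen N A gy.1 gy.2).
  - by move=> z zL'; apply: sL; rewrite inE zL' orbT.
  - apply: (@addgen_gideal _ _ _ _ _ A) => //; last first.
    + by apply: (A_gideal pieces_graded) => g; apply: piece0.
    + by apply: (A_gideal pieces_graded) => g; apply: piece0.
    + by have [] := hN.
    + move=> h a Aa; rewrite -[h](subrK gy.1) addrC.
      by have [_ _ AM] := pieces_graded; apply: AM => //; apply: (hL gy gyL).2.
  split=> //.
    move=> g v Nv; apply: NN'; exists v, 0; split=> //; first exact: piece0.
    by rewrite mulr0 addr0.
  move=> z g a; rewrite inE => /orP[/eqP->|zL'] Aa; last exact: LN'.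
  apply: NN'; exists 0, a; split=> //; last by rewrite add0r.
  by have [_ + _ _] := hN; exact.
have [//|hN _ LN] := key L (fun=> [set 0]) _ h0.
apply: (graded_hilbert_basis pieces_graded (wt := wt) _ _ _ _ hL) => //.
- by move=> g h; rewrite /wt /=; ring.
- by move=> [[p|p] [q|q]].
- exact: piece0.
- move=> a /piece00[c ->] c0; exists (c^-1)%:A; first exact: piece_cst.
  rewrite -scalerAl mul1r scalerA mulVf ?scale1r //.
  by apply: contraNneq c0 => ->; rewrite scale0r.
move=> [p q] g0 v Av.
have [p0|p0|p0] := ltgtP p 0.
- by rewrite (piece_neg1 p0 Av); have [_ + _ _] := hN; exact.
- have [f [Af ->]] := piece_genx p0 Av; apply: (gideal_sum _ hN) => j _.
  apply: (LN ((1, 0), x j)); first by rewrite mem_cat map_f ?mem_enum.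
  have := Af j; congr (A (_, _) _); rewrite /=; ring.
have [q0|q0|q0] := ltgtP q 0.
- by rewrite (piece_neg2 q0 Av); have [_ + _ _] := hN; exact.
- have [f [Af ->]] := piece_genF q0 Av; apply: (gideal_sum _ hN) => i _.
  apply: (LN ((0, 1), F i)); first by rewrite mem_cat orbC map_f ?mem_enum.
  have := Af i; congr (A (_, _) _); rewrite /=; ring.
by rewrite p0 q0 eqxx in g0.
Qed.

End Pieces.

(** * Closed points of the image *)

Section Image.
Variables (k : fieldType) (R : comAlgType k) (G : nat -> set R) (n : nat)
  (x : 'I_n -> R) (m d : nat) (F : 'I_m -> R).
Hypothesis hR : standard_graded G x.
Hypothesis hF : forall i, G d (F i).

Local Notation I := (base_ideal F).
Local Notation A := (rees_piece G d F).
Local Notation Proj_image := (Proj (@image_gr k R m F)).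

Let hA : graded_pieces A. Proof. exact: (pieces_graded d F hR). Qed.
Let A0 g : A g 0. Proof. exact: (piece0 d F hR). Qed.

(** The coordinate ring of the image: its piece of degree [q] is spanned by the
    products of [q] generators [F i]. *)
Definition degree0 (q : int) : set R := A (0, q).
Local Notation S := degree0.

Lemma degree0_graded : graded_pieces S.
Proof.
have [A1 AB AM] := hA; split=> // [g a b|g h a b Sa Sb]; first exact: AB.
exact: (AM (0, g) (0, h)).
Qed.

Let hS := degree0_graded.

Lemma degree0F i : S 1 (F i). Proof. exact: (piece_F hR hF). Qed.

Lemma degree0_gen q v : 0 < q -> S q v -> exists f : 'I_m -> R,
  (forall i, S (q - 1) (f i)) /\ v = \sum_i F i * f i.
Proof. exact: (piece_genF hR hF). Qed.

Lemma S_gideal : gideal S S.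
Proof. exact: (A_gideal hS (fun q => A0 (0, q))). Qed.

(** As [S] is generated in degree [1], the induction on [N2] can peel off one [F i],
    and replace [J] by [(J : F i)]. *)
Lemma degree0_products J (N2 N1 : nat) : gideal S J ->
  (forall u v, S N2%:Z u -> S N1%:Z v -> J (N2%:Z + N1%:Z) (u * v)) ->
  S (N2%:Z + N1%:Z) `<=` J (N2%:Z + N1%:Z).
Proof.
elim: N2 J => [|N2 IH] J hJ H w Sw.
  rewrite -[w]mul1r; apply: H; first by have [] := hS.
  by move: Sw; rewrite add0r.
have [|f [Sf ->]] := degree0_gen _ Sw; first by lia.
apply: (gideal_sum _ hJ) => i _.
have hC : gideal S (colon J S 1 (F i)).
  by apply: colon_gideal => //; [exact: degree0F|exact: S_gideal].
have [||_] := IH _ hC _ (f i) (_ : S (N2%:Z + N1%:Z) (f i)).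
- move=> u v Su Sv; split; first by have [_ _ SM] := hS; apply: SM.
  have := H (F i * u) v; rewrite mulrA addrA; apply=> //.
  have [_ _ SM] := hS; have := SM _ _ _ _ (degree0F i) Su.
  by congr (S _ _); lia.
- by have := Sf i; congr (S _ _); lia.
by congr (J _ _); lia.
Qed.

Lemma degree0_up J (N M : nat) : gideal S J -> S N%:Z `<=` J N%:Z -> (N <= M)%N ->
  S M%:Z `<=` J M%:Z.
Proof.
move=> hJ H /subnK <-; rewrite PoszD; apply: degree0_products => // u v Su Sv.
by have [_ _ _ JM] := hJ; apply: JM => //; apply: H.
Qed.

(** The element [a t ^ q] of the Rees algebra, for [a] in [I ^ q]. *)
Definition rees_elt (q : nat) (a : R) : rees I := insubd (0 : rees I) (a *: 'X^q).

Lemma val_rees_elt q a : idealX I q a -> val (rees_elt q a) = a *: 'X^q.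
Proof.
move=> Ia; rewrite /rees_elt val_insubd ifT //; apply/reesP => q'.
rewrite coefZ coefXn; case: eqP => [->|_]; first by rewrite mulr1.
by rewrite mulr0; have [] := idealX_ideal I q'.
Qed.

Lemma val_inj_rees_elt (u : rees I) q a : idealX I q a -> val u = a *: 'X^q -> u = rees_elt q a.
Proof. by move=> Ia uE; apply: val_inj; rewrite uE val_rees_elt. Qed.

Lemma rees_eltM q q' a b : idealX I q a -> idealX I q' b ->
  rees_elt q a * rees_elt q' b = rees_elt (q + q') (a * b).
Proof.
move=> Ia Ib; apply: val_inj; rewrite rmorphM /= !val_rees_elt //; last exact: idealXD.
by rewrite -scalerAl -scalerAr scalerA exprD.
Qed.

Lemma rees_eltD q a b : idealX I q a -> idealX I q b -> rees_elt q (a + b) = rees_elt q a + rees_elt q b.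
Proof.
move=> Ia Ib; apply: val_inj; rewrite rmorphD /= !val_rees_elt ?scalerDl //.
by have [_ JD _] := idealX_ideal I q; apply: JD.
Qed.

Lemma rees_elt0 q : rees_elt q 0 = 0.
Proof.
apply: val_inj; rewrite val_rees_elt ?scale0r ?rmorph0 //.
by have [] := idealX_ideal I q.
Qed.

Lemma rees_elt1 : rees_elt 0 1 = 1.
Proof. by apply: val_inj; rewrite val_rees_elt // rmorph1 expr0 scale1r. Qed.

Lemma degree0_idealX (q : nat) a : S q%:Z a -> idealX I q a.
Proof. by case. Qed.

Lemma image_coef u q : u \in @image_pred k R m F -> S q%:Z (val u)`_q.
Proof.
move=> /Defs.imageP Iu.
apply: (Iu [set u : rees I | forall q : nat, S q%:Z (val u)`_q]).
have [S1 SB SM] := hS; split.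
  split=> [q'|u1 u2 S1' S2 q'|u1 u2 Su1 Su2 q'].
  - rewrite rmorph1 coef1; case: q' => [|q'] //=; exact: A0.
  - by rewrite rmorphB coefB; apply: SB.
  rewrite rmorphM coefM; apply: (gideal_sum _ S_gideal) => i _.
  have := SM _ _ _ _ (Su1 i) (Su2 (q' - i)%N); rewrite -PoszD subnKC //.
  by rewrite -ltnS.
move=> v [[c vE]|[i vE]] q'; rewrite vE.
  rewrite coefC; case: q' => [|q'] /=; last exact: A0.
  exact: (piece_cst d F hR).
rewrite coefZ coefX; case: eqP => [->|_]; last by rewrite mulr0; apply: A0.
by rewrite mulr1; apply: degree0F.
Qed.

Lemma rees_elt_image (q : nat) a : S q%:Z a -> rees_elt q a \in @image_pred k R m F.
Proof.
elim: q a => [|q IH] a Sa.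
  have [c ac] := piece00 hR Sa.
  apply/Defs.imageP => E [_ gE]; apply: gE; left; exists c.
  by rewrite val_rees_elt ?expr0 ?alg_polyC ?ac //; case: Sa.
have [//|f [Sf aE]] := degree0_gen _ Sa.
have {}Sf i : S q%:Z (f i) by have := Sf i; congr (S _ _); lia.
have -> : rees_elt q.+1 a = \sum_i rees_elt 1 (F i) * rees_elt q (f i).
  have IF i : idealX I 1 (F i) by have [] := degree0F i.
  have IfF i : idealX I q.+1 (F i * f i).
    by rewrite -add1n; apply: idealXD => //; have [] := Sf i.
  apply: val_inj; rewrite val_rees_elt; last by case: Sa.
  rewrite rmorph_sum aE scaler_suml; apply: eq_bigr => i _.
  have If : idealX I q (f i) by have [] := Sf i.
  by rewrite (rees_eltM (IF i) If) add1n; symmetry; apply: val_rees_elt.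
apply: rpred_sum => i _; apply: rpredM; last exact: IH.
apply/Defs.imageP => E [_ gE]; apply: gE; right; exists i.
by rewrite val_rees_elt ?expr1 //; have [] := degree0F i.
Qed.

Definition image_elt (q : nat) (a : R) : image_ring F := insubd (0 : image_ring F) (rees_elt q a).

Lemma val_image_elt (q : nat) a : S q%:Z a -> val (image_elt q a) = rees_elt q a.
Proof. by move=> Sa; rewrite /image_elt val_insubd ifT //; apply: rees_elt_image. Qed.

Definition coef_image (q : nat) (s : image_ring F) : R := (val (val s))`_q.

Lemma coef_imageP q s : S q%:Z (coef_image q s).
Proof. exact: (image_coef q (valP s)). Qed.

Lemma coef_image_elt (q q' : nat) a : S q%:Z a ->
  coef_image q' (image_elt q a) = if q' == q then a else 0.
Proof.
move=> Sa; rewrite /coef_image val_image_elt // val_rees_elt; last by case: Sa.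
by rewrite coefZ coefXn; case: eqP; rewrite ?mulr1 ?mulr0.
Qed.

Lemma image_eltM (q q' : nat) a b : S q%:Z a -> S q'%:Z b -> image_elt q a * image_elt q' b = image_elt (q + q') (a * b).
Proof.
move=> Sa Sb; apply: val_inj; rewrite rmorphM /= !val_image_elt //; last first.
  by have [_ _ SM] := hS; apply: (SM q%:Z q'%:Z).
by apply: rees_eltM; [case: Sa|case: Sb].
Qed.

Lemma image_eltD (q : nat) a b : S q%:Z a -> S q%:Z b -> image_elt q (a + b) = image_elt q a + image_elt q b.
Proof.
move=> Sa Sb; apply: val_inj; rewrite rmorphD /= !val_image_elt //; last exact: (piecesD hS).
by apply: rees_eltD; [case: Sa|case: Sb].
Qed.

Lemma image_elt0 q : image_elt q 0 = 0.
Proof. by apply: val_inj; rewrite val_image_elt ?rees_elt0 ?rmorph0 //; apply: A0. Qed.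

Lemma image_elt1 : image_elt 0 1 = 1.
Proof. by apply: val_inj; rewrite val_image_elt ?rees_elt1 ?rmorph1 //; have [] := hS. Qed.

Lemma image_grP q s : image_gr q s <-> s = image_elt q (coef_image q s).
Proof.
split=> [[a sE]|->].
  have aE : coef_image q s = a by rewrite /coef_image sE coefZ coefXn eqxx mulr1.
  apply: val_inj; rewrite val_image_elt; last exact: coef_imageP.
  by apply: val_inj_rees_elt; [have [] := coef_imageP q s|rewrite aE].
exists (coef_image q s); rewrite val_image_elt; last exact: coef_imageP.
by rewrite val_rees_elt //; have [] := coef_imageP q s.
Qed.

Lemma image_gr_elt (q : nat) a : S q%:Z a -> image_gr q (image_elt q a).
Proof. by move=> Sa; apply/image_grP; rewrite coef_image_elt // eqxx. Qed.

Lemma image_decomp s : exists N, s = \sum_(q < N) image_elt q (coef_image q s).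
Proof.
exists (size (val (val s))); apply: val_inj; apply: val_inj.
rewrite !rmorph_sum /= -[LHS]coefK poly_def; apply: eq_bigr => q _.
rewrite val_image_elt; last exact: coef_imageP.
by rewrite val_rees_elt //; have [] := coef_imageP q s.
Qed.

Lemma coef_image_sum N (c : nat -> image_ring F) q : (forall p, image_gr p (c p)) ->
  (q < N)%N -> coef_image q (\sum_(p < N) c p) = coef_image q (c q).
Proof.
move=> hc qN; rewrite /coef_image !rmorph_sum coef_sum (bigD1 (Ordinal qN)) //=.
rewrite big1 ?addr0 // => p pq; have [a ->] := hc p; rewrite coefZ coefXn.
by rewrite eq_sym -val_eqE in pq; rewrite (negPf pq) mulr0.
Qed.

Lemma coef_imageM q s t : coef_image q (s * t) =
  \sum_(i < q.+1) coef_image i s * coef_image (q - i) t.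
Proof. by rewrite /coef_image !rmorphM coefM. Qed.

(** The homogeneous pieces of an ideal of the image ring, as subsets of [R] indexed by
    all integers, so that they form a [gideal]. *)
Definition ideal_piece (P : set (image_ring F)) (q : int) : set R :=
  [set a | S q a /\ forall q' : nat, q = q'%:Z -> P (image_elt q' a)].

Lemma ideal_piece_gideal (P : set (image_ring F)) : is_ideal P -> gideal S (ideal_piece P).
Proof.
move=> [P0 PD PM]; have [_ _ SM] := hS; split.
- by move=> q a [].
- by move=> q; split=> [|q' _]; [exact: A0|rewrite image_elt0].
- move=> q a b [Sa Pa] [Sb Pb]; split=> [|q' qE]; first exact: (piecesD hS).
  by rewrite qE in Sa Sb; rewrite image_eltD //; apply: PD; auto.
move=> h q a b Sa [Sb Pb]; split=> [|q' qE]; first exact: SM.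
case: h q => [h|h] [q|q] in qE Sa Sb Pb *.
- rewrite -PoszD in qE; case: qE => <-; rewrite -image_eltM //; apply: PM.
  exact: Pb.
- by rewrite (piece_neg2 _ Sb) // mulr0 image_elt0.
- by rewrite (piece_neg2 _ Sa) // mul0r image_elt0.
- by rewrite (piece_neg2 _ Sa) // mul0r image_elt0.
Qed.

Lemma ideal_pieceP (P : set (image_ring F)) (q : nat) a : ideal_piece P q%:Z a <-> S q%:Z a /\ P (image_elt q a).
Proof. by split=> [[Sa H]|[Sa Pa]]; split=> //; [exact: H|move=> q' [<-]]. Qed.

Lemma proj_eq (P P' : Proj_image) : (P : set _) = P' -> P = P'.
Proof.
case: P P' => [[P hP] hPh hPr] [[P' hP'] hP'h hP'r] /= E; subst P'.
rewrite (Prop_irrelevance hP' hP) in hP'h hP'r *.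
by congr ProjPoint; apply: Prop_irrelevance.
Qed.

Lemma proj_image_elt (P : Proj_image) s : spec_pt P s <-> forall q : nat, spec_pt P (image_elt q (coef_image q s)).
Proof.
have [hI _ _] := specP P; split=> [Ps q|H].
  have [N sE] := image_decomp s.
  case: (ltnP q N) => [qN|Nq].
    apply: (@proj_homogeneous _ _ P N (fun q => image_elt q (coef_image q s))) => // [p|].
      exact/image_gr_elt/coef_imageP.
    by rewrite -sE.
  suff -> : coef_image q s = 0 by rewrite image_elt0; case: hI.
  rewrite sE /coef_image !rmorph_sum coef_sum big1 // => p _ /=.
  have Sp := coef_imageP p s.
  have := coef_image_elt q Sp; rewrite /coef_image => ->.
  by rewrite gtn_eqF // (leq_trans (ltn_ord p)).
have [N ->] := image_decomp s.
exact: is_ideal_sum.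
Qed.

Lemma proj_F (P : Proj_image) : exists i, ~ spec_pt P (image_elt 1 (F i)).
Proof.
apply: contrapT => H; apply: (proj_relevant (p := P)) => s [p /= p0] /image_grP ->.
have [hI _ _] := specP P.
have [|f [Sf E]] := degree0_gen _ (coef_imageP p s); first by lia.
have PF i : spec_pt P (image_elt 1 (F i)) by apply: contrapT => nP; apply: H; exists i.
have [_ _ _ TM] := ideal_piece_gideal hI.
suff /ideal_pieceP[] : ideal_piece (spec_pt P) p%:Z (coef_image p s) by [].
rewrite E; apply: (gideal_sum _ (ideal_piece_gideal hI)) => i _.
have -> : p%:Z = (p%:Z - 1) + 1 by lia.
rewrite mulrC; apply: TM => //; apply/(ideal_pieceP (spec_pt P) 1); split=> //; exact: degree0F.
Qed.

Lemma proj_power (P : Proj_image) i q : ~ spec_pt P (image_elt 1 (F i)) ->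
  S q%:Z (F i ^+ q) /\ ~ spec_pt P (image_elt q (F i ^+ q)).
Proof.
move=> nP; have [_ P1 PM] := specP P.
have SX q' : S q'%:Z (F i ^+ q').
  have := piecesX hS q' (degree0F i); congr (S _ _); lia.
split=> //; elim: q => [|q IH]; first by rewrite expr0 image_elt1.
rewrite exprS -add1n -image_eltM; [|exact: degree0F|exact: SX].
by case/PM.
Qed.

(** The homogeneous ideals that contain no power of the irrelevant ideal. *)
Definition relevant_family (J : int -> set R) : Prop :=
  gideal S J /\ forall N : nat, ~ (S N%:Z `<=` J N%:Z).

Lemma degree0_chain (N : nat -> int -> set R) : (forall i, gideal S (N i)) ->
  (forall i q, N i q `<=` N i.+1 q) -> exists J, forall i q, N i q `<=` N J q.
Proof.
move=> hN incN; have [_ _ AM] := hA.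
have [||| J HJ] := pieces_noetherian hR hF
  (N := fun i g => [set v | A g v /\ (g.1 = 0 -> N i g.2 v)]).
- move=> i; have [NS N0 ND NM] := hN i; split.
  + by move=> g v [].
  + by move=> g; split=> // _.
  + move=> g a b [Aa Na] [Ab Nb]; split=> [|g0]; first exact: (piecesD hA).
    by apply: ND; auto.
  move=> [h h'] [p q] a v Aa [Av Nv]; split=> [|/= hp]; first exact: AM.
  have [h0|h0|h0] := ltgtP h 0.
  + by rewrite (piece_neg1 h0 Aa) mul0r.
  + have p0 : p < 0 by lia.
    by rewrite (piece_neg1 p0 Av) mulr0.
  have p0 : p = 0 by lia.
  by apply: NM; [rewrite /S -h0|apply: Nv].
- move=> i g v ->; split=> [|_]; first exact: A0.
  by have [_ + _ _] := hN i; exact.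
- by move=> i g v [Av Nv]; split=> // g0; apply/incN/Nv.
exists J => i q v Nv; have [NS _ _ _] := hN i.
by have [//|_] := HJ i (0, q) v; [split=> //; apply: NS|apply].
Qed.

Lemma maximal_family (J : int -> set R) : relevant_family J -> exists J',
  [/\ relevant_family J', forall q, J q `<=` J' q & forall J'', relevant_family J'' ->
      (forall q, J' q `<=` J'' q) -> forall q, J'' q `<=` J' q].
Proof.
move=> hJ; apply: contrapT => H.
pose T := {J' | relevant_family J' /\ forall q, J q `<=` J' q}.
have /choice[next Hnext] : forall t : T, exists t' : T,
    (forall q, sval t q `<=` sval t' q) /\ ~ (forall q, sval t' q `<=` sval t q).
  move=> [J' [hJ' JJ']] /=; apply: contrapT => nt; apply: H; exists J'; split=> //.
  move=> J'' hJ'' J'J''; apply: contrapT => nle; apply: nt.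
  have h : relevant_family J'' /\ forall q, J q `<=` J'' q.
    by split=> // q v /JJ' /J'J''.
  by exists (exist _ J'' h).
pose t0 : T := exist _ J (conj hJ (fun q v Jv => Jv)).
pose N i := sval (iter i next t0).
have [||j Hj] := @degree0_chain N.
- by move=> i; have [[]] := svalP (iter i next t0).
- by move=> i; have [] := Hnext (iter i next t0).
by have [_] := Hnext (iter j next t0); apply; apply: (Hj j.+1).
Qed.

(** A maximal relevant homogeneous ideal [J'] is prime: if it contained the product of
    [a] and [b] but neither factor, then [J' + (a)] and [J' + (b)] would contain
    [S_N1] and [S_N2], and [J'] would contain [S_(N1 + N2)]. It is a closed
    point, since a larger homogeneous prime that misses some [F i] misses all its
    powers, hence is relevant as well. *)
Lemma closed_point_above (J : int -> set R) : relevant_family J ->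
  exists P : Proj_image, closed_point P /\
    forall (q : nat) a, J q%:Z a -> spec_pt P (image_elt q a).
Proof.
move=> /maximal_family[J' [[hJ' relJ'] JJ' maxJ']].
have [JS J0 JD JM] := hJ'; have [S1 _ SM] := hS.
have prime_hom (q q' : nat) a b : S q%:Z a -> S q'%:Z b -> J' (q%:Z + q'%:Z) (a * b) ->
    J' q%:Z a \/ J' q'%:Z b.
  move=> Sa Sb Jab; apply: contrapT => /not_orP[na nb].
  have add (e : nat) c : S e%:Z c -> ~ J' e%:Z c ->
      exists N : nat, S N%:Z `<=` addgen J' S e%:Z c N%:Z.
    move=> Sc nc; apply: contrapT => H; apply: nc.
    apply: (maxJ' (addgen J' S e%:Z c)); last 1 first.
    - exists 0, 1; split; [exact: J0|by rewrite subrr|by rewrite mulr1 add0r].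
    - split=> [|N SN]; last by apply: H; exists N.
      apply: (@addgen_gideal _ _ _ _ _ S) => //; [|exact: S_gideal..].
      move=> h v Sv; rewrite -[h](subrK e%:Z) mulrC; exact: SM.
    - move=> h v Jv; exists v, 0; split=> //; last by rewrite mulr0 addr0.
      exact: A0.
  have [N1 H1] := add _ _ Sa na; have [N2 H2] := add _ _ Sb nb.
  apply: (relJ' (N1 + N2)%N); rewrite PoszD.
  apply: degree0_products => // u v Su Sv.
  have [j1 [c1 [Jj1 Sc1 uE]]] := H1 u Su; have [j2 [c2 [Jj2 Sc2 vE]]] := H2 v Sv.
  have -> : u * v = v * j1 + (a * c1) * j2 + (c1 * c2) * (a * b).
    rewrite uE vE; ring.
  apply: (JD); [apply: (JD)|].
  - by rewrite addrC; apply: JM.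
  - apply: JM => //; rewrite -[N1%:Z](subrK q%:Z) mulrC; exact: SM.
  have -> : N1%:Z + N2%:Z = ((N1%:Z - q%:Z) + (N2%:Z - q'%:Z)) + (q%:Z + q'%:Z) by ring.
  by apply: JM => //; apply: SM.
pose P := [set s : image_ring F | forall q : nat, J' q%:Z (coef_image q s)].
have P_img (q : nat) a : S q%:Z a -> P (image_elt q a) <-> J' q%:Z a.
  move=> Sa; split=> [/(_ q)|Ja q']; rewrite coef_image_elt ?eqxx //.
  by case: eqP => [->|_].
have hP : is_prime P.
  split.
  - split.
    + by move=> q; rewrite /coef_image !rmorph0 coef0.
    + by move=> s t Ps Pt q; rewrite /coef_image !rmorphD coefD; apply: JD; [exact: Ps|exact: Pt].
    move=> s t Pt q; rewrite coef_imageM; apply: (gideal_sum _ hJ') => i _.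
    have -> : q%:Z = i%:Z + (q - i)%N%:Z by rewrite -PoszD subnKC // -ltnS.
    by apply: JM; [exact: coef_imageP|exact: Pt].
  - move=> P1; apply: (relJ' 0%N) => a Sa; rewrite -[a]mulr1 -[0%:Z]addr0.
    by apply: JM => //; have := P1 0%N; rewrite -image_elt1 coef_image_elt.
  move=> s t Pst; apply: contrapT => /not_orP[ns nt].
  (* The components of least degree outside the ideal decide for inhomogeneous
     elements. *)
  have first_out u : ~ P u -> exists q : nat, ~ J' q%:Z (coef_image q u) /\
      forall q', (q' < q)%N -> J' q'%:Z (coef_image q' u).
    move=> nPu; have ex : exists q : nat, `[< ~ J' q%:Z (coef_image q u) >].
      by apply: contrapT => nex; apply: nPu => q; apply: contrapT => nq; apply: nex; exists q; apply/asboolP.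
    case: (ex_minnP ex) => q /asboolP nq minq; exists q; split=> // q' lt.
    by apply: contrapT => nq'; have := minq q' (introT (asboolP _) nq'); rewrite leqNgt lt.
  have [q [nq minq]] := first_out _ ns; have [q' [nq' minq']] := first_out _ nt.
  have := Pst (q + q')%N; rewrite coef_imageM.
  have lt : (q < (q + q').+1)%N by rewrite ltnS leq_addr.
  rewrite (bigD1 (Ordinal lt)) //= addKn => Jsum.
  have Jrest : J' (q + q')%N%:Z (\sum_(i < (q + q').+1 | i != Ordinal lt)
      coef_image i s * coef_image (q + q' - i) t).
    apply: (gideal_sum _ hJ') => i; rewrite -val_eqE /= neq_ltn => /orP[iq|qi].
      have -> : (q + q')%N%:Z = (q + q' - i)%N%:Z + i%:Z by rewrite -PoszD subnK // -ltnS.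
      by rewrite mulrC; apply: JM; [exact: coef_imageP|exact: minq].
    have -> : (q + q')%N%:Z = i%:Z + (q + q' - i)%N%:Z by rewrite -PoszD subnKC // -ltnS.
    apply: JM; [exact: coef_imageP|apply: minq'].
    by have := ltn_ord i; lia.
  have := gidealB hS hJ' Jsum Jrest; rewrite addrK PoszD.
  by case/(prime_hom _ _ _ _ (coef_imageP q s) (coef_imageP q' t)).
pose SP := SpecPoint hP.
have homP : homogeneous (@image_gr k R m F) SP.
  move=> N c hc Pc p pN /= q.
  have /image_grP cE := hc p; rewrite cE coef_image_elt; last exact: coef_imageP.
  case: eqP => [->|_]; last exact: J0.
  by have := Pc p; rewrite coef_image_sum.
have relP : ~ (irrelevant (@image_gr k R m F) `<=` SP).
  move=> H; apply: (relJ' 1%N) => a Sa; apply/(P_img 1%N a Sa)/H.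
  by exists 1%N => //; apply: image_gr_elt.
exists (ProjPoint homP relP); split=> [|q a Ja]; last first.
  by apply/P_img; [apply/JS/JJ'|apply: JJ'].
exists P; apply/seteqP; split=> [_ -> //|P' PP'] /=.
apply: proj_eq; apply/seteqP; split=> s /= Ps; last exact: PP'.
have hP' := specP P'; have [hI' P'1 P'M] := hP'.
have J'P' : forall q, J' q `<=` ideal_piece (spec_pt P') q.
  move=> q a Ja; split=> [|q' qE]; first exact: JS.
  by rewrite qE in Ja; apply/PP'/P_img => //; apply: JS.
have relP' : relevant_family (ideal_piece (spec_pt P')).
  split=> [|N SN]; first exact: ideal_piece_gideal.
  have [i ni] := proj_F P'; have [SN' nN] := proj_power N ni.
  by have /ideal_pieceP[_ /nN] := SN _ SN'.
move=> q; apply: (maxJ' _ relP' J'P'); apply/ideal_pieceP; split; first exact: coef_imageP.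
by apply: (proj1 (proj_image_elt P' s)).
Qed.

End Image.

(** * Fibers as localizations *)

Section FiberCohomology.
Variables (k : fieldType) (R : comAlgType k) (G : nat -> set R) (n : nat)
  (x : 'I_n -> R) (m d : nat) (F : 'I_m -> R).
Hypothesis hR : standard_graded G x.
Hypothesis hF : forall i, G d (F i).
Variable P : Proj (@image_gr k R m F).

Local Notation I := (base_ideal F).
Local Notation A := (rees_piece G d F).
Local Notation S := (degree0 G d F).
Local Notation frac := Defs.frac.

Let hA : graded_pieces A. Proof. exact: (pieces_graded d F hR). Qed.
Let A0 g : A g 0. Proof. exact: (piece0 d F hR). Qed.
Let hS := degree0_graded d F hR.

Lemma piece_idealX p (q : nat) a : A (p, q%:Z) a -> idealX I q a.
Proof. by case: p => p; [case|move=> ->; have [] := idealX_ideal I q]. Qed.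

Definition unit_at (q : nat) (w : R) : Prop := S q%:Z w /\ ~ spec_pt P (image_elt F q w).

Lemma unit_at1 : unit_at 0 1.
Proof.
have [_ P1 _] := specP P.
by split; [have [] := hS|rewrite (image_elt1 hR hF)].
Qed.

Lemma unit_atM q q' w w' : unit_at q w -> unit_at q' w' -> unit_at (q + q') (w * w').
Proof.
move=> [Sw Pw] [Sw' Pw']; split; first by have [_ _ SM] := hS; apply: (SM q%:Z q'%:Z).
by rewrite -(image_eltM hR hF) //; have [_ _ PM] := specP P; case/PM.
Qed.

Lemma unit_at_prod (J : eqType) (s : seq J) (Q : pred J) (q : J -> nat) (w : J -> R) :
  (forall j, unit_at (q j) (w j)) ->
  unit_at (\sum_(j <- s | Q j) q j) (\prod_(j <- s | Q j) w j).
Proof.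
by move=> H; elim/big_rec2: _ => [|j a b _ IH]; [exact: unit_at1|exact: unit_atM].
Qed.

Lemma unit_at_idealX q w : unit_at q w -> idealX I q w.
Proof. by case=> /degree0_idealX. Qed.

Lemma unit_at_denoms q w : unit_at q w -> rees_elt F q w \in denoms P.
Proof.
move=> [Sw Pw]; apply/denomsP; exists (image_elt F q w); split=> //.
  exact: (val_image_elt hR hF).
by exists q; apply: (image_gr_elt hR hF).
Qed.

Lemma denoms_unit_at (w : mulset (denoms P)) q : rees_t q (val w) ->
  exists2 b, unit_at q b & val w = rees_elt F q b.
Proof.
move=> wq; have /denomsP[s [sw Ps [q' /(image_grP hR hF) sE]]] := valP w.
have Sb := coef_imageP hR hF q' s.
have wE : val w = rees_elt F q' (coef_image q' s) by rewrite -sw {1}sE (val_image_elt hR hF).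
suff qq' : q = q' by rewrite qq'; exists (coef_image q' s); rewrite // /unit_at -sE.
apply: contrapT => /eqP qq'; apply: Ps; have [[P0 _ _] _ _] := specP P.
suff -> : s = 0 by [].
rewrite sE; suff -> : coef_image q' s = 0 by rewrite (image_elt0 hR hF).
have [a wa] := wq; move: wa; rewrite wE val_rees_elt; last by case: Sb.
move=> /(congr1 (fun u : {poly R} => u`_q')); rewrite !coefZ !coefXn eqxx mulr1 => ->.
by rewrite eq_sym (negPf qq') mulr0.
Qed.

Definition den (q : nat) (w : R) : mulset (denoms P) := insubd (mulset1 (denoms P)) (rees_elt F q w).

Lemma val_den q w : unit_at q w -> val (den q w) = rees_elt F q w.
Proof. by move=> uw; rewrite /den val_insubd ifT //; apply: unit_at_denoms. Qed.

(** The fraction [a / w], for [a] in [I ^ q] and [w] of degree [q]. *)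
Definition ffrac (q : nat) (a w : R) : fiber P := insubd (0 : fiber P) (fracr (rees_elt F q a) (den q w)).

Lemma val_ffrac q a w : idealX I q a -> unit_at q w ->
  val (ffrac q a w) = fracr (rees_elt F q a) (den q w).
Proof.
move=> Ia uw; rewrite /ffrac val_insubd ifT //; apply/fiberP.
exists q, (rees_elt F q a), (den q w); split=> //.
  by exists a; rewrite val_rees_elt.
by rewrite val_den //; exists w; rewrite val_rees_elt //; apply: unit_at_idealX.
Qed.

Lemma ffrac_eq q a w q' a' w' : idealX I q a -> unit_at q w -> idealX I q' a' -> unit_at q' w' ->
  ffrac q a w = ffrac q' a' w' <-> exists q1 w1, unit_at q1 w1 /\ w1 * (w' * a - w * a') = 0.
Proof.
move=> Ia uw Ia' uw'; have Iw := unit_at_idealX uw; have Iw' := unit_at_idealX uw'.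
have mulE q1 w1 : idealX I q1 w1 -> val (rees_elt F q1 w1 *
    (rees_elt F q' w' * rees_elt F q a - rees_elt F q w * rees_elt F q' a')) =
    (w1 * (w' * a - w * a')) *: 'X^(q1 + (q + q')).
  move=> Iw1; rewrite !rees_eltM // [(q' + q)%N]addnC.
  have I1 : idealX I (q + q') (w' * a) by rewrite addnC; apply: idealXD.
  have I2 : idealX I (q + q') (w * a') by apply: idealXD.
  rewrite rmorphM rmorphB /= !val_rees_elt // -scalerBl.
  by rewrite -scalerAl -scalerAr scalerA -exprD.
split=> [E|[q1 [w1 [uw1 E]]]].
  have : fracr (rees_elt F q a) (den q w) = fracr (rees_elt F q' a') (den q' w') by rewrite -!val_ffrac // E.
  move=> /eqP/fracrP[v vD]; rewrite !val_den // => E'.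
  have /denomsP[s [sv Ps [q1 /(image_grP hR hF) sE]]] := vD.
  have Sb := coef_imageP hR hF q1 s.
  exists q1, (coef_image q1 s); split; first by split=> //; rewrite -sE.
  have vE : v = rees_elt F q1 (coef_image q1 s) by rewrite -sv {1}sE (val_image_elt hR hF).
  move: E'; rewrite vE => /(congr1 val); rewrite mulE; last by case: Sb.
  move=> /(congr1 (fun u : {poly R} => u`_(q1 + (q + q')))).
  by rewrite coefZ coefXn eqxx mulr1 rmorph0 coef0.
apply: val_inj; rewrite !val_ffrac //; apply/eqP/fracrP; exists (rees_elt F q1 w1).
  exact: unit_at_denoms.
rewrite !val_den //; apply: val_inj; rewrite mulE; last exact: unit_at_idealX.
by rewrite E scale0r rmorph0.
Qed.

Lemma ffracM q a w q' a' w' : idealX I q a -> unit_at q w -> idealX I q' a' -> unit_at q' w' ->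
  ffrac q a w * ffrac q' a' w' = ffrac (q + q') (a * a') (w * w').
Proof.
move=> Ia uw Ia' uw'; apply: val_inj; rewrite rmorphM /= !val_ffrac //.
- rewrite [LHS]fracrM rees_eltM //; congr fracr; apply: val_inj => /=.
  rewrite !val_den // ?rees_eltM //; [exact: unit_at_idealX..|exact: unit_atM].
- exact: idealXD.
- exact: unit_atM.
Qed.

Lemma ffrac_scale q a w q' w' : idealX I q a -> unit_at q w -> unit_at q' w' ->
  ffrac q a w = ffrac (q' + q) (w' * a) (w' * w).
Proof.
move=> Ia uw uw'; apply/ffrac_eq => //; [|exact: unit_atM|].
  by apply: idealXD => //; apply: unit_at_idealX.
by exists 0%N, 1; split; [exact: unit_at1|ring].
Qed.

Lemma ffracD q a a' w : idealX I q a -> idealX I q a' -> unit_at q w ->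
  ffrac q (a + a') w = ffrac q a w + ffrac q a' w.
Proof.
move=> Ia Ia' uw; have [_ JD _] := idealX_ideal I q.
apply: val_inj; rewrite rmorphD /= !val_ffrac //; last exact: JD.
rewrite rees_eltD // /fracr fracD -!/(fracr _ _) -scalerDr.
by apply/eqP/fracrP; exists 1; rewrite ?rpred1 // mul1r [val _]/= -mulrA subrr.
Qed.

Lemma ffrac0 q w : unit_at q w -> ffrac q 0 w = 0.
Proof.
move=> uw; have [J0 _ _] := idealX_ideal I q; apply: val_inj.
by rewrite val_ffrac // rees_elt0 rmorph0 /= /fracr frac0.
Qed.

Lemma ffrac_eq0 q a w : idealX I q a -> unit_at q w ->
  ffrac q a w = 0 <-> exists q1 w1, unit_at q1 w1 /\ w1 * a = 0.
Proof.
move=> Ia uw; rewrite -(ffrac0 unit_at1).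
have [J0 _ _] := idealX_ideal I 0.
have H := ffrac_eq Ia uw J0 unit_at1.
by split=> [/H|] [q1 [w1 [u1 E]]]; [|apply/H]; exists q1, w1;
  rewrite mul1r mulr0 subr0 in E *.
Qed.

Lemma ffrac_sum q w (J : Type) (s : seq J) (Q : pred J) (f : J -> R) : unit_at q w ->
  (forall j, idealX I q (f j)) ->
  \sum_(j <- s | Q j) ffrac q (f j) w = ffrac q (\sum_(j <- s | Q j) f j) w.
Proof.
move=> uw If; rewrite [LHS](_ : _ = ffrac q (\sum_(j <- s | Q j) f j) w) //.
have hI := idealX_ideal I q; have [J0 JD _] := hI.
elim: s => [|j s IH]; first by rewrite !big_nil ffrac0.
rewrite !big_cons; case: ifP => // _; rewrite IH -ffracD //.
exact: is_ideal_sum.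
Qed.

Local Notation fx := (fiber_cst P \o x).
Local Notation zfib := (zpiece (0 : (fiber P)^o) (fiber_gr G d)).

Lemma fiber_cstE a : fiber_cst P a = ffrac 0 a 1.
Proof.
apply: val_inj; rewrite val_ffrac //; last exact: unit_at1.
rewrite /=; congr fracr; apply: val_inj => /=.
  by rewrite val_rees_elt // expr0 alg_polyC.
by rewrite val_den ?rees_elt1 //; apply: unit_at1.
Qed.

Lemma fiber_cst_ffrac v q a w : idealX I q a -> unit_at q w ->
  fiber_cst P v * ffrac q a w = ffrac q (v * a) w.
Proof. by move=> Ia uw; rewrite fiber_cstE ffracM ?mul1r ?add0n //; apply: unit_at1. Qed.

Lemma fiber_grP p y : fiber_gr G d p y <->
  exists q a w, [/\ A (p%:Z, q%:Z) a, unit_at q w & y = ffrac q a w].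
Proof.
split=> [[q [u [w [[a Ga ua] wq yE]]]]|[q [a [w [[Ia Ga] uw ->]]]]].
  have [b ub wE] := denoms_unit_at wq.
  have Ia : idealX I q a.
    by have /reesP/(_ q) := valP u; rewrite ua coefZ coefXn eqxx mulr1.
  exists q, a, b; split=> //; apply: val_inj; rewrite yE val_ffrac //.
  congr fracr; first exact: val_inj_rees_elt.
  by apply: val_inj; rewrite val_den.
exists q, (rees_elt F q a), (den q w); split.
- by exists a; rewrite ?val_rees_elt.
- by rewrite val_den //; exists w; rewrite val_rees_elt //; apply: unit_at_idealX.
exact: val_ffrac.
Qed.

Lemma zfibP p y : zfib p y <->
  exists q a w, [/\ A (p, q%:Z) a, unit_at q w & y = ffrac q a w].
Proof.
case: p => [p|p]; first exact: fiber_grP.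
split=> [->|[q [a [w [Aa uw ->]]]]].
  by exists 0%N, 0, 1; split; [|exact: unit_at1|rewrite ffrac0 //; exact: unit_at1].
by have -> : a = 0 by []; rewrite ffrac0.
Qed.

Lemma fiber_gr_x j : fiber_gr G d 1 (fx j).
Proof.
apply/fiber_grP; exists 0%N, (x j), 1; split; [exact: (piece_x d F hR)|exact: unit_at1|].
exact: fiber_cstE.
Qed.

Lemma fiber_gr1 : fiber_gr G d 0 (1 : fiber P).
Proof.
apply/fiber_grP; exists 0%N, 1, 1; split; [by have [] := hA|exact: unit_at1|].
rewrite -fiber_cstE; apply: val_inj; rewrite rmorph1 /=; congr fracr.
by apply: val_inj; rewrite rmorph1; apply: polyC1.
Qed.

Lemma fiber_grM p q a b : @fiber_gr _ _ _ F P G d p a -> fiber_gr G d q b ->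
  fiber_gr G d (p + q) (a * b).
Proof.
move=> /fiber_grP[q1 [a1 [w1 [Aa1 u1 ->]]]] /fiber_grP[q2 [a2 [w2 [Aa2 u2 ->]]]].
apply/fiber_grP; exists (q1 + q2)%N, (a1 * a2), (w1 * w2); split.
- by have [_ _ AM] := hA; apply: (AM (p%:Z, q1%:Z) (q%:Z, q2%:Z)).
- exact: unit_atM.
- by rewrite ffracM //; apply: piece_idealX; eauto.
Qed.

Lemma fiber_grB p a b : @fiber_gr _ _ _ F P G d p a -> fiber_gr G d p b ->
  fiber_gr G d p (a - b).
Proof.
move=> /fiber_grP[q1 [a1 [w1 [Aa1 u1 ->]]]] /fiber_grP[q2 [a2 [w2 [Aa2 u2 ->]]]].
have [_ AB AM] := hA.
have Sh q w p' q' v : unit_at q w -> A (p', q') v -> A (p', q%:Z + q') (w * v).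
  by move=> [Sw _] Av; rewrite -[p']add0r; apply: (AM (0, q%:Z) (p', q')).
have I1 := piece_idealX Aa1; have I2 := piece_idealX Aa2.
rewrite (ffrac_scale I1 u1 u2) (ffrac_scale I2 u2 u1) [(q1 + q2)%N]addnC [w1 * w2]mulrC.
have A1 := Sh _ _ _ _ _ u2 Aa1; have A2 := Sh _ _ _ _ _ u1 Aa2.
rewrite -PoszD in A1; rewrite addrC -PoszD in A2.
apply/fiber_grP; exists (q2 + q1)%N, (w2 * a1 - w1 * a2), (w2 * w1); split.
- exact: AB.
- exact: unit_atM.
have u21 := unit_atM u2 u1.
have hI := idealX_ideal I (q2 + q1).
have IB : idealX I (q2 + q1) (w2 * a1 - w1 * a2) by apply: (piece_idealX (AB _ _ _ A1 A2)).
rewrite -[w2 * a1 in LHS](subrK (w1 * a2)) ffracD ?addrK //.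
exact: piece_idealX A2.
Qed.

(** The numerators of two presentations in different degrees agree after a
    multiplication by elements outside the prime, which keeps their first degrees
    different. *)
Lemma fiber_gr_inj p q (a : fiber P) : fiber_gr G d p a -> fiber_gr G d q a -> p != q -> a = 0.
Proof.
move=> /fiber_grP[q1 [a1 [w1 [Aa1 u1 aE]]]] /fiber_grP[q2 [a2 [w2 [Aa2 u2 aE']]]] pq.
have I1 := piece_idealX Aa1; have I2 := piece_idealX Aa2.
have /ffrac_eq[] // := etrans (esym aE) aE'; move=> q3 [w3 [u3 E]].
rewrite aE; apply/ffrac_eq0 => //; exists (q3 + q2)%N, (w3 * w2).
split; first exact: unit_atM.
have [_ _ AM] := hA; have [_ _ SM] := hS.
have E' : w3 * w2 * a1 = w3 * w1 * a2.
  by apply/eqP; rewrite -subr_eq0 -!mulrA -mulrBr E.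
have [S32 _] := unit_atM u3 u2; have [S31 _] := unit_atM u3 u1.
have := AM _ _ _ _ S32 Aa1; have := AM _ _ _ _ S31 Aa2; rewrite -E'.
move=> [_ G1] [_ G2]; have [hG _ _ _] := hR.
apply: (graded_inj hG G1 G2).
rewrite -[(q3 + q1 + q2)%N]addnAC eqn_add2r.
by rewrite eq_sym.
Qed.

Lemma fiber_gr0 p : fiber_gr G d p (0 : fiber P).
Proof.
apply/fiber_grP; exists 0%N, 0, 1; split; [exact: A0|exact: unit_at1|].
by rewrite ffrac0 //; apply: unit_at1.
Qed.

Lemma fiber_gr_mulx p j (v : (fiber P)^o) : fiber_gr G d p v -> fiber_gr G d p.+1 (fx j *: v).
Proof. by move=> Gv; rewrite -add1n; apply: fiber_grM => //; apply: fiber_gr_x. Qed.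

Lemma fiber_cohomologyP i l :
  local_cohomology_neq0 (@fiber_gr _ _ _ F P G d) fx
    (fiber_gr G d : nat -> set (fiber P)^o) i l <->
  cohomology_neq0 fx zfib (fun=> [set 0]) i l.
Proof.
apply: local_cohomologyP.
- exact: fiber_gr_x.
- exact: fiber_gr1.
- exact: fiber_grM.
- exact: fiber_gr_inj.
- exact: fiber_gr0.
- exact: fiber_grB.
- exact: fiber_gr_mulx.
Qed.

Lemma zfib_gsub : gsub fx zfib.
Proof. by apply: zpiece_gsub; [exact: fiber_gr0|exact: fiber_grB|exact: fiber_gr_mulx]. Qed.

Lemma fiber_nonzero : (1 : fiber P) != 0.
Proof.
apply/eqP => E; have : ffrac 0 1 1 = 0.
  rewrite -E -fiber_cstE; apply: val_inj; rewrite rmorph1 /=; congr fracr.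
  by apply: val_inj; rewrite rmorph1; apply: polyC1.
move=> /ffrac_eq0[] //; first exact: unit_at1.
move=> q [w [[Sw Pw]]]; rewrite mulr1 => w0; apply: Pw; rewrite w0 (image_elt0 hR hF).
by have [[]] := specP P.
Qed.

Lemma mon_ffrac s N e a w : idealX I N a -> unit_at N w ->
  mon fx s ^+ e *: (ffrac N a w : (fiber P)^o) = ffrac N (mon x s ^+ e * a) w.
Proof.
move=> Ia uw; have [_ _ JM] := idealX_ideal I N.
have monfr b : idealX I N b -> mon fx s * ffrac N b w = ffrac N (mon x s * b) w.
  move=> Ib; rewrite /mon; elim/big_rec2: _ b Ib => [b Ib|j v u _ IH b Ib].
    by rewrite !mul1r.
  rewrite -mulrA IH // fiber_cst_ffrac ?mulrA //.
  exact: JM.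
elim: e => [|e IH]; first by rewrite !expr0 scale1r mul1r.
by rewrite !exprS -scalerA IH -mulrA; apply: monfr; apply: JM.
Qed.

Lemma dif_ffrac N e (b : {set 'I_n} -> R^o) w t : (forall s, idealX I N (b s)) -> unit_at N w ->
  dif fx e (fun s => ffrac N (b s) w : (fiber P)^o) t = ffrac N (dif x e b t) w.
Proof.
move=> Ib uw; have [_ _ JM] := idealX_ideal I N.
rewrite /dif -ffrac_sum // => [|j]; last exact: JM.
apply: eq_bigr => j _.
have powfr v : idealX I N v -> fx j ^+ e * ffrac N v w = ffrac N (x j ^+ e * v) w.
  move=> Iv; elim: e => [|e' IH]; first by rewrite !expr0 !mul1r.
  by rewrite !exprS -mulrA IH fiber_cst_ffrac ?mulrA //; apply: JM.
rewrite -[RHS]/(ffrac N ((sgn R t j * x j ^+ e) * b (t :\ j)) w).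
rewrite -[LHS]/((sgn (fiber P) t j * fx j ^+ e) * ffrac N (b (t :\ j)) w).
rewrite -!mulrA powfr // /sgn -[in LHS]signr_odd -[in RHS]signr_odd.
case: odd; rewrite !(expr0, expr1, mul1r, mulN1r) //.
have Ib' := JM (x j ^+ e) _ (Ib (t :\ j)).
apply/eqP; rewrite eq_sym -addr_eq0 -ffracD // ?addNr ?ffrac0 //.
by rewrite -mulN1r; apply: JM.
Qed.

Lemma ffrac_cochains N l b w : unit_at N w ->
  cochains x (slice A N%:Z) (fun=> [set 0]) l b ->
  cochains fx zfib (fun=> [set 0]) l (fun e s => ffrac N (b e s) w).
Proof.
move=> uw [Zb Bb]; split.
  by apply: ultimatelyW Zb => e Zb s; apply/zfibP; exists N, (b e s), w; split=> //; apply: Zb.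
apply: ultimatelyW2 Zb Bb => e Zb Bb s; rewrite /defect /=.
have Ib := piece_idealX (Zb s).
rewrite -[mon fx s]expr1 mon_ffrac // expr1.
have /eqP := Bb s; rewrite /defect subr_eq0 => /eqP ->.
by rewrite subrr.
Qed.

Lemma common_denominator (p : {set 'I_n} -> int) (y : {set 'I_n} -> fiber P) :
  (forall s, zfib (p s) (y s)) -> exists Q W (b : {set 'I_n} -> R^o),
  [/\ unit_at Q W, forall s, A (p s, Q%:Z) (b s), forall s, y s = ffrac Q (b s) W &
      forall s, y s = 0 -> b s = 0].
Proof.
move=> Zy; have /choice[qaw H] : forall s, exists qaw : nat * R * R,
    [/\ A (p s, qaw.1.1%:Z) qaw.1.2, unit_at qaw.1.1 qaw.2,
        y s = ffrac qaw.1.1 qaw.1.2 qaw.2 & y s = 0 -> qaw.1.2 = 0].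
  move=> s; have [y0|y0] := pselect (y s = 0).
    exists (0%N, 0, 1); have u1 := unit_at1.
    by split; [exact: A0|exact: u1|rewrite y0 ffrac0|].
  by have /zfibP[q [a [w [Aa uw yE]]]] := Zy s; exists (q, a, w).
have [_ _ AM] := hA.
exists (\sum_s (qaw s).1.1)%N, (\prod_s (qaw s).2).
exists (fun s => (\prod_(t | t != s) (qaw t).2) * (qaw s).1.2).
have ut s : unit_at (\sum_(t | t != s) (qaw t).1.1) (\prod_(t | t != s) (qaw t).2).
  by apply: unit_at_prod => t; have [] := H t.
have qE s : (\sum_s (qaw s).1.1 = \sum_(t | t != s) (qaw t).1.1 + (qaw s).1.1)%N.
  by rewrite (bigD1 s) //= addnC.
split.
- by apply: unit_at_prod => t; have [] := H t.
- move=> s; have [Aa _ _ _] := H s; rewrite (qE s) PoszD -[p s]add0r.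
  by apply: (AM (0, _) (p s, _)) => //; have [] := ut s.
- move=> s; have [Aa uw yE _] := H s.
  rewrite yE (ffrac_scale (piece_idealX Aa) uw (ut s)) -(qE s); congr ffrac.
  by rewrite [RHS](bigD1 s) //= mulrC.
by move=> s y0; have [_ _ _ ->] := H s; rewrite ?mulr0.
Qed.

Lemma common_annihilator (v : {set 'I_n} -> R) :
  (forall s, exists q w, unit_at q w /\ w * v s = 0) ->
  exists q w, unit_at q w /\ forall s, w * v s = 0.
Proof.
move=> H; have /choice[qw Hqw] : forall s, exists qw : nat * R,
    unit_at qw.1 qw.2 /\ qw.2 * v s = 0.
  by move=> s; have [q [w Hqw]] := H s; exists (q, w).
exists (\sum_s (qw s).1)%N, (\prod_s (qw s).2); split.
  by apply: unit_at_prod => t; have [] := Hqw t.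
by move=> s; have [_ E] := Hqw s; rewrite (bigD1 s) //= mulrAC E mul0r.
Qed.

Let gA q : gsub x (slice A q).
Proof.
apply: (slice_gsub hA (piece_x d F hR)).
exact: (A_gideal hA).
Qed.
Let g0 : gsub x (fun=> [set (0 : R^o)]) := gsub_zero x _.

Lemma unit_atA q w p q' v : unit_at q w -> A (p, q'%:Z) v -> A (p, (q + q')%N%:Z) (w * v).
Proof.
move=> [Sw _] Av; have [_ _ AM] := hA; rewrite -[p]add0r PoszD.
exact: (AM (0, q%:Z) (p, q'%:Z)).
Qed.

(** With [cocycle_fiber], this says that the cohomology of the fiber is the
    localization of the one of the Rees algebra. A cocycle of the fiber
    is generated by one level, whose finitely many components have a common
    denominator, and one multiplier makes the numerators a cocycle. *)
Lemma fiber_cocycle i l : cohomology_neq0 fx zfib (fun=> [set 0]) i l ->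
  exists (q : nat) c, [/\ supported i c, cocycles x (slice A q%:Z) (fun=> [set 0]) l c &
    forall q' f, unit_at q' f ->
      ~ coboundaries x (slice A (q' + q)%N%:Z) (fun=> [set 0]) l (f *: c)].
Proof.
move=> [c' [ci [hc' dc'] nb]]; have [Zc' _] := hc'.
have gz := gsub_zero fx (fiber P)^o.
have [e0 /(_ _ (leqnn e0))[[{}Zc' lev] {}dc']] :=
  ultimatelyI (ultimatelyI Zc' (cochains_levels gz hc')) dc'.
have [Q [W [b [uW Ab cE b0]]]] := common_denominator Zc'.
have Ib s := piece_idealX (Ab s).
have [Q' [W' [uW' dW']]] : exists q w, unit_at q w /\ forall t, w * dif x e0 b t = 0.
  apply: common_annihilator => t; apply/(ffrac_eq0 _ uW).
    have [_ _ JM] := idealX_ideal I Q; apply: is_ideal_sum; first exact: idealX_ideal.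
    by move=> j _; apply: JM.
  rewrite -dif_ffrac // (_ : (fun s => ffrac Q (b s) W) = c' e0); first exact: dc'.
  by apply/funext => s; rewrite cE.
exists (Q' + Q)%N, (gen x e0 (W' *: b)).
have AWb s : A (deg l e0 s, (Q' + Q)%N%:Z) (W' *: b s) by apply: unit_atA.
split.
- by move=> e s si; rewrite /gen !fctE b0 ?scaler0 // ci.
- split; first by apply: (cochains_gen (gA _) g0).
  exists e0 => e le t; rewrite /difs dif_gen // difZ.
  by rewrite [W' *: _]dW' scaler0.
move=> q' f uf [bt hbt cbt]; apply: nb.
have ufW := unit_atM uf (unit_atM uW' uW).
exists (fun e s => ffrac (q' + (Q' + Q)) (bt e s) (f * (W' * W))); first exact: ffrac_cochains.
have [Zbt _] := hbt.
have [e1 He1] := ultimatelyI Zbt cbt.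
exists (maxn e0 e1) => e; rewrite geq_max => /andP[le0 le1] s; rewrite !fctE /difs.
have [{}Zbt {}cbt] := He1 e le1.
have Ibt t := piece_idealX (Zbt t).
rewrite dif_ffrac // /=; apply/eqP; rewrite subr_eq0; apply/eqP.
have /eqP := lev e s le0; rewrite subr_eq0 => /eqP ->.
have [_ _ JM] := idealX_ideal I Q.
rewrite cE mon_ffrac // (ffrac_scale (JM _ _ (Ib s)) uW uW').
have Ia := JM (mon x s ^+ (e - e0)) _ (Ib s).
rewrite (ffrac_scale _ (unit_atM uW' uW) uf); last first.
  by apply: idealXD => //; apply: unit_at_idealX.
have E : f * (mon x s ^+ (e - e0) * (W' * b s)) = dif x e (bt e) s.
  by apply/eqP; rewrite -subr_eq0; apply/eqP; exact: cbt s.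
rewrite -E; congr (ffrac _ _ _); ring.
Qed.

(** The denominator that makes [c] a cochain of degree [0] in the fiber is a power of some
    [F i] outside the prime. *)
Lemma cocycle_fiber i l (q : nat) c : supported i c ->
  cocycles x (slice A q%:Z) (fun=> [set 0]) l c ->
  (forall q' f, unit_at q' f ->
      ~ coboundaries x (slice A (q' + q)%N%:Z) (fun=> [set 0]) l (f *: c)) ->
  cohomology_neq0 fx zfib (fun=> [set 0]) i l.
Proof.
move=> ci [hc dc] nb.
have [i0 ni0] := proj_F hR hF P; have uf := proj_power hR hF q ni0.
set f0 := F i0 ^+ q in uf.
have gz := gsub_zero fx (fiber P)^o; have [Zc _] := hc.
have hc' := ffrac_cochains uf hc.
exists (fun e s => ffrac q (c e s) f0); split.
- by move=> e s si; rewrite ci // ffrac0.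
- split=> //; apply: ultimatelyW2 Zc dc => e Zc dc t; rewrite /difs dif_ffrac //.
    by have := dc t; rewrite /difs /= => ->; rewrite ffrac0.
  by move=> s; apply: piece_idealX (Zc s).
move=> [b [Zb Bb] cb].
have [e1 /(_ _ (leqnn e1))[[[{}Zc lev] {}Zb] {}cb]] := ultimatelyI
  (ultimatelyI (ultimatelyI Zc (cochains_levels g0 hc)) Zb) cb.
have [Q [W [b' [uW Ab bE _]]]] := common_denominator Zb.
have Ib s := piece_idealX (Ab s).
have Ic s := piece_idealX (Zc s).
have Id t : idealX I Q (dif x e1 b' t).
  have [_ _ JM] := idealX_ideal I Q; apply: is_ideal_sum; first exact: idealX_ideal.
  by move=> j _; apply: JM.
have [Q' [W' [uW' dW']]] : exists q w, unit_at q w /\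
    forall t, w * (W * c e1 t - f0 * dif x e1 b' t) = 0.
  apply: common_annihilator => t; apply/(ffrac_eq (Ic t) uf (Id t) uW).
  have /eqP := cb t; rewrite !fctE /difs subr_eq0 => /eqP ->.
  rewrite -dif_ffrac // (_ : (fun s => ffrac Q (b' s) W) = b e1) //.
  by apply/funext => s; rewrite bE.
apply: (nb _ _ (unit_atM uW' uW)).
have Ab' s : A (deg l e1 s, (Q' + Q + q)%N%:Z) (W' * (f0 * b' s)).
  by rewrite -addnA [(Q + q)%N]addnC; apply: unit_atA => //; apply: unit_atA.
exists (gen x e1 (fun s => W' * (f0 * b' s) : R^o)).
  by apply: (cochains_gen (gA _) g0).
exists e1 => e le t; rewrite !fctE /difs dif_gen //=.
have /eqP := lev e t le; rewrite subr_eq0 => /eqP ->.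
have -> : dif x e1 (fun s => W' * (f0 * b' s) : R^o) t = W' * (f0 * dif x e1 b' t).
  have -> : (fun s => W' * (f0 * b' s) : R^o) = (W' * f0) *: b'.
    by apply/funext => s; rewrite mulrA.
  by rewrite difZ mulrA.
have /eqP := dW' t; rewrite mulrBr subr_eq0 => /eqP E.
rewrite -E /GRing.scale /=; ring.
Qed.

End FiberCohomology.

(** * Suprema of sets of extended integers *)

Lemma int_max (E : set int) (M : int) : E !=set0 -> (forall y, E y -> y <= M) ->
  exists2 y, E y & forall z, E z -> z <= y.
Proof.
move=> [y0 Ey0] EM; have [k] : exists k : nat, M - y0 <= k%:Z.
  by exists `|M - y0|%N; lia.
elim: k y0 Ey0 => [|k IH] y0 Ey0 hk.
  by exists y0 => // z /EM; lia.
have [[z Ez y0z]|H] := pselect (exists2 z, E z & y0 < z); first by apply: (IH z) => //; lia.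
by exists y0 => // z Ez; rewrite leNgt; apply/negP => lt; apply: H; exists z.
Qed.

Lemma supremums_neq0 (E : set (\bar int)) : supremums E !=set0.
Proof.
have [[M EM]|nM] := pselect (exists M : int, forall y, E y -> (y <= M%:E)%E); last first.
  exists +oo%E; split=> [y _|[z||] // zE]; first exact: leey.
    by case: nM; exists z.
  by case: nM; exists 0 => y /zE; rewrite leeNy_eq => /eqP ->; rewrite leNye.
have [ex|nex] := pselect ([set y : int | E y%:E] !=set0).
  have [y Ey ymax] := @int_max [set y : int | E y%:E] M ex (fun y Ey => EM _ Ey).
  exists y%:E; split=> [[z||] Ez|z]; last exact.
  - by rewrite lee_fin; apply: ymax.
  - by have := EM _ Ez.
  - exact: leNye.
exists -oo%E; split=> [[z||] Ez|z _]; last exact: leNye.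
- by case: nex; exists z.
- by have := EM _ Ez.
- by [].
Qed.

Lemma maxz_ub (E : set (\bar int)) y : E y -> (y <= maxz E)%E.
Proof.
move=> Ey; rewrite /maxz /supremum ifF; last by apply/negbTE/set0P; exists y.
by have [+ _] := xgetPex -oo%E (supremums_neq0 E); apply.
Qed.

Lemma maxz_le (E : set (\bar int)) z : (forall y, E y -> (y <= z)%E) -> (maxz E <= z)%E.
Proof.
move=> Ez; rewrite /maxz /supremum; case: ifP => _; first exact: leNye.
by have [_] := xgetPex -oo%E (supremums_neq0 E); apply.
Qed.

Section Regularity.
Variables (A : comPzRingType) (GA : nat -> set A) (r : nat) (x : 'I_r -> A).
Variables (M : lmodType A) (GM : nat -> set M).

Local Notation neq0 := (local_cohomology_neq0 GA x GM).
Local Notation reg := (regularity GA x GM).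

Lemma regularity_ub i l : neq0 i l -> ((l + i%:Z)%:E <= reg)%E.
Proof.
move=> H; apply: (@le_trans _ _ (a_invariant GA x GM i + (i%:Z)%:E)%E); last first.
  by apply: maxz_ub; exists i.
have : (l%:E <= a_invariant GA x GM i)%E by apply: maxz_ub; exists l.
case: (a_invariant _ _ _ _) => [y||] //=; last by rewrite addye ?leey.
by rewrite -EFinD !lee_fin lerD2r.
Qed.

Lemma regularity_le z : (forall i l, neq0 i l -> ((l + i%:Z)%:E <= z)%E) -> (reg <= z)%E.
Proof.
move=> H; apply: maxz_le => _ [i _ <-] /=.
case: z H => [z||] H; [|exact: leey|].
  have : (a_invariant GA x GM i <= (z - i%:Z)%:E)%E.
    apply: maxz_le => _ [l hl <-]; have := H i l hl; rewrite !lee_fin; lia.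
  case: (a_invariant _ _ _ _) => [y hy|//|_]; last exact: leNye.
  by rewrite -EFinD lee_fin; rewrite lee_fin in hy; lia.
suff -> : a_invariant GA x GM i = -oo%E by [].
apply/eqP; rewrite -leeNy_eq; apply: maxz_le => _ [l hl <-].
by have := H i l hl.
Qed.

End Regularity.

Lemma cohomology_neq0_le (K : comPzRingType) (r : nat) (x : 'I_r -> K) (V : lmodType K)
  (Z B : int -> set V) i p : gsub x Z -> gsub x B -> cohomology_neq0 x Z B i p -> (i <= r)%N.
Proof.
move=> hZ hB [c [ci _ nb]]; rewrite leqNgt; apply/negP => ri; apply: nb.
suff -> : c = 0 by apply: coboundaries0.
apply/funext => e; apply/funext => s; apply: ci.
by rewrite ltn_eqF // (leq_ltn_trans _ ri) // -[X in (_ <= X)%N](card_ord r) max_card.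
Qed.

(** * Powers of the ideal and fibers *)

Section Powers.
Variables (k : fieldType) (R : comAlgType k) (G : nat -> set R) (n : nat)
  (x : 'I_n -> R) (m d : nat) (F : 'I_m -> R).
Hypothesis hR : standard_graded G x.
Hypothesis hF : forall i, G d (F i).

Local Notation I := (base_ideal F).
Local Notation A := (rees_piece G d F).
Local Notation S := (degree0 G d F).
Local Notation Proj_image := (Proj (@image_gr k R m F)).
Local Notation Bz := (fun _ : int => [set (0 : R^o)]).
Local Notation coh q i l := (cohomology_neq0 x (slice A q) Bz i l).

Let hG : graded_ring G. Proof. by have [] := hR. Qed.
Let hA : graded_pieces A. Proof. exact: (pieces_graded d F hR). Qed.
Let A0 g : A g 0. Proof. exact: (piece0 d F hR). Qed.
Let hS := degree0_graded d F hR.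
Let hAA : gideal A A := A_gideal hA A0.

Let hB0 : gideal A (fun=> [set 0]).
Proof. by split=> [g _ ->|g|g a b -> ->|g h a b _ ->]; rewrite ?addr0 ?mulr0. Qed.

Let gA q : gsub x (slice A q) := slice_gsub hA (piece_x d F hR) q hAA.
Let g0 : gsub x Bz := gsub_zero x _.

Section PowerModule.
Variable q : nat.
Local Notation Gq := (fun l : nat => [set a : powmod I q | G l (val a)]).
Local Notation Zq := (zpiece (0 : powmod I q) Gq).
Local Notation B0 := (fun _ : int => [set (0 : powmod I q)]).

Lemma val_linear : linear (val : powmod I q -> R^o).
Proof. exact: linearP. Qed.

Let val0 : val (0 : powmod I q) = 0. Proof. exact: (lin0 val_linear). Qed.
Let valD (u v : powmod I q) : val (u - v) = val u - val v.
Proof. exact: (linB val_linear). Qed.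
Let valZ' (a : R) (v : powmod I q) : val (a *: v) = a *: val v.
Proof. exact: (linZ val_linear). Qed.

Let gZq : gsub x Zq.
Proof.
have [_ _ Gx _] := hR; apply: zpiece_gsub.
- by move=> p; change (G p (val (0 : powmod I q))); rewrite val0; apply: graded0.
- by move=> p u v Gu Gv; change (G p (val (u - v))); rewrite valD; apply: gradedB.
- by move=> p j v Gv; change (G p.+1 (val (x j *: v))); rewrite valZ' -add1n; apply: gradedM.
Qed.

Definition to_powmod (c : nat -> {set 'I_n} -> R^o) : nat -> {set 'I_n} -> powmod I q :=
  fun e s => insubd (0 : powmod I q) (c e s).

Definition of_powmod (c : nat -> {set 'I_n} -> powmod I q) : nat -> {set 'I_n} -> R^o :=
  fun e s => val (c e s).

Lemma to_powmodK a : idealX I q a -> val (insubd (0 : powmod I q) a) = a.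
Proof. by move=> Ia; rewrite val_insubd ifT //; apply/powmodP. Qed.

Lemma powmod_piece p (v : powmod I q) : Zq p v -> A (p - (q * d)%N%:Z, q%:Z) (val v).
Proof.
case: p => [p|p]; last by move=> ->; rewrite val0; apply: A0.
move=> Gv; have Iv := elimT (powmodP I q (val v)) (valP v).
have [le|lt] := leqP (q * d) p; last by rewrite (idealX_low hR hF Iv Gv lt); apply: A0.
by rewrite subzn //; split=> //; rewrite subnK.
Qed.

Lemma piece_powmod p (a : R) : A (p, q%:Z) a ->
  Zq (p + (q * d)%N%:Z) (insubd (0 : powmod I q) a).
Proof.
move=> Aa; have Ia := piece_idealX Aa.
case: p Aa => [p|p] Aa; first by rewrite /= to_powmodK //; case: Aa.
have -> : insubd (0 : powmod I q) a = 0.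
  by apply: val_inj; rewrite to_powmodK // val0; exact: Aa.
exact: (gsub0 gZq).
Qed.

Lemma to_powmod_cochains l c : cochains x (slice A q%:Z) Bz l c ->
  cochains x Zq B0 (l + (q * d)%N%:Z) (to_powmod c).
Proof.
move=> [Zc Bc]; split.
  by apply: ultimatelyW Zc => e Zc s; rewrite deg_shift; apply/piece_powmod/Zc.
apply: ultimatelyW2 (ultimatelyI Zc (ultimatelyS Zc)) Bc => e [Ze Ze1] Bc s.
apply: val_inj; rewrite /defect valD valZ' val0 /to_powmod.
rewrite !to_powmodK; [exact: Bc|exact: piece_idealX (Ze s)|exact: piece_idealX (Ze1 s)].
Qed.

Lemma to_powmodE l c : ev (slice A q%:Z) l c -> ultimately (fun e =>
  forall s, of_powmod (to_powmod c) e s = c e s).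
Proof.
by apply: ultimatelyW => e Zc s; apply: to_powmodK; apply: piece_idealX (Zc s).
Qed.

(** The local cohomology of the power [I ^ q] is the strand of degree [q] of the
    one of the Rees algebra, with the degrees shifted by [q * d]. *)
Lemma power_cohomologyP i l :
  local_cohomology_neq0 G x Gq i (l + (q * d)%N%:Z) <-> coh q%:Z i l.
Proof.
have [[_ G1 GM _ _] _ Gx _] := hR.
have valZ p v : Zq p v -> slice A q%:Z (p - (q * d)%N%:Z) (val v) by apply: powmod_piece.
have valB (p : int) v : B0 p v -> Bz (p - (q * d)%N%:Z) (val v) by move=> ->; apply: val0.
have difv c e s : of_powmod (difs x c) e s = difs x (of_powmod c) e s.
  by rewrite /difs /of_powmod -(dif_map x val_linear).
apply: (iff_trans (local_cohomologyP Gx G1 GM (graded_inj hG) _ _ _ _ _)).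
- by move=> p; change (G p (val (0 : powmod I q))); rewrite val0; apply: graded0.
- by move=> p u v Gu Gv; change (G p (val (u - v))); rewrite valD; apply: gradedB.
- by move=> p j v Gv; change (G p.+1 (val (x j *: v))); rewrite valZ' -add1n; apply: GM.
split=> [[c [ci hc nb]]|[c [ci [hc dc] nb]]].
  exists (of_powmod c); split.
  - by move=> e s si; rewrite /of_powmod ci // val0.
  - by have := cocycles_map (B' := Bz) val_linear valZ valB hc; rewrite addrK.
  move=> [b hb cb]; apply: nb; exists (to_powmod b); first exact: to_powmod_cochains.
  have [Zb _] := hb; apply: ultimatelyW2 (to_powmodE Zb) cb => e bE cb s.
  apply: val_inj; rewrite [LHS]valD val0 [X in _ - X]difv.
  suff -> : difs x (of_powmod (to_powmod b)) e s = difs x b e s by exact: cb s.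
  by apply: eq_bigr => j _; congr (_ *: _); apply: bE.
have hc' := to_powmod_cochains hc; have [Zc _] := hc.
exists (to_powmod c); split.
- move=> e s si; rewrite /to_powmod ci //; apply: val_inj.
  by rewrite to_powmodK ?val0 //; have [] := idealX_ideal I q.
- split=> //; apply: ultimatelyW2 (to_powmodE Zc) dc => e cE dc s.
  apply: val_inj; rewrite val0 [LHS]difv.
  suff -> : difs x (of_powmod (to_powmod c)) e s = difs x c e s by exact: dc s.
  by apply: eq_bigr => j _; congr (_ *: _); apply: cE.
move=> /(coboundaries_map (B' := Bz) val_linear valZ valB); rewrite addrK => hb; apply: nb.
rewrite -[c](subrK (of_powmod (to_powmod c))); apply: coboundariesD => //.
apply: coboundaries_ev => //; apply: ultimatelyW (to_powmodE Zc) => e cE s.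
by rewrite !fctE cE /= subrr.
Qed.

End PowerModule.

Local Notation neq0_fiber P := (local_cohomology_neq0 (@fiber_gr _ _ _ F P G d)
  (fiber_cst P \o x) (fiber_gr G d : nat -> set (fiber P)^o)).

Definition fiber_support (i : nat) (l : int) : Prop :=
  exists2 P : Proj_image, closed_point P & neq0_fiber P i l.

Lemma rees_cohomology_finite :
  cohomology_bounded x A (fun=> [set 0]) /\ forall p, hacc x A A (fun=> [set 0]) p.
Proof.
apply: (cohomology_finite hA (piece_x d F hR)) => //.
- by move=> p q a; apply: piece_neg1.
- by move=> p q a; apply: (piece_genx hR hF).
- exact: (pieces_noetherian hR hF).
- by move=> g _ ->.
Qed.

Lemma coh_bounded : exists p0, forall q i l, coh q i l -> l < p0.
Proof.
have [[p0 H] _] := rees_cohomology_finite; exists p0 => q i l [c [_ hc nb]].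
by rewrite ltNge; apply/negP => le; apply: nb; apply: H.
Qed.

Lemma coh_le q i l : coh q i l -> (i <= n)%N.
Proof. exact: cohomology_neq0_le. Qed.

(** The multiples of a class by the powers of an [F i] outside the prime stay nonzero, and
    they reach all larger degrees. *)
Lemma fiber_support_coh i l : fiber_support i l ->
  exists q0 : nat, forall q : nat, (q0 <= q)%N -> coh q%:Z i l.
Proof.
move=> [P _ /(fiber_cohomologyP hR hF P) /(fiber_cocycle hR hF)[q0 [c [ci hc nc]]]].
have [i0 ni0] := proj_F hR hF P.
exists q0 => q /subnK <-; have uf := proj_power hR hF (q - q0) ni0.
exists (F i0 ^+ (q - q0) *: c); split; last exact: nc.
  by move=> e s si; rewrite !fctE ci // scaler0.
by rewrite PoszD; apply: (cocyM hAA hB0 uf.1).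
Qed.

(** Every class is killed by the elements of [S] of large degree: otherwise its
    annihilator lies in the ideal of a closed point, where the class survives. Consider
    the submodule of the classes of which all multiples of degree at least [N] vanish.
    It grows with [N], and every class belongs to one of them. Once the chain is
    stationary at [J], the classes of degree at least [J] vanish, as multiples by [1] of
    themselves. *)
Lemma coh_fiber_support i l : ~ fiber_support i l ->
  exists q0 : nat, forall q : nat, (q0 <= q)%N -> ~ coh q%:Z i l.
Proof.
move=> nsup; have [_ acc] := rees_cohomology_finite.
pose cob q := coboundaries x (slice A q) Bz l.
pose coc q := cocycles x (slice A q) Bz l.
have cobM q h f c : S h f -> cob q c -> cob (h + q) (f *: c).
  exact: (cobdM hAA hB0).
have cocM q h f c : S h f -> coc q c -> coc (h + q) (f *: c).
  exact: (cocyM hAA hB0).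
have torsion (q : nat) c : supported i c -> coc q%:Z c -> exists N : nat,
    forall (K : nat) f, (N <= K)%N -> S K%:Z f -> cob (K%:Z + q%:Z) (f *: c).
  move=> ci hc; pose J h := [set f | S h f /\ cob (h + q%:Z) (f *: c)].
  have hJ : gideal S J.
    split=> [h f []//|h|h f f' [Sf Cf] [Sf' Cf']|h h' f f' Sf [Sf' Cf']].
    - by split; [exact: A0|rewrite scale0r; apply: coboundaries0].
    - by split; [exact: (piecesD hS)|rewrite scalerDl; apply: coboundariesD].
    split; first by have [_ _ SM] := hS; apply: SM.
    by rewrite -scalerA -addrA; apply: cobM.
  have [N HN] : exists N : nat, S N%:Z `<=` J N%:Z.
    apply: contrapT => H; apply: nsup.
    have [|P [Pcl JP]] := closed_point_above hR hF (J := J).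
      by split=> // N HN; apply: H; exists N.
    exists P => //; apply/(fiber_cohomologyP hR hF P)/(cocycle_fiber hR hF ci hc).
    move=> q' f [Sf nP]; rewrite PoszD => Cf; apply/nP/JP.
    by split.
  exists N => K f NK Sf.
  by have [] := degree0_up hR hF hJ HN NK Sf.
have [||J HJ] := acc l (fun N q => [set c | coc q c /\ forall h f, S h f ->
    N%:Z <= h + q -> cob (h + q) (f *: c)]).
- move=> N; split.
  + move=> q c hc; split=> [|h f Sf _]; last exact: cobM.
    by apply: coboundaries_cocycles hc => // p _ ->; apply: A0.
  + by move=> q c [].
  + move=> q c c' [hc Hc] [hc' Hc']; split=> [|h f Sf le].
      exact: cocyclesD.
    by rewrite scalerDr; apply: coboundariesD => //; [exact: Hc|exact: Hc'].
  move=> h q a c Sa [hc Hc]; split=> [|h' f Sf le]; first exact: cocM.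
  rewrite scalerA addrA; apply: Hc; first by have [_ _ SM] := hS; apply: SM.
  by rewrite -addrA.
- by move=> N q c [hc Hc]; split=> // h f Sf le; apply: Hc => //; lia.
exists J => q Jq [c [ci hc nc]]; apply: nc.
have [N HN] := torsion q c ci hc.
have [|_ /(_ 0 1)] := HJ (q + N)%N q%:Z c.
  split=> // h f Sf le; case: h Sf le => [h|h] Sf le; last by lia.
  by apply: HN => //; lia.
rewrite add0r scale1r; apply; first by have [] := hS.
by [].
Qed.

(** Every fiber has some nonzero local cohomology; hence without any, the image is
    empty and the powers of the ideal vanish from some point on. *)
Lemma fiber_support_empty : (forall i l, ~ fiber_support i l) ->
  exists q0 : nat, forall (q : nat) i l, (q0 <= q)%N -> ~ coh q%:Z i l.
Proof.
move=> H.
have [N HN] : exists N : nat, S N%:Z `<=` [set 0].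
  apply: contrapT => nN.
  have [|P [Pcl _]] := closed_point_above hR hF (J := fun=> [set 0]).
    split=> [|N SN]; last by apply: nN; exists N.
    split=> [h f ->|//|h f f' -> ->|h h' f f' _ ->]; rewrite ?addr0 ?mulr0 //.
    exact: A0.
  have [||||i [l hil]] := @cohomology_nonvanishing _ _ (fiber_cst P \o x)
    (zpiece (0 : (fiber P)^o) (fiber_gr G d)).
  - exact: (zfib_gsub hR hF).
  - exact: (fiber_gr1 hR hF).
  - by [].
  - exact: (fiber_nonzero hR hF).
  by apply: (H i l); exists P => //; apply/(fiber_cohomologyP hR hF P).
exists N => q i l Nq [c [_ [[Zc _] _] nc]]; apply: nc.
apply: coboundaries_ev => //.
have S0 v : S q%:Z v -> v = 0.
  have h0 : gideal S (fun=> [set 0]).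
    split=> [h f ->|//|h f f' -> ->|h h' f f' _ ->]; rewrite ?addr0 ?mulr0 //.
    exact: A0.
  exact: (degree0_up hR hF h0 HN Nq).
have Az p v : A (p, q%:Z) v -> v = 0.
  case: p => [p|p] //; elim: p v => [|p IH] v //; first exact: S0.
  move=> /(piece_genx hR hF (isT : 0 < p.+1%:Z))[f [Af ->]].
  rewrite big1 // => j _; rewrite (IH (f j)) ?mulr0 //.
  by have := Af j; congr (A (_, _) _); lia.
by apply: ultimatelyW Zc => e Zc s; apply: Az (Zc s).
Qed.

Lemma reg_phi_ub i l : fiber_support i l -> ((l + i%:Z)%:E <= reg_phi F G x d)%E.
Proof.
move=> [P Pcl H]; apply: (le_trans (regularity_ub H)).
by apply: maxz_ub; exists P.
Qed.

Lemma reg_phi_le z : (forall i l, fiber_support i l -> ((l + i%:Z)%:E <= z)%E) ->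
  (reg_phi F G x d <= z)%E.
Proof.
move=> H; apply: maxz_le => _ [P Pcl <-]; apply: regularity_le => i l hil.
by apply: H; exists P.
Qed.

Lemma reg_pow_ub (q : nat) i l : coh q%:Z i l ->
  ((l + (q * d)%N%:Z + i%:Z)%:E <= reg_pow F G x q)%E.
Proof. by move=> /power_cohomologyP; apply: regularity_ub. Qed.

Lemma reg_pow_le (q : nat) z : (forall i l, coh q%:Z i l ->
  ((l + (q * d)%N%:Z + i%:Z)%:E <= z)%E) -> (reg_pow F G x q <= z)%E.
Proof.
move=> H; apply: regularity_le => i l; rewrite -[l](subrK (q * d)%N%:Z).
by move=> /power_cohomologyP; apply: H.
Qed.

(** The maximum of [l + i] over the support of the fibers is attained at a pair
    that belongs to the support of all large powers. Of the pairs with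
    a larger sum only finitely many lie below the uniform bound on the degrees, and
    each of them leaves the support of the powers. *)
Theorem reg_pow_eventually : (reg_phi F G x d < +oo)%E /\
  exists q0 : nat, forall q : nat, (q0 <= q)%N ->
    reg_pow F G x q = (((q * d)%N%:Z)%:E + reg_phi F G x d)%E.
Proof.
have [p0 Hp0] := coh_bounded.
have supp_bound i l : fiber_support i l -> l < p0 /\ (i <= n)%N.
  move=> /fiber_support_coh[q0 /(_ _ (leqnn q0)) Hq].
  by split; [exact: Hp0 Hq|exact: coh_le Hq].
have [[[i0 l0] /= sup0]|nsup] := pselect (exists il, fiber_support il.1 il.2); last first.
  have nsup' i l : ~ fiber_support i l by move=> H; apply: nsup; exists (i, l).
  have -> : reg_phi F G x d = -oo%E.
    by apply/eqP; rewrite -leeNy_eq; apply: reg_phi_le => i l /nsup'.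
  split=> //; have [q0 Hq0] := fiber_support_empty nsup'; exists q0 => q le.
  rewrite addeNy; apply/eqP; rewrite -leeNy_eq; apply: reg_pow_le => i l.
  by move=> /(Hq0 q i l le).
have [||y [i [l [sup1 yE]]] ymax] := @int_max
    [set y | exists i l, fiber_support i l /\ y = l + i%:Z] (p0 + n%:Z).
- by exists (l0 + i0%:Z), i0, l0.
- by move=> y [i [l [/supp_bound[lp il] ->]]]; lia.
have regE : reg_phi F G x d = y%:E.
  apply/eqP; rewrite eq_le; apply/andP; split; last by rewrite yE; apply: reg_phi_ub.
  by apply: reg_phi_le => i' l' H; rewrite lee_fin; apply: ymax; exists i', l'.
rewrite regE; split; first exact: ltry.
have [q1 Hq1] := fiber_support_coh sup1.
have /choice[q2 Hq2] : forall it : nat * nat, exists q2 : nat,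
    ~ fiber_support it.1 (p0 - it.2%:Z) ->
    forall q : nat, (q2 <= q)%N -> ~ coh q%:Z it.1 (p0 - it.2%:Z).
  move=> it; have [H|/coh_fiber_support[q2 Hq2]] := pselect (fiber_support it.1 (p0 - it.2%:Z)).
    by exists 0%N.
  by exists q2.
pose T := (absz (p0 - y + n%:Z)).+1.
exists (maxn q1 (\max_(i < n.+1) \max_(t < T) q2 (i : nat, t : nat))) => q.
rewrite geq_max => /andP[le1 le2]; rewrite -EFinD.
apply/eqP; rewrite eq_le; apply/andP; split; last first.
  have -> : (q * d)%N%:Z + y = l + (q * d)%N%:Z + i%:Z by rewrite yE; ring.
  exact/reg_pow_ub/Hq1.
apply: reg_pow_le => i' l' H; rewrite lee_fin.
suff : l' + i'%:Z <= y by lia.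
rewrite leNgt; apply/negP => lt.
have lp := Hp0 _ _ _ H; have il := coh_le H.
have tE : p0 - `|p0 - l'|%N%:Z = l' by lia.
have tT : (`|p0 - l'|%N < T)%N by rewrite /T; lia.
have := Hq2 (i', `|p0 - l'|%N); rewrite /= tE => /(_ _ q) H2.
apply: H2 H => [/(fun s => ymax _ (ex_intro _ i' (ex_intro _ l' (conj s erefl))))|].
  by lia.
apply: leq_trans le2.
apply: leq_trans (leq_bigmax (Ordinal (il : (i' < n.+1)%N))).
exact: (leq_bigmax (Ordinal tT)).
Qed.

End Powers.

Theorem theorem1p3 (k : fieldType) (R : comAlgType k) (G : nat -> set R)
    (n : nat) (x : 'I_n.+1 -> R) (m d : nat) (F : 'I_m.+1 -> R)
    (hR : standard_graded G x)
    (hX : irreducible [set: Proj G])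
    (hdim : (1%:E <= proj_dim G)%E)
    (hF : forall i, G d (F i))
    (hCM : forall P : Proj (@image_gr k R m.+1 F),
       closed_point P -> cohen_macaulay (fiber P)) :
  (reg_phi F G x d < +oo)%E /\
  exists q0 : nat, forall q : nat, (q0 <= q)%N ->
    reg_pow F G x q = (((q * d)%N%:Z)%:E + reg_phi F G x d)%E.
Proof. exact: reg_pow_eventually. Qed.
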